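(* Let $c_1 := 3^{900}\left(\frac{3}{2}\right)^{5/3}$. Let $a \ge 7$ be an integer, let $K_a = \mathbb{Q}(\rho)$ be the simplest cubic field, where $\rho$ is the largest root of $f_a(X) = X^3 - aX^2 - (a+3)X - 1$, and assume that $\mathcal{O}_{K_a} = \mathbb{Z}[\rho]$. Then for all real $x \ge 1$, \[ \left|P(a,x) - C_{K_a} x\right| \le c_1 (\log a)^{10/3} x^{2/3}. \] In particular, there exist absolute constants $c', c'' > 0$ such that for all such $a$ and all $x \ge c_1^3 a^6 (\log a)^4$, \[ c'\,\frac{(\log a)^2}{a^2}\,x \le P(a,x) \le c''\,\frac{(\log a)^2}{a^2}\,x. \]
   Context: For an integer $a \ge -1$, $K_a$ denotes the splitting field over $\mathbb{Q}$ of $f_a(X) = X^3 - aX^2 - (a+3)X - 1$; it is a totally real cyclic cubic field and $K_a = \mathbb{Q}(\rho)$ with $\rho$ the largest real root of $f_a$. $\mathcal{O}_{K_a}$ is its ring of integers. $P(a,x)$ is the number of nonzero principal ideals $I \subset \mathcal{O}_{K_a}$ with norm $\mathrm{N}(I) \le x$. For a number field $K$ with $r_1$ real embeddings, $2r_2$ complex embeddings, regulator $\mathrm{Reg}_K$, discriminant $\Delta_K$ and $w$ roots of unity, put \[ C_K = \frac{2^{r_1}(2\pi)^{r_2}\mathrm{Reg}_K}{w\sqrt{|\Delta_K|}}; \] for $K = K_a$ one has $r_1 = 3$, $r_2 = 0$, $w = 2$. *)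

(* Defs.v *)
From HB Require Import structures.
From mathcomp Require Import all_boot all_order all_algebra all_field.
From mathcomp Require Import finmap.
From mathcomp Require Import all_classical all_reals.
From mathcomp Require Import topology normedtype sequences exp trigo.
From mathcomp Require Import complex.

Set Implicit Arguments.
Unset Strict Implicit.
Unset Printing Implicit Defensive.

Import Order.TTheory GRing.Theory Num.Theory.
Import numFieldNormedType.Exports.

Local Open Scope classical_set_scope.
Local Open Scope ring_scope.

(* Number of elements of a finite set; the value on infinite sets is 0. *)
Definition ncard (T : choiceType) (A : set T) : nat := #|` fset_set A|.

Section NumberField.
Variable K : fieldExtType rat.

Definition ring_of_integers : set K :=
  [set u | integralOver (intr : int -> K) u].

Local Notation OK := ring_of_integers.

Definition is_principal_ideal (I : set K) : Prop :=
  exists2 alpha, OK alpha & I = [set alpha * u | u in OK].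

(* The index of I in O_K, computed by counting the cosets u + I. *)
Definition ideal_norm (I : set K) : nat :=
  ncard [set [set u + v | v in I] | u in OK].

Definition nb_principal_ideals (R : realType) (x : R) : nat :=
  ncard [set I : set K |
    [/\ is_principal_ideal I, I <> [set 0] & (ideal_norm I)%:R <= x]].

Definition field_trace (u : K) : rat :=
  \tr (passmx.mxof (vbasis {:K}) (vbasis {:K}) (amulr u)).

Definition is_integral_basis (n : nat) (b : 'I_n -> K) : Prop :=
  (forall i, OK (b i)) /\
  (forall u, OK u ->
     exists! m : {ffun 'I_n -> int}, u = \sum_(i < n) b i *~ m i).

(* The value does not depend on the integral basis, whose size n is
   necessarily [K : Q]. *)
Definition field_discriminant : rat :=
  xget 0 [set d | exists n (b : 'I_n -> K), is_integral_basis b /\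
    d = \det (\matrix_(i < n, j < n) field_trace (b i * b j))].

Definition roots_of_unity : set K :=
  [set z | exists2 n : nat, (0 < n)%N & z ^+ n = 1].

Definition is_integral_unit (u : K) : Prop := [/\ u != 0, OK u & OK u^-1].

Definition is_fundamental_units (r : nat) (eps : 'I_r -> K) : Prop :=
  (forall i, is_integral_unit (eps i)) /\
  (forall u, is_integral_unit u ->
     exists! zm : K * {ffun 'I_r -> int},
       roots_of_unity zm.1 /\ u = zm.1 * \prod_(i < r) eps i ^ zm.2 i).

Section Analytic.
Variable R : realType.

Definition is_real_embedding (sigma : K -> R[i]) : Prop :=
  forall u, sigma u \is Num.real.

Definition embeddings : set (K -> R[i]) :=
  [set (sigma : K -> R[i]) | sigma in [set: {rmorphism K -> R[i]}]].

Definition nb_real_embeddings : nat :=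
  ncard (embeddings `&` is_real_embedding).

(* Half the number of nonreal embeddings. *)
Definition nb_complex_places : nat :=
  (ncard (embeddings `\` is_real_embedding))./2.

(* One embedding from each pair of complex conjugate ones. *)
Definition represents_places (n : nat) (sigma : 'I_n -> {rmorphism K -> R[i]})
    : Prop :=
  forall tau : {rmorphism K -> R[i]},
    exists! j, tau =1 sigma j \/ tau =1 (@conjc R \o sigma j).

Definition local_degree (sigma : K -> R[i]) : nat :=
  if `[< is_real_embedding sigma >] then 1%N else 2%N.

(* The condition on sigma forces r + 1 = r1 + r2. The value depends neither on
   the choice of fundamental units nor on the omitted last embedding. *)
Definition regulator : R :=
  xget 0 [set rho | exists r (sigma : 'I_r.+1 -> {rmorphism K -> R[i]})
      (eps : 'I_r -> K),
    [/\ represents_places sigma, is_fundamental_units eps &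
      rho = `| \det (\matrix_(i < r, j < r)
        (let s := sigma (widen_ord (leqnSn r) j) in
         (local_degree s)%:R * ln (Normc.normc (s (eps i))))) | ]].

Definition ideal_density : R :=
  2 ^+ nb_real_embeddings * (2 * pi) ^+ nb_complex_places * regulator /
  ((ncard roots_of_unity)%:R * Num.sqrt `| ratr field_discriminant |).

End Analytic.
End NumberField.

Arguments ring_of_integers : clear implicits.
Arguments roots_of_unity : clear implicits.
Arguments embeddings : clear implicits.

Definition simplest_cubic_poly (a : int) : {poly int} :=
  'X^3 - a *: 'X^2 - (a + 3) *: 'X - 1.

Definition is_largest_real_root (R : realType) (p : {poly int}) (y : R) : Prop :=
  root (map_poly intr p) y /\
  forall z : R, root (map_poly intr p) z -> z <= y.

(* K is a splitting field of f_a over Q, and the embedding iota of K in the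
   reals sends rho to the largest real root of f_a. *)
Definition is_simplest_cubic_field (R : realType) (a : int)
    (K : fieldExtType rat) (iota : {rmorphism K -> R}) (rho : K) : Prop :=
  splittingFieldFor 1%VS (map_poly intr (simplest_cubic_poly a)) {:K} /\
  is_largest_real_root (simplest_cubic_poly a) (iota rho).

Definition is_monogenic (K : fieldExtType rat) (rho : K) : Prop :=
  ring_of_integers K =
    [set (map_poly intr p).[rho] | p in [set: {poly int}]].

(* Main.v *)
(** Every nonzero principal ideal has exactly one generator whose first conjugate is positive and whose
    logarithm vector lies in a fundamental domain for the unit lattice.  That lattice is spanned by a unit
    [u] of minimal length and its conjugate [tau u] (the rotation by 120 degrees makes it hexagonal), and
    both have length of order [ln a]: the upper bound comes from [rho], the lower one from the discriminant
    of [Z[u]].  Cutting the domain into [O(ln a ^+ 2)] pieces brings each of them, after a diagonal rescaling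
    of determinant 1, into a fixed bounded cone.  The rescaled lattice still has norms at least 1, so
    its points in any plane are sparse; this controls the count up to the scale [r] at which the lattice first
    has three independent points, and beyond [r] it has a fundamental cell of size [O(r)].  Hence translating
    the lattice changes the count in the cone dilated by [L] only by [O(L ^+ 2)], uniformly in the lattice, and
    averaging over translations gives volume over covolume. *)
Require Import Defs.
From HB Require Import structures.
From mathcomp Require Import all_boot all_order all_algebra all_field.
From mathcomp Require Import perm.
From mathcomp Require Import finmap.
From mathcomp Require Import all_classical all_reals all_analysis.
From mathcomp Require Import measurable_realfun.
From mathcomp Require Import complex.
From mathcomp Require Import ring lra zify.

Set Implicit Arguments.
Unset Strict Implicit.
Unset Printing Implicit Defensive.

Import Order.TTheory GRing.Theory Num.Theory.
Import numFieldNormedType.Exports.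

Local Open Scope classical_set_scope.
Local Open Scope ring_scope.

(** * Substitutions on the line *)

Section one_dim.
Context {R : realType}.
Local Notation mu := (@lebesgue_measure R).
Local Open Scope ereal_scope.

(** The difficulty is uniformity in [a]: the covolume is [a ^+ 2 + 3 * a + 9] and nothing is known
    about the shape of the lattice, so the error may depend on the field only through the number of
    pieces. The product of the coordinates is kept, up to sign, by every diagonal rescaling of
    determinant 1 or -1, and its lower bound 1 replaces any knowledge of the successive minima. The
    scale [r] cancels from the error: the boundary of the cone is covered by [O((L / r) ^+ 2)] cubes
    of size [O(r)], and each holds [O(r ^+ 2)] lattice points, because it splits into boundedly many
    cubes in which differences of lattice points lie in one plane. A norm bound [x] is a dilation by
    [L] with [L ^+ 3 = x], hence the exponent 2/3. Each unit direction is cut into at most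
    [5 * ln a] parts and there are four sign patterns, so the error is [100 * count_constant * ln a
    ^+ 2 * L ^+ 2]. For the two-sided bound, the density has order [ln a ^+ 2 / a ^+ 2]. The same
    factor [ln a ^+ 2] stands in the error and cancels, so the main term wins once [L] exceeds a
    constant times [a ^+ 2]. *)

Definition pushforwardR (nu : {measure set (measurableTypeR R) -> \bar R})
    (phi : measurableTypeR R -> measurableTypeR R) (mphi : measurable_fun setT phi) :
    {measure set (measurableTypeR R) -> \bar R} :=
  measure_function_pushforward__canonical__measure_function_Measure nu mphi.

Lemma ge0_integral_pushforwardR (nu : {measure set (measurableTypeR R) -> \bar R})
    (phi : measurableTypeR R -> measurableTypeR R) (mphi : measurable_fun setT phi)
    (f : measurableTypeR R -> \bar R) : measurable_fun setT f -> (forall x, 0 <= f x) ->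
  \int[pushforwardR nu mphi]_x f x = \int[nu]_x f (phi x).
Proof.
move=> mf f0; have := @ge0_integral_pushforward _ _ _ _ _ phi mphi nu setT f measurableT mf.
by rewrite preimage_setT; apply => x _.
Qed.

Definition mrestrR (nu : {measure set (measurableTypeR R) -> \bar R})
    (D : set (measurableTypeR R)) (mD : measurable D) :
    {measure set (measurableTypeR R) -> \bar R} :=
  measure_function_mrestr__canonical__measure_function_Measure nu mD.

Lemma affine_measurable (c d : R) : measurable_fun [set: R] (fun x => c * x + d)%R.
Proof.
by apply: measurable_funD => //; apply: measurable_funM.
Qed.

(* Both sides are translation-scaled copies of Lebesgue measure, so it suffices to compare half-open intervals. *)
Lemma ge0_integral_affine_pos (c d : R) (f : R -> \bar R) : (0 < c)%R ->
  measurable_fun setT f -> (forall x, 0 <= f x) ->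
  \int[mu]_x f x = c%:E * \int[mu]_x f (c * x + d)%R.
Proof.
move=> c0 mf f0.
have mphi := affine_measurable c d.
pose nu : {measure set (measurableTypeR R) -> \bar R} :=
  mscale (NngNum (ltW c0)) (pushforwardR mu mphi).
have nuE A : measurable A -> mu A = nu A.
  apply: lebesgue_measure_unique => X [[a b] /= _ <-].
  rewrite /nu /= /mscale /= /pushforward.
  have -> : (fun x : R => (c * x + d)%R) @^-1` `]a, b]%classic =
      `]((a - d) / c)%R, ((b - d) / c)%R]%classic.
    apply/seteqP; split=> x /=; rewrite !in_itv/= ltr_pdivrMr// ler_pdivlMr//;
    rewrite ![(x * c)%R]mulrC => /andP[h1 h2]; apply/andP; split; lra.
  rewrite !lebesgue_measure_itv/= !lte_fin.
  rewrite ltr_pM2r ?invr_gt0// ltrD2r; case: ifPn => _; last by rewrite mule0.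
  rewrite -!EFinB -EFinM; congr _%:E; field; exact: lt0r_neq0.
rewrite (eq_measure_integral nu) => [|A mA _]; last exact: nuE.
rewrite [LHS](@ge0_integral_mscale _ _ _ (pushforwardR mu mphi) setT _ (NngNum (ltW c0)))//=.
by congr (_ * _); exact: (ge0_integral_pushforwardR mu mphi).
Qed.

Lemma ge0_integral_oppr (f : R -> \bar R) : measurable_fun setT f ->
  (forall x, 0 <= f x) -> \int[mu]_x f x = \int[mu]_x f (- x)%R.
Proof.
move=> mf f0.
have mphi : measurable_fun [set: measurableTypeR R] (-%R : R -> R) by exact: oppr_measurable.
pose nu : {measure set (measurableTypeR R) -> \bar R} := pushforwardR mu mphi.
have nuE A : measurable A -> mu A = nu A.
  apply: lebesgue_measure_unique => X [[a b] /= _ <-].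
  rewrite /nu /= /pushforward.
  have -> : (-%R : R -> R) @^-1` `]a, b]%classic = `[(- b)%R, (- a)%R[%classic.
    by apply/seteqP; split=> x /=; rewrite !in_itv/= => /andP[h1 h2]; apply/andP; split; lra.
  rewrite !lebesgue_measure_itv/= !lte_fin ltrN2.
  by case: ifPn => _ //; rewrite -!EFinB; congr _%:E; ring.
rewrite (eq_measure_integral nu) => [|A mA _]; last exact: nuE.
exact: ge0_integral_pushforwardR.
Qed.

Lemma ge0_integral_affine (c d : R) (f : R -> \bar R) : (c != 0)%R ->
  measurable_fun setT f -> (forall x, 0 <= f x) ->
  \int[mu]_x f x = `|c|%:E * \int[mu]_x f (c * x + d)%R.
Proof.
move=> c0 mf f0; have [cp|cn|/eqP] := ltrgt0P c; last by rewrite (negbTE c0).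
  exact: ge0_integral_affine_pos.
rewrite (@ge0_integral_affine_pos (- c)%R d)// ?oppr_gt0//.
congr (_ * _).
rewrite [RHS]ge0_integral_oppr//.
  by apply: eq_integral => x _; rewrite mulNr mulrN.
apply: measurableT_comp => //; exact: affine_measurable.
Qed.

(** This is the image of Lebesgue measure on the positive half-line under [x |-> - ln x]. *)
Definition exp_density (A : set (measurableTypeR R)) : \bar R := \int[mu]_(y in A) (expR (- y))%:E.

Lemma measurable_expRN : measurable_fun [set: R] (fun y : R => expR (- y)%R).
Proof. by apply: measurableT_comp => //; exact: measurable_expR. Qed.

Let m_expRN (A : set R) : measurable_fun A (fun y : R => (expR (- y))%:E).
Proof.
by apply/measurable_EFinP; apply: measurable_funTS; exact: measurable_expRN.
Qed.

Let exp_density0 : exp_density set0 = 0.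
Proof. by rewrite /exp_density integral_set0. Qed.

Let exp_density_ge0 A : 0 <= exp_density A.
Proof. by apply: integral_ge0 => x _; rewrite lee_fin expR_ge0. Qed.

Let exp_density_sigma_additive : semi_sigma_additive exp_density.
Proof.
move=> /= A mA tA mUA.
rewrite /exp_density ge0_integral_bigcup//=; last exact: m_expRN.
  apply: is_cvg_ereal_nneg_natsum_cond => n _ _; exact: exp_density_ge0.
Qed.

HB.instance Definition _ := isMeasure.Build _ _ _
  exp_density exp_density0 exp_density_ge0 exp_density_sigma_additive.

Lemma integral_expRN_itvy (b : R) :
  \int[mu]_(y in `[b, +oo[) (expR (- y))%:E = (expR (- b))%:E.
Proof.
rewrite (@ge0_continuous_FTC2y _ _ (fun y => - expR (- y))%R _ 0%R).
- by rewrite sub0e EFinN oppeK.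
- by move=> x _; exact: expR_ge0.
- by apply: continuous_subspaceT => x; apply: continuous_comp; [exact: continuousN|exact: continuous_expR].
- by rewrite -oppr0; apply: cvgN; exact: cvgr_expR.
- by move=> x _; apply: ex_derive.
- apply: cvg_at_right_filter; apply: cvgN.
  by apply: continuous_comp; [exact: continuousN|exact: continuous_expR].
- move=> x _; rewrite derive1E.
  have h : is_derive x 1%R (- (expR \o -%R))%R (- (expR (- x) * -1))%R.
    have h1 := is_deriveNid x (1%R : R).
    have h2 := is_derive1_comp (is_derive_expR (- x)%R) h1.
    exact: is_deriveN h2.
  by rewrite (@derive_val _ _ _ _ _ _ _ h) mulrN1 opprK.
Qed.

(** Pushing [exp_density] forward along [y |-> expR (- y)] gives back Lebesgue measure on the
    positive half-line; on intervals this is the primitive [- expR (- y)]. *)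
Lemma lebesgue_measure_expRN (A : set R) : measurable A -> A `<=` [set x | 0 < x]%R ->
  mu A = \int[mu]_y ((\1_A (expR (- y)) * expR (- y))%:E).
Proof.
move=> mA A0.
have m1 : measurable_fun [set: R] (fun y : R => expR (- y)%R) := measurable_expRN.
pose nu1 : {measure set (measurableTypeR R) -> \bar R} :=
  pushforwardR (exp_density : {measure set (measurableTypeR R) -> \bar R}) m1.
have mN : measurable (`]-oo, 0%R] : set R) by [].
(* Uniqueness of Lebesgue measure compares measures on the whole line, so the missing half-line is
   added back; it does not meet [A]. *)
pose nu := measure_add nu1 (mrestrR mu mN).
have nu1E (b : R) : (0 <= b)%R -> nu1 `]0%R, b]%classic = b%:E.
  rewrite le_eqVlt => /predU1P[<-|b0].
    by rewrite set_itv_ge ?measure0// bnd_simp ltxx.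
  rewrite /nu1 /pushforwardR /= /pushforward.
  have -> : (fun y : R => expR (- y)) @^-1` `]0%R, b]%classic = `[(- ln b)%R, +oo[%classic.
    apply/seteqP; split=> y /=; rewrite !in_itv/= andbT expR_gt0/=.
      by rewrite lerNl -[in X in X -> _](lnK b0) ler_expR.
    by rewrite lerNl -[in X in _ -> X](lnK b0) ler_expR.
  by rewrite /exp_density integral_expRN_itvy opprK lnK.
have nuD (b c : R) : (0 <= b)%R -> (b <= c)%R -> nu1 `]b, c]%classic = (c - b)%:E.
  move=> b0 bc; have := nu1E _ (le_trans b0 bc).
  rewrite (_ : `]0%R, c]%classic = `]0%R, b]%classic `|` `]b, c]%classic); last first.
    apply/seteqP; split=> x /=; rewrite !in_itv/=.
      by move=> /andP[h1 h2]; have [h|h] := leP x b; [left|right]; apply/andP; split.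
    by move=> [] /andP[h1 h2]; apply/andP; split; lra.
  rewrite measureU//; last first.
    by rewrite -subset0 => x /=; rewrite !in_itv/= => -[/andP[_ ?] /andP[]]; rewrite ltNge => /negP.
  rewrite [X in X + _](nu1E b b0).
  have sub (Y : \bar R) : b%:E + Y = c%:E -> Y = (c - b)%:E.
    by case: Y => [r|//|//] [] <-; congr _%:E; ring.
  by move/sub.
have nuE X : measurable X -> mu X = nu X.
  apply: lebesgue_measure_unique => Y [[a b] /= _ <-].
  rewrite [RHS](measure_addE nu1 (mrestrR mu mN) `]a, b]%classic) lebesgue_measure_itv/= lte_fin.
  rewrite /= /mrestr; have [ab|ab] := ltP a b; last first.
    by rewrite set_itv_ge ?set0I ?measure0 ?adde0// bnd_simp -leNgt.
  have [a0|a0] := leP 0%R a.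
    rewrite [X in _ = X + _](nuD a b)//; last exact: ltW.
    rewrite (_ : _ `&` _ = set0) ?measure0 ?adde0//.
    by rewrite -subset0 => x /=; rewrite !in_itv/= => -[/andP[h1 h2] h3]; lra.
  have [b0|b0] := leP b 0%R.
    rewrite (_ : _ `&` _ = `]a, b]%classic); last first.
      apply/seteqP; split=> x /=; first by case.
      by rewrite !in_itv/= => /andP[h1 h2]; split; [rewrite h1|]; lra.
    rewrite lebesgue_measure_itv/= lte_fin ab [X in _ = X + _](_ : _ = 0) ?add0e//.
    rewrite /nu1 /= /pushforward (_ : _ @^-1` _ = set0) ?measure0//.
    rewrite -subset0 => x /=; rewrite in_itv/= => /andP[_ h].
    by have := expR_gt0 (- x); lra.
  rewrite (_ : _ `&` _ = `]a, 0%R]%classic); last first.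
    apply/seteqP; split=> x /=; rewrite !in_itv/=.
      by move=> [/andP[-> _] ->].
    by move=> /andP[h1 h2]; split; lra.
  rewrite lebesgue_measure_itv/= lte_fin a0.
  rewrite [X in _ = X + _](_ : _ = nu1 `]0%R, b]%classic).
    rewrite [X in _ = X + _](nu1E b (ltW b0)).
    by rewrite -!EFinB -EFinD; congr _%:E; ring.
  rewrite /nu1 /= /pushforward; congr (exp_density _).
  apply/seteqP; split=> x /=; rewrite !in_itv/= => /andP[h1 ->]; rewrite andbT.
    exact: expR_gt0.
  by have := expR_gt0 (- x); lra.
have rA : mrestrR mu mN A = 0.
  rewrite /mrestrR /= /mrestr (_ : A `&` _ = set0) ?measure0//.
  by rewrite -subset0 => x /= [/A0 /=]; rewrite in_itv/= ltNge => /negP.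
rewrite nuE// [LHS](measure_addE nu1 (mrestrR mu mN) A) rA adde0.
rewrite /nu1 /pushforwardR /= /pushforward /exp_density integral_mkcond/=.
apply: eq_integral => y _; rewrite patchE indicE.
rewrite (_ : (y \in _) = (expR (- y) \in A)); last by apply/idP/idP => /set_mem h; exact: mem_set.
by case: ifPn => _; rewrite ?mul1r ?mul0r.
Qed.

End one_dim.

(** * Triple integrals *)

Section triple_integral.
Context {R : realType}.
Local Notation mu := (@lebesgue_measure R).
Local Open Scope ereal_scope.

Definition vec3 (x y z : R) : 'rV[R]_3 := \row_(j < 3) [:: x; y; z]`_j.

(** Volume is an iterated integral, so that every change of variables below can be made one
    coordinate at a time on the line. *)
Definition int3 (f : 'rV[R]_3 -> \bar R) : \bar R :=
  \int[mu]_x \int[mu]_y \int[mu]_z f (vec3 x y z).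

Definition measurable3 (f : 'rV[R]_3 -> \bar R) :=
  measurable_fun [set: R * R * R] (fun p : R * R * R => f (vec3 p.1.1 p.1.2 p.2)).

Lemma vec3K (v : 'rV[R]_3) : vec3 (v 0 0)%R (v 0 1)%R (v 0 2%:R)%R = v.
Proof.
apply/rowP => j; rewrite mxE.
by case: j => -[|[|[|//]]] h /=; congr (v _ _); apply/val_inj.
Qed.

Lemma vec3_mul (x y z : R) (A : 'M[R]_3) : vec3 x y z *m A =
  vec3 (x * A 0 0 + y * A 1 0 + z * A 2%:R 0)%R (x * A 0 1 + y * A 1 1 + z * A 2%:R 1)%R
    (x * A 0 2%:R + y * A 1 2%:R + z * A 2%:R 2%:R)%R.
Proof.
apply/rowP => j; rewrite !mxE !big_ord_recl big_ord0 !mxE/= addr0 addrA.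
have -> : lift ord0 ord0 = 1%R :> 'I_3 by apply/val_inj.
have -> : lift ord0 (lift ord0 ord0) = 2%:R :> 'I_3 by apply/val_inj.
by case: j => -[|[|[|//]]] h /=; congr (_ * _ + _ * _ + _ * _)%R; congr (A _ _); apply/val_inj.
Qed.

Section one_function.
Variable f : 'rV[R]_3 -> \bar R.
Hypotheses (mf : measurable3 f) (f0 : forall v, 0 <= f v).

Lemma measurable3_z x y : measurable_fun setT (fun z : R => f (vec3 x y z)).
Proof.
exact: (measurableT_comp mf (pair1_measurable (x, y))).
Qed.

Lemma measurable3_yz x : measurable_fun setT (fun p : R * R => f (vec3 x p.1 p.2)).
Proof.
have mphi : measurable_fun setT (fun p : R * R => (x, p.1, p.2)).
  by apply: measurable_fun_pair => //; apply: measurable_fun_pair.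
exact: (measurableT_comp mf mphi).
Qed.

Lemma measurable3_int : measurable_fun setT (fun p : R * R => \int[mu]_z f (vec3 p.1 p.2 z)).
Proof.
exact: (measurable_fun_fubini_tonelli_F (m2 := mu) _ mf).
Qed.

Lemma measurable3_inty x : measurable_fun setT (fun y : R => \int[mu]_z f (vec3 x y z)).
Proof.
exact: (measurableT_comp measurable3_int (pair1_measurable x)).
Qed.

Lemma measurable3_intx : measurable_fun setT (fun x : R => \int[mu]_y \int[mu]_z f (vec3 x y z)).
Proof.
apply: (measurable_fun_fubini_tonelli_F (m2 := mu) _ measurable3_int) => p.
by apply: integral_ge0 => z _.
Qed.

Lemma int3_swap12 : int3 f = \int[mu]_x \int[mu]_y \int[mu]_z f (vec3 y x z).
Proof.
apply: (fubini_tonelli (m1 := mu) (m2 := mu) _ measurable3_int) => p.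
by apply: integral_ge0 => z _.
Qed.

Lemma int3_swap23 : int3 f = \int[mu]_x \int[mu]_y \int[mu]_z f (vec3 x z y).
Proof.
apply: eq_integral => x _.
exact: (fubini_tonelli (m1 := mu) (m2 := mu) _ (measurable3_yz x)).
Qed.

End one_function.

Lemma measurable3_mul (A : 'M[R]_3) (f : 'rV[R]_3 -> \bar R) :
  measurable3 f -> measurable3 (fun v => f (v *m A)).
Proof.
move=> mf; rewrite /measurable3.
pose phi (p : R * R * R) : R * R * R :=
  ((p.1.1 * A 0 0 + p.1.2 * A 1 0 + p.2 * A 2%:R 0)%R, (p.1.1 * A 0 1 + p.1.2 * A 1 1 + p.2 * A 2%:R 1)%R,
    (p.1.1 * A 0 2%:R + p.1.2 * A 1 2%:R + p.2 * A 2%:R 2%:R)%R).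
rewrite (_ : (fun p : R * R * R => _) =
   (fun p : R * R * R => f (vec3 p.1.1 p.1.2 p.2)) \o phi); last first.
  by apply/funext => p /=; rewrite vec3_mul.
apply: (measurableT_comp mf).
have m (a b c : R) : measurable_fun setT (fun p : R * R * R => (p.1.1 * a + p.1.2 * b + p.2 * c)%R).
  apply: measurable_funD; [apply: measurable_funD|].
  - by apply: measurable_funM => //; exact: measurableT_comp.
  - by apply: measurable_funM => //; exact: measurableT_comp.
  - by apply: measurable_funM.
by apply: measurable_fun_pair => //=; apply: measurable_fun_pair => /=; exact: m.
Qed.

Lemma mule_integral (k : R) (g : R -> \bar R) : (0 <= k)%R -> measurable_fun setT g ->
  (forall x, 0 <= g x) -> k%:E * \int[mu]_x g x = \int[mu]_x (k%:E * g x).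
Proof. by move=> k0 mg g0; rewrite ge0_integralZl_EFin. Qed.

(** The change of variables formula is stated as a property of the matrix because it passes to
    products: it is proved for triangular and permutation matrices and then for all invertible
    ones. *)
Definition int3_scales (A : 'M[R]_3) := forall f : 'rV[R]_3 -> \bar R,
  measurable3 f -> (forall v, 0 <= f v) ->
  int3 f = `|\det A|%:E * int3 (fun v => f (v *m A)).

Lemma int3_scalesM (A B : 'M[R]_3) : int3_scales A -> int3_scales B -> int3_scales (A *m B).
Proof.
move=> hA hB f mf f0.
have f0' v : 0 <= f (v *m B) by [].
have mf' := measurable3_mul B mf.
rewrite (hB f mf f0) (hA _ mf' f0') muleA -EFinM -normrM -det_mulmx.
have -> : (\det (B *m A) = \det (A *m B))%R by rewrite !det_mulmx mulrC.
by under [in RHS]eq_fun do rewrite mulmxA.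
Qed.

(** Each coordinate of [v *m A] is affine in its own variable, with a shift that depends only on the
    variables integrated outside it. *)
Lemma int3_scales_upper (A : 'M[R]_3) : is_trig_mx A^T -> \det A != 0%R -> int3_scales A.
Proof.
move=> /is_trig_mxP tA dA f mf f0.
have A10 : A 1%R 0%R = 0%R by have := tA 0%R 1%R isT; rewrite mxE.
have A20 : A 2%:R 0%R = 0%R by have := tA 0%R 2%:R isT; rewrite mxE.
have A21 : A 2%:R 1%R = 0%R by have := tA 1%R 2%:R isT; rewrite mxE.
have detA : (\det A = A 0 0 * A 1 1 * A 2%:R 2%:R)%R.
  rewrite -det_tr det_trig; last exact/is_trig_mxP.
  rewrite !big_ord_recl big_ord0 !mxE/= mulr1 mulrA.
  by congr (_ * _ * _)%R; congr (A _ _); apply/val_inj.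
move: dA; rewrite detA !mulf_eq0 !negb_or => /andP[/andP[a0 a1] a2].
have mg := measurable3_mul A mf.
have g0 v : 0 <= f (v *m A) by [].
have x0 x : 0 <= \int[mu]_y \int[mu]_z f (vec3 x y z) by do 2 apply: integral_ge0 => ? _.
have y0 x y : 0 <= \int[mu]_z f (vec3 x y z) by apply: integral_ge0 => ? _.
have gx0 x : 0 <= \int[mu]_y \int[mu]_z f (vec3 x y z *m A) by do 2 apply: integral_ge0 => ? _.
have gy0 x y : 0 <= \int[mu]_z f (vec3 x y z *m A) by apply: integral_ge0 => ? _.
rewrite [LHS](ge0_integral_affine 0%R a0 (measurable3_intx mf f0) x0).
rewrite !normrM !EFinM -!muleA; congr (_ * _).
have mgx := measurable3_intx mg g0.
rewrite /int3 (mule_integral (normr_ge0 _) mgx)//.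
rewrite [RHS](mule_integral (normr_ge0 _))//; last 2 first.
  - by apply: measurable_funeM; exact: mgx.
  - by move=> x; exact: mule_ge0.
apply: eq_integral => x _.
rewrite (ge0_integral_affine (x * A 0%R 1%R)%R a1 (measurable3_inty mf f0 _) (y0 _)).
congr (_ * _).
rewrite [RHS](mule_integral (normr_ge0 _) (measurable3_inty mg g0 x))//.
apply: eq_integral => y _.
rewrite (ge0_integral_affine (x * A 0%R 2%:R + y * A 1%R 2%:R)%R a2 (measurable3_z mf _ _))//.
congr (_ * _); apply: eq_integral => z _; rewrite vec3_mul A10 A20 A21; congr (f (vec3 _ _ _)); ring.
Qed.

Lemma normr_det_perm n (s : {perm 'I_n}) : (`|\det (perm_mx s : 'M[R]_n)| = 1)%R.
Proof. by rewrite det_perm normrX normrN1 expr1n. Qed.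

Lemma int3_scales_swap01 : int3_scales (tperm_mx 0%R 1%R).
Proof.
move=> f mf f0; rewrite normr_det_perm mul1e (int3_swap12 mf f0).
do 3 apply: eq_integral => ? _; congr (f _).
rewrite -xcolE; apply/rowP => j; rewrite !mxE.
by case: tpermP => [->|->|/eqP h0 /eqP h1] //; move: j h0 h1 => [[|[|[|//]]]].
Qed.

Lemma int3_scales_swap12 : int3_scales (tperm_mx 1%R 2%:R).
Proof.
move=> f mf f0; rewrite normr_det_perm mul1e (int3_swap23 mf f0).
do 3 apply: eq_integral => ? _; congr (f _).
rewrite -xcolE; apply/rowP => j; rewrite !mxE.
by case: tpermP => [->|->|/eqP h0 /eqP h1] //; move: j h0 h1 => [[|[|[|//]]]].
Qed.

Lemma int3_scales_swap02 : int3_scales (tperm_mx 0%R 2%:R).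
Proof.
have -> : tperm_mx 0%R 2%:R = tperm_mx 0%R 1%R *m (tperm_mx 1%R 2%:R *m tperm_mx 0%R 1%R) :> 'M[R]_3.
  rewrite /tperm_mx -!perm_mxM; congr perm_mx.
  have := tpermJ (1%R : 'I_3) 2%:R (tperm 0%R 1%R).
  by rewrite tpermR tpermD// conjgE tpermV => <-.
exact: (int3_scalesM int3_scales_swap01 (int3_scalesM int3_scales_swap12 int3_scales_swap01)).
Qed.

Lemma int3_scales1 : int3_scales 1%:M.
Proof. by move=> f mf f0; rewrite det1 normr1 mul1e; under [in RHS]eq_fun do rewrite mulmx1. Qed.

Lemma int3_scales_tperm (i j : 'I_3) : int3_scales (tperm_mx i j).
Proof.
have [->|ij] := eqVneq i j; first by rewrite /tperm_mx tperm1 perm_mx1; exact: int3_scales1.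
wlog ltij : i j ij / (i < j)%N => [hw|].
  have [|ji|/val_inj/eqP] := ltngtP i j; first exact: hw.
    by rewrite /tperm_mx tpermC; apply: hw; rewrite // eq_sym.
  by rewrite (negbTE ij).
move: i j {ij} ltij => [[|[|[|//]]] hi] [[|[|[|//]]] hj]//= _.
- by rewrite (_ : Ordinal hi = 0%R) 1?(_ : Ordinal hj = 1%R); [exact: int3_scales_swap01|exact/val_inj|exact/val_inj].
- by rewrite (_ : Ordinal hi = 0%R) 1?(_ : Ordinal hj = 2%:R); [exact: int3_scales_swap02|exact/val_inj|exact/val_inj].
- by rewrite (_ : Ordinal hi = 1%R) 1?(_ : Ordinal hj = 2%:R); [exact: int3_scales_swap12|exact/val_inj|exact/val_inj].
Qed.

Lemma int3_scales_perm (s : 'S_3) : int3_scales (perm_mx s).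
Proof.
have [ts -> _] := prod_tpermP s.
elim: ts => [|t ts IH]; first by rewrite big_nil perm_mx1; exact: int3_scales1.
by rewrite big_cons perm_mxM; exact: (int3_scalesM (int3_scales_tperm _ _) IH).
Qed.

Lemma lup_decomposition n (A : 'M[R]_n.+1) : exists (s : {perm 'I_n.+1}) (L U : 'M[R]_n.+1),
  [/\ perm_mx s *m A = L *m U, (\det L = 1)%R,
      forall i j : 'I_n.+1, (i <= j)%N -> L i j = (i == j)%:R%R &
      forall i j : 'I_n.+1, (j < i)%N -> U i j = 0%R].
Proof.
have := cormen_lup_correct A; have := cormen_lup_perm A.
have := cormen_lup_detL A; have := cormen_lup_lower A; have := cormen_lup_upper A.
case: (cormen_lup A) => [[P L] U] /= upU loL detL /is_perm_mxP[s ->] PA.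
by exists s, L, U.
Qed.

Lemma int3_linear (A : 'M[R]_3) : \det A != 0%R -> int3_scales A.
Proof.
move=> dA.
have [s [L [U [PA detL loL upU]]]] := lup_decomposition A.
have -> : A = perm_mx s^-1 *m (L *m U).
  by rewrite -PA mulmxA -perm_mxM mulVg perm_mx1 mul1mx.
have dU : \det U != 0%R.
  have /(congr1 determinant) := PA.
  rewrite !det_mulmx detL mul1r => <-; rewrite mulf_neq0// det_perm.
  by rewrite signr_eq0.
apply: int3_scalesM; first exact: int3_scales_perm.
apply: int3_scalesM; last first.
  by apply: int3_scales_upper => //; apply/is_trig_mxP => i j ij; rewrite mxE upU.
(* Conjugation by the reversal of the coordinates makes the lower triangular factor upper
   triangular. *)
pose J : 'M[R]_3 := tperm_mx 0%R 2%:R.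
have JJ : J *m J = 1%:M by rewrite /J /tperm_mx -perm_mxM tperm2 perm_mx1.
have -> : L = J *m ((J *m L *m J) *m J).
  by rewrite -[X in _ = J *m X]mulmxA JJ mulmx1 mulmxA JJ mul1mx.
apply: int3_scalesM; first exact: int3_scales_swap02.
apply: int3_scalesM; last exact: int3_scales_swap02.
apply: int3_scales_upper; last first.
  by rewrite !det_mulmx detL mulr1 -det_mulmx JJ det1 oner_eq0.
apply/is_trig_mxP => i j ij.
rewrite mxE -xcolE -xrowE !mxE; have rev (k : 'I_3) : tperm 0%R 2%:R k = rev_ord k.
  by apply/val_inj; case: tpermP => [->|->|/eqP h0 /eqP h1] //; move: k h0 h1 => [[|[|[|//]]]].
rewrite !rev loL; last by rewrite leq_sub2l// ltnW.
by rewrite (inj_eq rev_ord_inj) eq_sym -val_eqE ltn_eqF.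
Qed.

Lemma int3_translate (w : 'rV[R]_3) (f : 'rV[R]_3 -> \bar R) : measurable3 f ->
  (forall v, 0 <= f v) -> int3 (fun v => f (v + w)%R) = int3 f.
Proof.
move=> mf f0.
have addE x y z : (vec3 x y z + w)%R = vec3 (1 * x + w 0 0)%R (1 * y + w 0 1)%R (1 * z + w 0 2%:R)%R.
  by rewrite !mul1r -[w in LHS]vec3K; apply/rowP => j; rewrite !mxE; case: j => -[|[|[|//]]].
rewrite /int3 [RHS](ge0_integral_affine (w 0%R 0%R) (oner_neq0 _) (measurable3_intx mf f0)); last first.
  by move=> x; do 2 apply: integral_ge0 => ? _.
rewrite normr1 mul1e; apply: eq_integral => x _.
rewrite [RHS](ge0_integral_affine (w 0%R 1%R) (oner_neq0 _) (measurable3_inty mf f0 _)); last first.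
  by move=> y; apply: integral_ge0 => ? _.
rewrite normr1 mul1e; apply: eq_integral => y _.
rewrite [RHS](ge0_integral_affine (w 0%R 2%:R) (oner_neq0 _) (measurable3_z mf _ _))// normr1 mul1e.
by apply: eq_integral => z _; rewrite addE.
Qed.

End triple_integral.

(** * Volume of a piece of a cone *)

Section cone_volume.
Context {R : realType}.
Local Notation mu := (@lebesgue_measure R).
Local Open Scope ereal_scope.

Lemma rV3P (T : Type) (u v : 'rV[T]_3) :
  u 0%R 0%R = v 0%R 0%R -> u 0%R 1%R = v 0%R 1%R -> u 0%R 2%:R%R = v 0%R 2%:R%R -> u = v.
Proof.
move=> e0 e1 e2; apply/rowP => -[[|[|[|//]]] h]; [move: e0|move: e1|move: e2];
  by congr (u _ _ = v _ _); apply/val_inj.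
Qed.

Lemma vec3E (x y z : R) : ((vec3 x y z 0%R 0%R = x) * (vec3 x y z 0%R 1%R = y) * (vec3 x y z 0%R 2%:R = z))%type.
Proof. by rewrite !mxE. Qed.

Lemma measurable3_prod (g0 g1 g2 : R -> R) : measurable_fun setT g0 ->
  measurable_fun setT g1 -> measurable_fun setT g2 ->
  measurable3 (fun v : 'rV[R]_3 => (g0 (v 0 0) * g1 (v 0 1) * g2 (v 0 2%:R))%:E)%R.
Proof.
move=> m0 m1 m2; rewrite /measurable3; under eq_fun do rewrite !vec3E.
apply/measurable_EFinP; apply: measurable_funM; [apply: measurable_funM|].
- by apply: (measurableT_comp m0); exact: measurableT_comp.
- by apply: (measurableT_comp m1); exact: measurableT_comp.
- exact: (measurableT_comp m2).
Qed.

Lemma measurable3_map (phi : R -> R) (f : 'rV[R]_3 -> \bar R) :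
  measurable_fun setT phi -> measurable3 f -> measurable3 (fun v => f (map_mx phi v)).
Proof.
move=> mphi mf.
pose psi (p : R * R * R) : R * R * R := (phi p.1.1, phi p.1.2, phi p.2).
have mpsi : measurable_fun setT psi.
  apply: measurable_fun_pair; [apply: measurable_fun_pair|].
  - by apply: (measurableT_comp mphi); exact: measurableT_comp.
  - by apply: (measurableT_comp mphi); exact: measurableT_comp.
  - exact: (measurableT_comp mphi).
have := measurableT_comp mf mpsi; rewrite /measurable3; congr measurable_fun.
apply/funext => p /=; congr f; apply/rowP => j; rewrite !mxE.
by case: j => -[|[|[|//]]].
Qed.

Lemma measurable3M (f g : 'rV[R]_3 -> R) : measurable3 (EFin \o f) -> measurable3 (EFin \o g) ->
  measurable3 (fun v => (f v * g v)%:E).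
Proof.
rewrite /measurable3 => /measurable_EFinP mf /measurable_EFinP mg.
by apply/measurable_EFinP; apply: measurable_funM.
Qed.

Lemma int3_prod (g0 g1 g2 : R -> R) (c0 c1 c2 : R) : measurable_fun setT g0 ->
  measurable_fun setT g1 -> measurable_fun setT g2 ->
  (forall x, (0 <= g0 x)%R) -> (forall x, (0 <= g1 x)%R) -> (forall x, (0 <= g2 x)%R) ->
  \int[mu]_x (g0 x)%:E = c0%:E -> \int[mu]_x (g1 x)%:E = c1%:E -> \int[mu]_x (g2 x)%:E = c2%:E ->
  int3 (fun v : 'rV[R]_3 => (g0 (v 0 0) * g1 (v 0 1) * g2 (v 0 2%:R))%:E)%R = (c0 * c1 * c2)%:E.
Proof.
move=> m0 m1 m2 p0 p1 p2 e0 e1 e2.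
have pull (g : R -> R) (k c : R) : measurable_fun setT g -> (forall x, (0 <= g x)%R) ->
    (0 <= k)%R -> \int[mu]_x (g x)%:E = c%:E -> \int[mu]_x (k * g x)%:E = (k * c)%:E.
  move=> mg g0' k0 e; rewrite EFinM -e mule_integral//; exact/measurable_EFinP.
have c2p : (0 <= c2)%R.
  by rewrite -lee_fin -e2; apply: integral_ge0 => x _; rewrite lee_fin.
have c1p : (0 <= c1)%R.
  by rewrite -lee_fin -e1; apply: integral_ge0 => x _; rewrite lee_fin.
rewrite /int3; under eq_integral => x _.
  under eq_integral => y _.
    under eq_integral do rewrite !vec3E.
    rewrite (pull g2 _ c2)//; last exact: mulr_ge0.
    rewrite mulrAC.
    over.
  rewrite (pull g1 _ c1)//; last exact: mulr_ge0.
  rewrite -mulrA mulrC.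
  over.
rewrite (pull g0 _ c0)//; last exact: mulr_ge0.
by congr _%:E; ring.
Qed.

Lemma le_int3 (f g : 'rV[R]_3 -> \bar R) : measurable3 f -> measurable3 g ->
  (forall v, 0 <= f v) -> (forall v, f v <= g v) -> int3 f <= int3 g.
Proof.
move=> mf mg f0 fg; have g0 v : 0 <= g v := le_trans (f0 v) (fg v).
apply: ge0_le_integral => //.
- by move=> x _; do 2 apply: integral_ge0 => ? _.
- exact: measurable3_intx.
- exact: measurable3_intx.
move=> x _; apply: ge0_le_integral => //.
- by move=> y _; apply: integral_ge0 => ? _.
- exact: measurable3_inty.
- exact: measurable3_inty.
move=> y _; apply: ge0_le_integral => //.
- exact: measurable3_z.
- exact: measurable3_z.
Qed.

Lemma measurable3D (f g : 'rV[R]_3 -> \bar R) : measurable3 f -> measurable3 g ->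
  measurable3 (fun v => f v + g v).
Proof. exact: emeasurable_funD. Qed.

Lemma int3D (f g : 'rV[R]_3 -> \bar R) : measurable3 f -> measurable3 g ->
  (forall v, 0 <= f v) -> (forall v, 0 <= g v) -> int3 (fun v => f v + g v) = int3 f + int3 g.
Proof.
move=> mf mg f0 g0.
rewrite /int3 -ge0_integralD//; last 4 first.
- by move=> x _; do 2 apply: integral_ge0 => ? _.
- exact: measurable3_intx.
- by move=> x _; do 2 apply: integral_ge0 => ? _.
- exact: measurable3_intx.
apply: eq_integral => x _; rewrite -ge0_integralD//; last 4 first.
- by move=> y _; apply: integral_ge0 => ? _.
- exact: measurable3_inty.
- by move=> y _; apply: integral_ge0 => ? _.
- exact: measurable3_inty.
apply: eq_integral => y _; rewrite -ge0_integralD//.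
- exact: measurable3_z.
- exact: measurable3_z.
Qed.

Lemma int3_sum (I : eqType) (s : seq I) (f : I -> 'rV[R]_3 -> \bar R) :
  (forall i, measurable3 (f i)) -> (forall i v, 0 <= f i v) ->
  measurable3 (fun v => \sum_(i <- s) f i v) /\
  int3 (fun v => \sum_(i <- s) f i v) = \sum_(i <- s) int3 (f i).
Proof.
move=> mf f0; elim: s => [|i s [IHm IHe]].
  split; first by rewrite /measurable3; under eq_fun do rewrite big_nil; exact: measurable_cst.
  rewrite big_nil /int3; apply: integral0_eq => x _; apply: integral0_eq => y _.
  by apply: integral0_eq => z _; rewrite big_nil.
have E : (fun v => \sum_(j <- i :: s) f j v) = (fun v => f i v + \sum_(j <- s) f j v).
  by apply/funext => v; rewrite big_cons.
rewrite E; split; first exact: measurable3D.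
by rewrite int3D// ?big_cons ?IHe// => v; exact: sume_ge0.
Qed.

Definition box3 (I0 I1 I2 : set R) : set 'rV[R]_3 :=
  [set v | [/\ I0 (v 0 0), I1 (v 0 1) & I2 (v 0 2%:R)]]%R.

Lemma indic_box3 (I0 I1 I2 : set R) (v : 'rV[R]_3) :
  (\1_(box3 I0 I1 I2) v = \1_I0 (v 0 0) * \1_I1 (v 0 1) * \1_I2 (v 0 2%:R) :> R)%R.
Proof.
rewrite !indicE -!natrM !mulnb; congr (_%:R); congr nat_of_bool.
apply/idP/idP; first by move=> /set_mem[h0 h1 h2]; rewrite !mem_set.
by move=> /andP[/andP[/set_mem h0 /set_mem h1] /set_mem h2]; rewrite mem_set.
Qed.

Lemma measurable3_box3 (I0 I1 I2 : set R) : measurable I0 -> measurable I1 -> measurable I2 ->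
  measurable3 (fun v => (\1_(box3 I0 I1 I2) v)%:E).
Proof.
move=> m0 m1 m2; under eq_fun do rewrite indic_box3.
by apply: measurable3_prod; exact: measurable_indic.
Qed.

Lemma indic_box3_prod (I0 I1 I2 : set R) (a0 a1 a2 : R) :
  measurable I0 -> measurable I1 -> measurable I2 ->
  mu I0 = a0%:E -> mu I1 = a1%:E -> mu I2 = a2%:E ->
  int3 (fun v => (\1_(box3 I0 I1 I2) v)%:E) = (a0 * a1 * a2)%:E.
Proof.
move=> m0 m1 m2 e0 e1 e2; under eq_fun do rewrite indic_box3.
apply: int3_prod; rewrite ?integral_indic ?setIT//; exact: measurable_indic.
Qed.

Definition unit_cube : set 'rV[R]_3 := box3 `[0%R, 1%R[ `[0%R, 1%R[ `[0%R, 1%R[.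

Lemma int3_unit_cube : int3 (fun v => (\1_unit_cube v)%:E) = 1.
Proof.
have e : mu `[0%R, 1%R[%classic = (1%R : R)%:E.
  by rewrite lebesgue_measure_itv/= lte_fin ltr01 -EFinB subr0.
by rewrite (indic_box3_prod _ _ _ e e e)// !mulr1.
Qed.

Lemma measurable3Z (k : R) (f : 'rV[R]_3 -> \bar R) : measurable3 f ->
  measurable3 (fun v => k%:E * f v).
Proof. exact: measurable_funeM. Qed.

Lemma int3Z (k : R) (f : 'rV[R]_3 -> \bar R) : measurable3 f -> (forall v, 0 <= f v) ->
  (0 <= k)%R -> int3 (fun v => k%:E * f v) = k%:E * int3 f.
Proof.
move=> mf f0 k0; rewrite /int3 mule_integral//; last 2 first.
- exact: measurable3_intx.
- by move=> x; do 2 apply: integral_ge0 => ? _.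
apply: eq_integral => x _; rewrite mule_integral//; last 2 first.
- exact: measurable3_inty.
- by move=> y; apply: integral_ge0 => ? _.
by apply: eq_integral => y _; rewrite mule_integral//; exact: measurable3_z.
Qed.

Lemma measurable3_translate (w : 'rV[R]_3) (f : 'rV[R]_3 -> \bar R) : measurable3 f ->
  measurable3 (fun v => f (v + w)%R).
Proof.
move=> mf.
pose psi (p : R * R * R) : R * R * R :=
  ((p.1.1 + w 0 0)%R, (p.1.2 + w 0 1)%R, (p.2 + w 0 2%:R)%R).
have mpsi : measurable_fun setT psi.
  apply: measurable_fun_pair; [apply: measurable_fun_pair|]; apply: measurable_funD => //;
    exact: measurableT_comp.
have := measurableT_comp mf mpsi; rewrite /measurable3; congr measurable_fun.
apply/funext => p /=; congr f; rewrite -[w in RHS]vec3K; apply/rowP => j; rewrite !mxE.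
by case: j => -[|[|[|//]]].
Qed.

Lemma unit_cube_floor (v : 'rV[R]_3) (m : 'rV[int]_3) :
  unit_cube (v - map_mx intr m)%R <-> m = map_mx Num.floor v.
Proof.
have floorP (x : R) (k : int) : (`[0%R, 1%R[%classic (x - k%:~R)%R) <-> k = Num.floor x.
  rewrite /= in_itv/=; split=> [/andP[h1 h2]|->].
    by apply/esym/floor_def; rewrite intrD; apply/andP; split; lra.
  by have /andP[] := floor_itv x; rewrite intrD => h1 h2; apply/andP; split; lra.
split=> [[]|->].
  rewrite !mxE => /floorP h0 /floorP h1 /floorP h2.
  by apply: rV3P; rewrite mxE.
by split; rewrite !mxE; apply/floorP.
Qed.

(** Unfolding: after the substitution by [A], space is cut into integer translates of the unit cube
    and each is moved back to the cube. The volume of [S] becomes [|\det A|] times the integral over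
    the cube of the number of lattice points in a translate of [S]; [s] lists the finitely many
    points that can occur. *)
Lemma int3_averaging (S : set 'rV[R]_3) (A : 'M[R]_3) (s : seq 'rV[int]_3) (a b : R) :
  measurable3 (fun v => (\1_S v)%:E) -> \det A != 0%R -> uniq s ->
  (forall m u, unit_cube u -> S ((u + map_mx intr m)%R *m A) -> m \in s) ->
  (0 <= a)%R -> (forall u, unit_cube u ->
     a <= \sum_(m <- s) \1_S ((u + map_mx intr m)%R *m A) <= b)%R ->
  (`|\det A| * a)%:E <= int3 (fun v => (\1_S v)%:E) <= (`|\det A| * b)%:E.
Proof.
move=> mS dA us sP a0 ab.
have S0 v : 0 <= (\1_S v)%:E :> \bar R by rewrite lee_fin indicE ler0n.
have mC : measurable3 (fun v => (\1_unit_cube v)%:E) by exact: measurable3_box3.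
pose g (m : 'rV[int]_3) (v : 'rV[R]_3) : \bar R := (\1_S ((v + map_mx intr m)%R *m A) * \1_unit_cube v)%:E.
have mg m : measurable3 (g m).
  by apply: measurable3M mC; exact: (measurable3_translate _ (measurable3_mul A mS)).
have g0 m v : 0 <= g m v by rewrite lee_fin mulr_ge0// indicE ler0n.
(* Exactly one cube contains [v], the one indexed by the floors of its coordinates, so one term of
   the sum survives. *)
have E1 v : (\1_S (v *m A))%:E = \sum_(m <- s) g m (v + - map_mx intr m)%R.
  have gN m : m != map_mx Num.floor v -> g m (v - map_mx intr m)%R = 0.
    move=> mv; rewrite /g [X in (_ * X)%R](_ : _ = 0%R) ?mulr0// indicE memNset//.
    by move/unit_cube_floor => /eqP; rewrite (negbTE mv).
  have uv : unit_cube (v - map_mx intr (map_mx Num.floor v))%R by exact/unit_cube_floor.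
  have [vs|vs] := boolP (map_mx Num.floor v \in s).
    rewrite (bigD1_seq _ vs us)/= big1 ?adde0; last by move=> m /gN.
    by rewrite /g subrK [X in (_ * X)%R](_ : _ = 1%R) ?mulr1// indicE mem_set.
  rewrite big_seq big1; last by move=> m ms; apply: gN; apply: contra vs => /eqP <-.
  rewrite indicE memNset// => Sv; move/negP: vs; apply.
  by apply: (sP _ _ uv); rewrite subrK.
rewrite (int3_linear dA mS S0) !EFinM.
rewrite (_ : int3 _ = int3 (fun v => \sum_(m <- s) g m v)); last first.
  under eq_fun do rewrite E1.
  have mgt m : measurable3 (fun v => g m (v + - map_mx intr m)%R) by exact: measurable3_translate.
  rewrite (int3_sum s mgt _).2// (int3_sum s mg g0).2.
  by apply: eq_bigr => m _; rewrite int3_translate.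
have [mG _] := int3_sum s mg g0.
have E2 v : \sum_(m <- s) g m v =
    ((\sum_(m <- s) \1_S ((v + map_mx intr m)%R *m A)) * \1_unit_cube v)%:E.
  by rewrite sumEFin mulr_suml.
have C0 v : 0 <= (\1_unit_cube v)%:E :> \bar R by rewrite lee_fin indicE ler0n.
have b0 : (0 <= b)%R.
  have u0 : unit_cube 0%R.
    have /unit_cube_floor := erefl (map_mx Num.floor (0 : 'rV[R]_3)%R).
    rewrite (_ : (0 - _)%R = 0%R)//; apply/rowP => j; rewrite !mxE sub0r floor0 oppr0//.
  by have /andP[h1 h2] := ab _ u0; exact: le_trans (le_trans a0 h1) h2.
apply/andP; split; apply: lee_wpmul2l; rewrite ?lee_fin ?normr_ge0//.
- have -> : a%:E = int3 (fun v => a%:E * (\1_unit_cube v)%:E).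
    by rewrite (int3Z mC C0 _)// int3_unit_cube mule1.
  apply: le_int3 => //; first exact: measurable3Z.
    by move=> v; rewrite mule_ge0// lee_fin.
  move=> v; rewrite E2 -EFinM lee_fin indicE; case: (boolP (v \in _)) => [/set_mem/ab/andP[h _]|_].
    by rewrite !mulr1.
  by rewrite !mulr0.
- have -> : b%:E = int3 (fun v => b%:E * (\1_unit_cube v)%:E).
    by rewrite (int3Z mC C0 _)// int3_unit_cube mule1.
  apply: le_int3 => //; first exact: measurable3Z.
    by move=> v; exact: sume_ge0.
  move=> v; rewrite E2 -EFinM lee_fin indicE; case: (boolP (v \in _)) => [/set_mem/ab/andP[_ h]|_].
    by rewrite !mulr1.
  by rewrite !mulr0.
Qed.

Lemma integral_indic_expRN (k : R) (A : set R) : measurable A -> A `<=` [set x | 0 < x]%R ->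
  (0 <= k)%R ->
  \int[mu]_x (\1_A x * k)%:E = \int[mu]_y (\1_A (expR (- y)) * k * expR (- y))%:E.
Proof.
move=> mA A0 k0.
under eq_integral do rewrite mulrC EFinM.
rewrite -mule_integral//; last by apply/measurable_EFinP; exact: measurable_indic.
have -> : \int[mu]_x (\1_A x)%:E = mu A by rewrite integral_indic// setIT.
rewrite (lebesgue_measure_expRN mA A0) mule_integral//.
- by apply: eq_integral => y _; rewrite -EFinM; congr _%:E; ring.
- apply/measurable_EFinP; apply: measurable_funM; last exact: measurable_expRN.
  by apply: measurableT_comp measurable_expRN; exact: measurable_indic.
Qed.

(* The substitution [v = exp (- w)] is carried out one coordinate at a time, the coordinate at hand being moved to the innermost integral. *)
Lemma int3_expRN (D : set 'rV[R]_3) : measurable3 (fun v => (\1_D v)%:E) ->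
  (forall v, D v -> forall j, 0 < v 0 j)%R ->
  int3 (fun v => (\1_D v)%:E) =
  int3 (fun v => (\1_D (map_mx (fun y => expR (- y)) v) *
    expR (- v 0 0) * expR (- v 0 1) * expR (- v 0 2%:R))%:E)%R.
Proof.
move=> mD D0; pose e (y : R) := expR (- y).
have e0 y : (0 <= e y)%R := expR_ge0 _.
have me : measurable_fun setT e := measurable_expRN.
pose d x y z : R := \1_D (vec3 x y z).
have d0 x y z : (0 <= d x y z)%R by rewrite /d indicE ler0n.
have md (a b c : R * R * R -> R) : measurable_fun setT a -> measurable_fun setT b ->
    measurable_fun setT c -> measurable_fun setT (fun p => d (a p) (b p) (c p)).
  move=> ma mb mc; apply/measurable_EFinP.
  have mp := measurable_fun_pair (measurable_fun_pair ma mb) mc.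
  exact: (measurableT_comp mD mp).
have mset (a b c : R -> R) : measurable_fun setT a -> measurable_fun setT b ->
    measurable_fun setT c -> measurable [set t | D (vec3 (a t) (b t) (c t))].
  move=> ma mb mc; apply/(measurable_indicP R).
  have mp := measurable_fun_pair (measurable_fun_pair ma mb) mc.
  by have /measurable_EFinP := measurableT_comp mD mp.
pose f1 (v : 'rV[R]_3) : \bar R := (d (v 0 0) (v 0 1) (e (v 0 2%:R)) * e (v 0 2%:R))%:E%R.
pose f2 (v : 'rV[R]_3) : \bar R := (d (v 0 0) (e (v 0 1)) (e (v 0 2%:R)) * e (v 0 2%:R) * e (v 0 1))%:E%R.
pose f3 (v : 'rV[R]_3) : \bar R :=
  (d (e (v 0 0)) (e (v 0 1)) (e (v 0 2%:R)) * (e (v 0 2%:R) * e (v 0 1)) * e (v 0 0))%:E%R.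
have m1 : measurable_fun setT (fun p : R * R * R => p.1.1) by exact: measurableT_comp.
have m2 : measurable_fun setT (fun p : R * R * R => p.1.2) by exact: measurableT_comp.
have m3 : measurable_fun setT (fun p : R * R * R => p.2) by exact: measurable_snd.
have me1 := measurableT_comp me m1.
have me2 := measurableT_comp me m2.
have me3 := measurableT_comp me m3.
have mf1 : measurable3 f1.
  apply/measurable_EFinP; rewrite /=; under eq_fun do rewrite !vec3E.
  by apply: measurable_funM => //; exact: md.
have mf2 : measurable3 f2.
  apply/measurable_EFinP; rewrite /=; under eq_fun do rewrite !vec3E.
  by apply: measurable_funM => //; apply: measurable_funM => //; exact: md.
have p1 v : 0 <= f1 v by rewrite lee_fin mulr_ge0.
have p2 v : 0 <= f2 v by rewrite lee_fin !mulr_ge0.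
transitivity (int3 f1).
  apply: eq_integral => x _; apply: eq_integral => y _.
  transitivity (\int[mu]_z (\1_[set z | D (vec3 x y z)] z * 1)%:E).
    by apply: eq_integral => z _; rewrite mulr1.
  have zpos : [set z | D (vec3 x y z)] `<=` [set z | 0 < z]%R by move=> z /D0 /(_ 2%:R); rewrite vec3E.
  have mz : measurable [set z | D (vec3 x y z)].
    by apply: (mset (fun=> x) (fun=> y) id).
  rewrite (integral_indic_expRN mz zpos ler01).
  by apply: eq_integral => z _; rewrite /f1 !vec3E mulr1.
transitivity (int3 f2).
  rewrite (int3_swap23 mf1 p1) (int3_swap23 mf2 p2).
  apply: eq_integral => x _; apply: eq_integral => z _.
  have yp : [set y | D (vec3 x y (e z))] `<=` [set y | 0 < y]%R by move=> y /D0 /(_ 1%R); rewrite vec3E.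
  have my : measurable [set y | D (vec3 x y (e z))] by apply: (mset (fun=> x) id (fun=> e z)).
  transitivity (\int[mu]_y (\1_[set y | D (vec3 x y (e z))] y * e z)%:E).
    by apply: eq_integral => y _; rewrite /f1 !vec3E.
  rewrite (integral_indic_expRN my yp (e0 z)).
  by apply: eq_integral => y _; rewrite /f2 !vec3E.
transitivity (int3 f3); last first.
  congr int3; apply/funext => v; rewrite /f3; congr _%:E.
  rewrite /d (_ : vec3 _ _ _ = map_mx e v).
    by rewrite /e; ring.
  by apply: rV3P; rewrite !mxE.
pose sw (f : 'rV[R]_3 -> \bar R) (v : 'rV[R]_3) := f (vec3 (v 0 1) (v 0 0) (v 0 2%:R))%R.
have msw f : measurable3 f -> measurable3 (sw f).
  move=> mf; rewrite /measurable3 /sw; under eq_fun do rewrite !vec3E.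
  exact: (measurableT_comp mf (measurable_fun_pair (measurable_fun_pair m2 m1) m3)).
have swE f : measurable3 f -> (forall v, 0 <= f v) ->
    int3 f = \int[mu]_y \int[mu]_z \int[mu]_x f (vec3 x y z).
  move=> mf f0; rewrite (int3_swap12 mf f0).
  transitivity (int3 (sw f)).
    by do 3 apply: eq_integral => ? _; rewrite /sw !vec3E.
  have f0' v : 0 <= sw f v := f0 _.
  rewrite (int3_swap23 (msw _ mf) f0').
  by do 3 apply: eq_integral => ? _; rewrite /sw !vec3E.
have mf3 : measurable3 f3.
  apply/measurable_EFinP; rewrite /=; under eq_fun do rewrite !vec3E.
  by apply: measurable_funM => //; apply: measurable_funM; [exact: md|exact: measurable_funM].
have p3 v : 0 <= f3 v by rewrite lee_fin !mulr_ge0.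
rewrite (swE _ mf2 p2) (swE _ mf3 p3).
apply: eq_integral => y _; apply: eq_integral => z _.
have xp : [set x | D (vec3 x (e y) (e z))] `<=` [set x | 0 < x]%R by move=> x /D0 /(_ 0%R); rewrite vec3E.
have mx : measurable [set x | D (vec3 x (e y) (e z))] by apply: (mset id (fun=> e y) (fun=> e z)).
transitivity (\int[mu]_x (\1_[set x | D (vec3 x (e y) (e z))] x * (e z * e y))%:E).
  by apply: eq_integral => x _; rewrite /f2 !vec3E -mulrA.
rewrite (integral_indic_expRN mx xp (mulr_ge0 (e0 z) (e0 y))).
by apply: eq_integral => x _; rewrite /f3 !vec3E.
Qed.

(** The coordinates [(s, t, h)] of a logarithm vector: a half-open square for the two unit
    directions, and a height [h], unbounded below, for which [3 * h] will be the logarithm of the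
    norm. *)
Definition log_box (X : R) : set 'rV[R]_3 :=
  box3 `[0%R, 1%R[ `[0%R, 1%R[ [set h | expR (3 * h) <= X]%R.

Definition cone_piece (X : R) (B : 'M[R]_3) : set 'rV[R]_3 :=
  [set v : 'rV[R]_3 | (forall j, 0 < v 0 j)%R /\ log_box X (map_mx (@ln R) v *m invmx B)].

Lemma measurable_expR_le (X : R) : measurable [set h : R | expR (3 * h) <= X]%R.
Proof.
have m : measurable_fun [set: R] (fun h => expR (3 * h)%R).
  by apply: measurableT_comp => //; exact: measurable_funM.
have mI : measurable (`]-oo, X] : set R) by [].
have := m measurableT _ mI; rewrite setTI; congr measurable.
Qed.

Lemma measurable3_log_box X : measurable3 (fun v : 'rV[R]_3 => (\1_(log_box X) v)%:E).
Proof. by apply: measurable3_box3 => //; exact: measurable_expR_le. Qed.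

Lemma measurable3_cone_piece X B : measurable3 (fun v : 'rV[R]_3 => (\1_(cone_piece X B) v)%:E).
Proof.
pose P : set 'rV[R]_3 := box3 `]0%R, +oo[ `]0%R, +oo[ `]0%R, +oo[.
have mP : measurable3 (fun v => (\1_P v)%:E) by exact: measurable3_box3.
have mL := measurable3_map (@measurable_ln R) (measurable3_mul (invmx B) (measurable3_log_box X)).
have := measurable3M mP mL; congr measurable3; apply/funext => v; congr _%:E.
rewrite !indicE -natrM mulnb; congr (_%:R); congr nat_of_bool.
apply/idP/idP.
  move=> /andP[/set_mem[]]; rewrite /= !in_itv/= !andbT => h0 h1 h2 /set_mem hl.
  apply/mem_set; split => //; case=> -[|[|[|//]]] hj; [move: h0|move: h1|move: h2];
    by congr (0 < v _ _)%R; apply/val_inj.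
move=> /set_mem[h hl]; apply/andP; split; apply/mem_set => //.
by split; rewrite /= in_itv/= andbT.
Qed.

(** With [h = - y / 3] this is one third of the integral that gives the length of []0, X]]. *)
Lemma integral_expR3_le (X : R) : (0 < X)%R ->
  \int[mu]_h (\1_[set h : R | expR (3 * h) <= X]%R h * expR (3 * h))%:E = (X / 3)%:E.
Proof.
move=> X0.
have m3 : measurable_fun [set: R] (fun h => expR (3 * h)%R).
  by apply: measurableT_comp => //; exact: measurable_funM.
have c0 : (- (1 / 3) : R)%R != 0%R by rewrite oppr_eq0 mul1r invr_eq0 pnatr_eq0.
rewrite (ge0_integral_affine 0%R c0); last 2 first.
- apply/measurable_EFinP; apply: measurable_funM => //; apply: measurable_indic.
  exact: measurable_expR_le.
- by move=> h; rewrite lee_fin mulr_ge0 ?expR_ge0// indicE ler0n.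
have mI : measurable (`]0%R, X] : set R) by [].
have I0 : `]0%R, X]%classic `<=` [set x : R | 0 < x]%R.
  by move=> x /=; rewrite in_itv/= => /andP[].
have := lebesgue_measure_expRN mI I0.
rewrite lebesgue_measure_itv/= lte_fin X0 -EFinB subr0 => e.
rewrite (_ : \int[mu]_x _ = X%:E); last first.
  rewrite e; apply: eq_integral => y _; congr _%:E.
  have -> : (3 * (- (1 / 3) * y + 0) = - y)%R by field.
  congr (_ * _)%R; rewrite !indicE; congr (_%:R); congr nat_of_bool.
  apply/idP/idP => /set_mem h; apply/mem_set; move: h; rewrite /= in_itv/= expR_gt0.
    by have -> : (3 * (- (1 / 3) * y + 0) = - y)%R by field.
  by have -> : (3 * (- (1 / 3) * y + 0) = - y)%R by field.
rewrite -EFinM; congr _%:E; rewrite normrN normrM normr1 normfV ger0_norm//; field => //.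
Qed.

(** In the variables [(s, t, h)] the Jacobian of the exponential is the exponential of the sum of
    the coordinates of the logarithm vector. The row sums 0, 0, 3 make this [expR (3 * h)], so the
    integral factors. *)
Lemma int3_cone_piece (X : R) (B : 'M[R]_3) : (0 < X)%R -> \det B != 0%R ->
  (forall i, B i 0 + B i 1 + B i 2%:R = if i == 2%:R then 3 else 0)%R ->
  int3 (fun v => (\1_(cone_piece X B) v)%:E) = (`|\det B| * (X / 3))%:E.
Proof.
move=> X0 dB sB.
have uB : B \in unitmx by rewrite unitmxE unitfE.
rewrite int3_expRN; [|exact: measurable3_cone_piece|by move=> v []].
have E v : (\1_(cone_piece X B) (map_mx (fun y => expR (- y)) v) *
    expR (- v 0 0) * expR (- v 0 1) * expR (- v 0 2%:R))%R =
    (\1_(log_box X) (v *m - invmx B) * expR (- (v 0 0 + v 0 1 + v 0 2%:R)))%R :> R.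
  rewrite -!mulrA -!expRD !opprD addrA; congr (_ * _)%R.
  rewrite !indicE; congr (_%:R); congr nat_of_bool.
  have e : map_mx (@ln R) (map_mx (fun y => expR (- y)) v) *m invmx B = v *m - invmx B.
    rewrite mulmxN -mulNmx; congr (_ *m _); apply/rowP => j; rewrite !mxE expRK//.
  apply/idP/idP => /set_mem.
    by case=> _; rewrite e => h; apply/mem_set.
  move=> h; apply/mem_set; split; last by rewrite e.
  by move=> j; rewrite mxE expR_gt0.
under eq_fun do rewrite E.
have dNB : \det (- B) != 0%R by rewrite -scaleN1r detZ mulf_neq0// expf_neq0// oppr_eq0 oner_eq0.
have mE : measurable3 (fun v : 'rV[R]_3 => (expR (- (v 0 0 + v 0 1 + v 0 2%:R)))%:E)%R.
  have m := measurable_expRN (R := R).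
  have := measurable3_prod m m m; congr measurable3; apply/funext => v; congr _%:E.
  by rewrite -!expRD -!opprD.
rewrite (int3_linear dNB); last 2 first.
- by apply: measurable3M mE; exact: (measurable3_mul _ (measurable3_log_box X)).
- by move=> v; rewrite lee_fin mulr_ge0 ?expR_ge0// indicE ler0n.
have -> : `|\det (- B)|%R = `|\det B|%R.
  by rewrite -scaleN1r detZ normrM normrX normrN1 expr1n mul1r.
rewrite EFinM; congr (_ * _).
have E2 (v : 'rV[R]_3) : (\1_(log_box X) (v *m - B *m - invmx B) *
     expR (- ((v *m - B) 0 0 + (v *m - B) 0 1 + (v *m - B) 0 2%:R)))%R =
   (\1_`[0%R, 1%R[ (v 0 0) * \1_`[0%R, 1%R[ (v 0 1) *
     (\1_[set h : R | expR (3 * h) <= X] (v 0 2%:R) * expR (3 * v 0 2%:R)))%R :> R.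
  have -> : v *m - B *m - invmx B = v by rewrite !mulmxN mulNmx opprK mulmxK.
  rewrite indic_box3 -!mulrA; do 3 congr (_ * _)%R.
  congr expR; rewrite -[v in LHS]vec3K vec3_mul !vec3E !mxE.
  transitivity (v 0 0 * (B 0 0 + B 0 1 + B 0 2%:R) + v 0 1 * (B 1 0 + B 1 1 + B 1 2%:R)
     + v 0 2%:R * (B 2%:R 0 + B 2%:R 1 + B 2%:R 2%:R))%R; first ring.
  by rewrite !sB/=; ring.
under eq_fun do rewrite E2.
have e1 : \int[mu]_x (\1_(`[0%R, 1%R[%classic : set R) x)%:E = (1%R : R)%:E.
  have -> : \int[mu]_x (\1_(`[0%R, 1%R[%classic : set R) x)%:E = mu `[0%R, 1%R[%classic by rewrite integral_indic// setIT.
  by rewrite lebesgue_measure_itv/= lte_fin ltr01 -EFinB subr0.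
have me : measurable_fun [set: R] (fun h => \1_[set h : R | expR (3 * h) <= X]%R h * expR (3 * h))%R.
  apply: measurable_funM; first by apply: measurable_indic; exact: measurable_expR_le.
  by apply: measurableT_comp => //; exact: measurable_funM.
have h0 (h : R) : (0 <= \1_[set h : R | expR (3 * h) <= X]%R h * expR (3 * h))%R.
  by rewrite mulr_ge0 ?expR_ge0// indicE ler0n.
rewrite (int3_prod _ _ me _ _ h0 e1 e1 (integral_expR3_le X0)) ?mul1r//.
Qed.

End cone_volume.

(** * Counting points of a planar lattice *)

Section counting.

(** [ncard] is 0 on infinite sets, so a bound on it says nothing about finiteness; [atmost] carries
    finiteness and the bound together. *)
Definition atmost (T : choiceType) (N : nat) (A : set T) :=
  exists2 s : seq T, (size s <= N)%N & A `<=` [set` s].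

Lemma atmost_sub (T : choiceType) N (A B : set T) : A `<=` B -> atmost N B -> atmost N A.
Proof. by move=> AB [s sN Bs]; exists s => //; exact: subset_trans Bs. Qed.

Lemma atmost_le (T : choiceType) N M (A : set T) : (N <= M)%N -> atmost N A -> atmost M A.
Proof. by move=> NM [s sN As]; exists s => //; exact: leq_trans NM. Qed.

Lemma atmost_cover (T : choiceType) (I : finType) N (F : I -> set T) (A : set T) :
  (forall i, atmost N (F i)) -> A `<=` \bigcup_i F i -> atmost (#|I| * N) A.
Proof.
move=> FN AF.
have {}FN i : exists s : seq T, (size s <= N)%N /\ F i `<=` [set` s].
  by have [s sN Fs] := FN i; exists s.
have [s sP] := choice FN.
exists (flatten [seq s i | i <- enum I]).
  rewrite size_flatten /shape -map_comp cardE.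
  elim: (enum I) => //= i e IH; rewrite mulSn leq_add//; exact: (sP i).1.
move=> x /AF[i _ Fx]; apply/flattenP; exists (s i); last exact: (sP i).2.
by apply/mapP; exists i; rewrite ?mem_enum.
Qed.

Lemma atmost_inj (T : choiceType) (I : finType) (f : T -> I) (A : set T) :
  (forall x y, A x -> A y -> f x = f y -> x = y) -> atmost #|I| A.
Proof.
move=> finj; have [[x0 Ax0]|A0] := pselect (exists x, A x); last first.
  by exists [::] => // x Ax; case: A0; exists x.
pose g i := xget x0 [set x | A x /\ f x = i].
exists [seq g i | i <- enum I]; first by rewrite size_map -cardE.
move=> x Ax; apply/mapP; exists (f x); first by rewrite mem_enum.
rewrite /g; case: xgetP => [y _ [Ay fy]|/(_ x)]; last by case.
exact: finj.
Qed.

Lemma atmost_finite (T : choiceType) N (A : set T) : atmost N A -> finite_set A.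
Proof. by move=> [s _ As]; apply: sub_finite_set As _; exact: finite_seq. Qed.

Lemma atmost_ncard (T : choiceType) N (A : set T) : atmost N A -> (ncard A <= N)%N.
Proof.
move=> AN; have fA := atmost_finite AN; have [s sN As] := AN.
apply: leq_trans sN; apply: uniq_leq_size; first exact: fset_uniq.
by move=> x; rewrite in_fset_set// => /set_mem /As.
Qed.

Lemma ncard_seq (T : choiceType) (s : seq T) (A : set T) : uniq s ->
  A = [set` s] -> ncard A = size s.
Proof.
move=> us ->; rewrite /ncard; apply: perm_size; apply: uniq_perm => // x.
rewrite in_fset_set; last exact: finite_seq.
by apply/idP/idP => [/set_mem|h]; [|exact/mem_set].
Qed.

Lemma ncard_sum_indic (T : choiceType) (R : realType) (s : seq T) (A : set T) : uniq s ->
  (forall x, A x -> x \in s) -> \sum_(x <- s) \1_A x = (ncard A)%:R :> R.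
Proof.
move=> us As; rewrite (@ncard_seq _ [seq x <- s | x \in A])//; last 2 first.
- exact: filter_uniq.
- apply/seteqP; split=> x /=; first by move=> Ax; rewrite mem_filter mem_set//=; exact: As.
  by rewrite mem_filter => /andP[/set_mem].
rewrite size_filter -sum1_count natr_sum [in RHS]big_mkcond/=.
by apply: eq_bigr => x _; rewrite indicE; case: (x \in A).
Qed.

Lemma ncard_le_diff (T : choiceType) (A B : set T) E : finite_set A -> finite_set B ->
  atmost E (A `\` B) -> (ncard A <= ncard B + E)%N.
Proof.
move=> fA fB [s sE ABs]; apply: (@leq_trans (size (enum_fset (fset_set B) ++ s))).
  apply: uniq_leq_size; first exact: fset_uniq.
  move=> x; rewrite mem_cat !in_fset_set// => /set_mem Ax.
  by have [Bx|Bx] := pselect (B x); [rewrite mem_set|rewrite ABs// orbT].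
by rewrite size_cat leq_add.
Qed.

End counting.

(** * Lattices whose nonzero points have norm at least 1 *)

Section lattice.
Context {R : realType}.
Implicit Types (A : 'M[R]_3) (c v w : 'rV[R]_3) (m : 'rV[int]_3).

Definition lat A m : 'rV[R]_3 := map_mx intr m *m A.

Lemma latD A m m' : lat A (m + m') = lat A m + lat A m'.
Proof. by rewrite /lat map_mxD mulmxDl. Qed.

Lemma latN A m : lat A (- m) = - lat A m.
Proof. by rewrite /lat map_mxN mulNmx. Qed.

Lemma latB A m m' : lat A (m - m') = lat A m - lat A m'.
Proof. by rewrite latD latN. Qed.

Lemma lat_subE A m m' k : lat A (m - m') 0 k = lat A m 0 k - lat A m' 0 k.
Proof. by rewrite latB !mxE. Qed.

Lemma truncnP (x : R) : 0 <= x -> (Num.truncn x)%:R <= x /\ x < (Num.truncn x)%:R + 1.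
Proof. by move=> /truncn_itv/andP[h1 h2]; rewrite natr1. Qed.

(** Unlike the lengths of lattice vectors, this survives any diagonal rescaling of determinant 1 or
    -1, which is what makes the later counts uniform. *)
Definition norm_ge1 A := forall m, m != 0 -> 1 <= \prod_(j < 3) `|lat A m 0 j|.

Definition near c (r : R) v := forall j, `|v 0 j - c 0 j| <= r.

Lemma near0P (r : R) v : near 0 r v <-> forall j, `|v 0 j| <= r.
Proof. by split=> h j; move: (h j); rewrite mxE subr0. Qed.

Definition planar A (r : R) := exists2 n : 'cV[R]_3, n != 0 &
  forall m, near 0 r (lat A m) -> lat A m *m n = 0.

Lemma sum_ord3 (V : nmodType) (F : 'I_3 -> V) (j : 'I_3) :
  \sum_(k < 3) F k = F j + F (j + 1) + F (j + 1 + 1).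
Proof.
rewrite !big_ord_recl big_ord0 addr0.
case: j => -[|[|[|//]]] h; rewrite ?addrA//.
- by congr (F _ + F _ + F _); apply/val_inj.
- by rewrite -addrA addrC; congr (F _ + F _ + F _); apply/val_inj.
- by rewrite addrC addrA; congr (F _ + F _ + F _); apply/val_inj.
Qed.

Lemma prod_ord3 (F : 'I_3 -> R) (j : 'I_3) :
  \prod_(k < 3) F k = F j * F (j + 1) * F (j + 1 + 1).
Proof.
rewrite !big_ord_recl big_ord0 mulr1.
case: j => -[|[|[|//]]] h; rewrite ?mulrA//.
- by congr (F _ * F _ * F _); apply/val_inj.
- by rewrite -mulrA mulrC; congr (F _ * F _ * F _); apply/val_inj.
- by rewrite mulrC mulrA; congr (F _ * F _ * F _); apply/val_inj.
Qed.

(** Differences of points near [c] lie in the cube of radius [2 * r], hence in the plane with normal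
    [n]. There the coordinate [j] with [|n j|] largest is at most the sum of the other two in
    absolute value. If two points share a cell of side 1/2 in those two coordinates, their
    difference has coordinates below 1/2, 1/2 and 1, so a product below 1, and it vanishes. *)
Lemma planar_count A (r : R) c : 0 < r -> norm_ge1 A -> planar A (2 * r) ->
  atmost ((Num.truncn (4 * r)).+1 ^ 2) [set m | near c r (lat A m)].
Proof.
move=> r0 nA [n n0 pl].
have [j nj] : exists j : 'I_3, forall k, `|n k 0| <= `|n j 0|.
  pose j := [arg max_(i > (0 : 'I_3)) `|n i 0|]%O.
  by exists j => k; rewrite /j; case: Order.TotalTheory.arg_maxP => // i _ /(_ k); apply.
have nj0 : 0 < `|n j 0|.
  rewrite lt_def normr_ge0 andbT; apply: contra n0 => /eqP z.
  apply/eqP/matrixP => i k; rewrite ord1 mxE; apply/eqP; rewrite -normr_le0 -z; exact: nj.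
(* Each coordinate ranges over an interval of length [2 * r], cut into cells of length 1/2; the
   successor leaves room for the right endpoint. *)
set K := (Num.truncn (4 * r)).+1.
pose cell (k : 'I_3) m : 'I_K := inord (Num.truncn (2 * (lat A m 0 k - c 0 k + r))).
have cellP k m m' : near c r (lat A m) -> near c r (lat A m') -> cell k m = cell k m' ->
    `|lat A (m - m') 0 k| < 1 / 2.
  move=> hm hm' /(congr1 val); rewrite /= !inordK.
  - move: (hm k) (hm' k); rewrite !ler_norml => /andP[a1 a2] /andP[b1 b2] e.
    have p1 : 0 <= 2 * (lat A m 0 k - c 0 k + r) by lra.
    have p2 : 0 <= 2 * (lat A m' 0 k - c 0 k + r) by lra.
    have [i3 i4] := truncnP p1; have := truncnP p2; rewrite -e => -[i1 i2].
    by rewrite lat_subE ltr_norml; apply/andP; split; lra.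
  - rewrite ltnS; apply: le_truncn; move: (hm' k); rewrite ler_norml => /andP[]; lra.
  - rewrite ltnS; apply: le_truncn; move: (hm k); rewrite ler_norml => /andP[]; lra.
have <- : #|{: 'I_K * 'I_K}| = (K ^ 2)%N by rewrite card_prod card_ord mulnn.
apply: (@atmost_inj _ _ (fun m => (cell (j + 1) m, cell (j + 1 + 1) m))).
move=> m m' hm hm' [e1 e2]; apply/eqP; rewrite -subr_eq0; apply/negP => /negP/nA.
have h1 := cellP _ _ _ hm hm' e1; have h2 := cellP _ _ _ hm hm' e2.
have : near 0 (2 * r) (lat A (m - m')).
  apply/near0P => k; have := hm k; have := hm' k; rewrite lat_subE !ler_norml => /andP[? ?] /andP[? ?].
  by apply/andP; split; lra.
move=> /pl /matrixP /(_ 0 0); rewrite mxE [X in _ = X -> _]mxE (sum_ord3 _ j) (prod_ord3 _ j).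
move: h1 h2; set x := lat A _ 0 j; set y := lat A _ 0 _; set z := lat A _ 0 _ => h1 h2 e.
have hx : `|x| < 1.
  rewrite -(ltr_pM2r nj0) mul1r -normrM.
  have -> : x * n j 0 = - (y * n (j + 1) 0 + z * n (j + 1 + 1) 0) by lra.
  rewrite normrN; apply: le_lt_trans (ler_normD _ _) _; rewrite !normrM.
  have := nj (j + 1); have := nj (j + 1 + 1) => k1 k2.
  have : `|y| * `|n (j + 1) 0| <= `|y| * `|n j 0| by rewrite ler_wpM2l.
  have : `|z| * `|n (j + 1 + 1) 0| <= `|z| * `|n j 0| by rewrite ler_wpM2l.
  have : `|y| * `|n j 0| < 1 / 2 * `|n j 0| by rewrite ltr_pM2r.
  have : `|z| * `|n j 0| < 1 / 2 * `|n j 0| by rewrite ltr_pM2r.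
  lra.
have ? := normr_ge0 x; have ? := normr_ge0 y; have ? := normr_ge0 z.
have : `|x| * `|y| * `|z| <= 1 * (1/2) * (1/2) by rewrite !ler_pM ?mulr_ge0// ltW.
lra.
Qed.

(** Two such points would differ by at most 1/2 in each coordinate, so by a vector of norm at most
    1/8. *)
Lemma small_count A c : norm_ge1 A -> atmost 1 [set m | near c (1 / 4) (lat A m)].
Proof.
move=> nA; apply: (@atmost_le _ #|'I_1|); first by rewrite card_ord.
apply: (@atmost_inj _ 'I_1 (fun=> ord0)).
move=> m m' hm hm' _; apply/eqP; rewrite -subr_eq0; apply/negP => /negP/nA.
have h k : `|lat A (m - m') 0 k| <= 1 / 2.
  have := hm k; have := hm' k; rewrite lat_subE !ler_norml => /andP[? ?] /andP[? ?].
  by apply/andP; split; lra.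
rewrite (prod_ord3 _ 0) leNgt => /negP; apply.
have : `|lat A (m - m') 0 0| * `|lat A (m - m') 0 (0 + 1)| * `|lat A (m - m') 0 (0 + 1 + 1)| <=
  1 / 2 * (1 / 2) * (1 / 2) by rewrite !ler_pM ?mulr_ge0.
lra.
Qed.

Lemma ball_count_mul A (r : R) (k N : nat) : 0 < r -> (0 < k)%N ->
  (forall c, atmost N [set m | near c r (lat A m)]) ->
  forall c, atmost (k ^ 3 * N) [set m | near c (k%:R * r) (lat A m)].
Proof.
move=> r0 k0 hN c; case: k k0 => // k _.
pose ctr (i : 'I_k.+1 * 'I_k.+1 * 'I_k.+1) : 'rV[R]_3 :=
  c + (2 * r) *: vec3 (i.1.1%:R) (i.1.2%:R) (i.2%:R) - const_mx (k%:R * r).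
have <- : #|{: 'I_k.+1 * 'I_k.+1 * 'I_k.+1}| = (k.+1 ^ 3)%N.
  by rewrite !card_prod card_ord !expnS expn0 muln1 mulnA.
apply: (@atmost_cover _ _ _ (fun i => [set m | near (ctr i) r (lat A m)])); first by move=> i.
move=> m hm; pose x (j : 'I_3) : R := (lat A m 0 j - c 0 j + k.+1%:R * r) / (2 * r).
have : forall j, exists i : 'I_k.+1, (nat_of_ord i)%:R <= x j <= i%:R + 1.
  move=> j.
  have := hm j; rewrite /= ler_norml => /andP[h1 h2].
  have x0 : 0 <= x j by rewrite divr_ge0; lra.
  have xk : x j <= k%:R + 1 by rewrite ler_pdivrMr ?mulr_gt0//; rewrite -natr1 in h2; lra.
  have [lk|kl] := ltnP (Num.truncn (x j)) k.+1.
    exists (Ordinal lk) => /=; by have [-> /ltW ->] := truncnP x0.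
  (* The far face of the cube, where [x j] equals [k.+1], belongs to the last cell. *)
  exists ord_max => /=; rewrite xk andbT.
  have [h _] := truncnP x0; apply: le_trans h; rewrite ler_nat; exact: ltnW.
move=> /choice[i iP].
exists (i 0, i 1, i 2%:R) => //= j.
have -> : ctr (i 0, i 1, i 2%:R) 0 j = c 0 j + 2 * r * (i j)%:R - k%:R * r.
  rewrite /ctr !mxE /=; congr (_ + _ * _ - _).
  by case: j => -[|[|[|//]]] hj /=; congr (_%:R); congr (nat_of_ord (i _)); apply/val_inj.
have /andP[h1 h2] := iP j; rewrite ler_norml.
have e : lat A m 0 j = x j * (2 * r) - k.+1%:R * r + c 0 j by rewrite /x -natr1; field; lra.
have l1 : (i j)%:R * (2 * r) <= x j * (2 * r) by rewrite ler_pM2r//; lra.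
have l2 : x j * (2 * r) <= ((i j)%:R + 1) * (2 * r) by rewrite ler_pM2r//; lra.
by rewrite e -natr1; apply/andP; split; lra.
Qed.

End lattice.

(** * The boundary of a piece of a cone *)

Section boundary.
Context {R : realType}.
Implicit Types (p q u v : 'rV[R]_3).

(** From [expR (- 1 / 6) >= 5 / 6] one gets [expR (1 / 6) <= 6 / 5], and the twelfth power of 6/5 is
    below 9. The exponents occurring in a piece have absolute value at most 2, so 9 bounds their
    exponentials, the inverses of these, and the Lipschitz constant. *)
Lemma expR2_le9 : expR 2 <= 9 :> R.
Proof.
have h : expR (1 / 6) <= 6 / 5 :> R.
  have := expR_ge1Dx (- (1 / 6) : R); rewrite expRN => h.
  have p := expR_gt0 (1 / 6 : R).
  rewrite -[leLHS]invrK -[leRHS]invrK lef_pV2 ?posrE ?invr_gt0 ?divr_gt0//.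
  by apply: le_trans h; rewrite invf_div; lra.
have -> : (2 : R) = 12%:R * (1 / 6) by field.
rewrite expRM_natl; apply: (@le_trans _ _ ((6 / 5) ^+ 12)).
  by apply: lerXn2r => //; rewrite nnegrE ?expR_ge0 ?divr_ge0.
lra.
Qed.

Lemma expR_dist (x y : R) : x <= 2 -> y <= 2 -> `|expR x - expR y| <= 9 * `|x - y|.
Proof.
wlog xy : x y / y <= x => [hw|] x2 y2.
  have [yx|/ltW xy] := leP y x; first exact: hw.
  by rewrite distrC (distrC x); exact: hw.
rewrite !ger0_norm ?subr_ge0 ?ler_expR//.
have h := expR_ge1Dx (y - x).
have -> : expR x - expR y = expR x * (1 - expR (y - x)).
  by rewrite mulrBr mulr1 -expRD addrCA subrr addr0.
have ex : expR x <= 9 by apply: le_trans expR2_le9; rewrite ler_expR.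
apply: (@le_trans _ _ (expR x * (x - y))).
  by rewrite ler_wpM2l ?expR_ge0//; lra.
by rewrite ler_wpM2r ?subr_ge0.
Qed.

(** The row of ones makes the third coordinate the logarithm of a common dilation factor. *)
Definition frame p q : 'M[R]_3 :=
  \matrix_(i, j) (if i == 0 then p 0 j else if i == 1 then q 0 j else 1).

Lemma vec3_frame p q s t h j : (vec3 s t h *m frame p q) 0 j = s * p 0 j + t * q 0 j + h.
Proof. by rewrite !mxE !big_ord_recl big_ord0 !mxE/= mulr1 addr0 addrA. Qed.

Lemma cone_pieceP X p q v : \det (frame p q) != 0 ->
  cone_piece X (frame p q) v <-> exists s t h, [/\ 0 <= s < 1, 0 <= t < 1, expR (3 * h) <= X &
    forall j, v 0 j = expR (s * p 0 j + t * q 0 j + h)].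
Proof.
move=> dF; have uF : frame p q \in unitmx by rewrite unitmxE unitfE.
split=> [[v0]|[s [t [h [s01 t01 hX vE]]]]].
  set w := _ *m _ => -[]; rewrite /= !in_itv/= => s01 t01 hX.
  exists (w 0 0), (w 0 1), (w 0 2%:R); split=> // j.
  by rewrite -vec3_frame vec3K /w mulmxKV// mxE lnK// posrE.
split=> [j|]; first by rewrite vE expR_gt0.
have -> : map_mx (@ln R) v *m invmx (frame p q) = vec3 s t h.
  apply: (canLR (mulmxK uF)); apply/rowP => j.
  by rewrite vec3_frame mxE vE expRK.
by split; rewrite !vec3E /= ?in_itv.
Qed.

(** The dilation factor is [r] itself rather than its logarithm, so that [r = 0], the apex of the
    cone, is allowed. *)
Definition surface_point p q (r s t : R) : 'rV[R]_3 := \row_j (r * expR (s * p 0 j + t * q 0 j)).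

Lemma exponent_le p q s t j : (forall j, `|p 0 j| <= 1) -> (forall j, `|q 0 j| <= 1) ->
  0 <= s <= 1 -> 0 <= t <= 1 -> `|s * p 0 j + t * q 0 j| <= 2.
Proof.
move=> p1 q1 /andP[s0 s1] /andP[t0 t1]; apply: le_trans (ler_normD _ _) _.
rewrite !normrM (ger0_norm s0) (ger0_norm t0).
have : s * `|p 0 j| <= 1 * 1 by apply: ler_pM.
have : t * `|q 0 j| <= 1 * 1 by apply: ler_pM.
lra.
Qed.

Lemma cone_piece_radius (L : R) p q v (L0 : 0 < L) (dF : \det (frame p q) != 0) :
  cone_piece (L ^+ 3) (frame p q) v -> exists r s t, [/\ 0 < r <= L, 0 <= s < 1, 0 <= t < 1 &
  v = surface_point p q r s t].
Proof.
move=> /(cone_pieceP _ _ dF)[s [t [h [s01 t01 hX vE]]]].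
exists (expR h), s, t; split=> //.
  rewrite expR_gt0/=; move: hX; rewrite expRM_natl.
  by rewrite ler_pXn2r// nnegrE ?expR_ge0// ltW.
by apply/rowP => j; rewrite mxE vE addrC expRD.
Qed.

Lemma cone_piece_near (L : R) p q v (L0 : 0 < L) (p1 : forall j, `|p 0 j| <= 1) (q1 : forall j, `|q 0 j| <= 1)
  (dF : \det (frame p q) != 0) : cone_piece (L ^+ 3) (frame p q) v -> near 0 (9 * L) v.
Proof.
move=> /(cone_piece_radius L0 dF)[r [s [t [/andP[r0 rL] /andP[s0 s1] /andP[t0 t1] ->]]]].
apply/near0P => j; rewrite mxE ger0_norm ?mulr_ge0 ?expR_ge0 ?(ltW r0)// mulrC.
apply: ler_pM; rewrite ?expR_ge0 ?(ltW r0)// (le_trans _ expR2_le9)// ler_expR.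
by apply: le_trans (exponent_le j p1 q1 _ _); [exact: ler_norm| |]; rewrite ?s0 ?t0 ltW.
Qed.

Definition on_boundary (L r s t : R) := [|| r == L, s == 0, s == 1, t == 0 | t == 1].

(** On the segment from [v] to [v + u] the logarithmic coordinates vary continuously, so leaving the
    piece means meeting one of its faces, at distance at most [D] from [v]. The apex, where
    logarithms fail, is treated apart and costs the factor 81. *)
Lemma boundary_near (L D : R) p q u v (L0 : 0 < L) (D0 : 0 < D) (p1 : forall j, `|p 0 j| <= 1) (q1 : forall j, `|q 0 j| <= 1)
  (dF : \det (frame p q) != 0) (S := cone_piece (L ^+ 3) (frame p q)) : (forall j, `|u 0 j| <= D) -> S v -> ~ S (v + u) ->
  exists r s t, [/\ 0 <= r <= L, 0 <= s <= 1, 0 <= t <= 1, on_boundary L r s t &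
    near (surface_point p q r s t) (81 * D) v].
Proof.
move=> uD Sv Svu; have [r [s [t [/andP[r0 rL] /andP[s0 s1] /andP[t0 t1] vE]]]] := cone_piece_radius L0 dF Sv.
have sI : 0 <= s <= 1 by rewrite s0 ltW.
have tI : 0 <= t <= 1 by rewrite t0 ltW.
have vjE j : v 0 j = r * expR (s * p 0 j + t * q 0 j) by rewrite vE mxE.
(* If some coordinate is at most [D], then [r <= 9 * D] and all coordinates are at most [9 * r], so
   [v] is within [81 * D] of the apex. Otherwise the whole segment stays in the positive octant. *)
have [[j vj]|vD] := pselect (exists j, v 0 j <= D).
  exists 0, 0, 0; rewrite /on_boundary lexx ler01 ltW// eqxx !orbT; split=> // k.
  rewrite mxE mul0r subr0 vjE ger0_norm ?mulr_ge0 ?expR_ge0 ?(ltW r0)//.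
  have r9 : r <= 9 * D.
    have h : 1 <= 9 * expR (s * p 0 j + t * q 0 j).
      apply: (@le_trans _ _ (expR (- (s * p 0 j + t * q 0 j)) * expR (s * p 0 j + t * q 0 j))).
        by rewrite mulrC expRxMexpNx_1.
      rewrite ler_wpM2r ?expR_ge0// (le_trans _ expR2_le9)// ler_expR.
      by apply: le_trans (exponent_le j p1 q1 sI tI); rewrite -normrN; exact: ler_norm.
    apply: (@le_trans _ _ (9 * (r * expR (s * p 0 j + t * q 0 j)))).
      by rewrite mulrCA ler_peMr// ltW.
    by rewrite ler_pM2l// -vjE.
  have -> : 81 * D = 9 * D * 9 by ring.
  apply: ler_pM; rewrite ?expR_ge0 ?(ltW r0)// (le_trans _ expR2_le9)// ler_expR.
  by apply: le_trans (exponent_le k p1 q1 sI tI); exact: ler_norm.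
have {}vD j : D < v 0 j by rewrite ltNge; apply/negP => h; apply: vD; exists j.
pose x (c : R) : 'rV[R]_3 := v + c *: u.
have x0 c j : 0 <= c <= 1 -> 0 < x c 0 j.
  move=> /andP[c0 c1]; rewrite /x !mxE.
  have : - (c * u 0 j) <= 1 * D.
    apply: le_trans (ler_norm _) _; rewrite normrN normrM (ger0_norm c0).
    by apply: ler_pM.
  by have := vD j; lra.
pose y (c : R) := map_mx (@ln R) (x c) *m invmx (frame p q).
have uF : frame p q \in unitmx by rewrite unitmxE unitfE.
have xE c : 0 <= c <= 1 -> forall j, x c 0 j =
    expR (y c 0 0 * p 0 j + y c 0 1 * q 0 j + y c 0 2%:R).
  by move=> cI j; rewrite -vec3_frame vec3K /y mulmxKV// [in RHS]mxE lnK// posrE x0.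
have cont k c : 0 <= c <= 1 -> {for c, continuous (fun c => y c 0 k : R^o)}.
  move=> cI; pose f (j : 'I_3) (e : R) : R^o := ln (v 0 j + e * u 0 j) * invmx (frame p q) j k.
  have -> : (fun c => y c 0 k : R^o) = f ord0 \+ (f (lift ord0 ord0) \+ f (lift ord0 (lift ord0 ord0))).
    apply/funext => e; rewrite /y mxE !big_ord_recl big_ord0 addr0 /f /=.
    by rewrite !mxE.
  have fc j : {for c, continuous (f j)}.
    apply: continuousM; last exact: cvg_cst.
    apply: (continuous_comp (f := fun e : R => v 0 j + e * u 0 j) (g := @ln R)).
      by apply: continuousD; [exact: cvg_cst|apply: continuousM; [exact: cvg_id|exact: cvg_cst]].
    by apply: continuous_ln; have := x0 c j cI; rewrite /x !mxE.
  by apply: continuousD; [exact: fc|apply: continuousD; exact: fc].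
(* [g c <= 0] says that [x c] satisfies all the closed inequalities of the piece; at a zero of [g]
   one of them is an equality. *)
pose g (c : R) : R^o := Num.max (Num.max (Num.max (- y c 0 0) (y c 0 0 - 1)) (Num.max (- y c 0 1) (y c 0 1 - 1)))
  (y c 0 2%:R - ln L).
have gcont : {within `[0, 1], continuous g}.
  apply: continuous_in_subspaceT => c; rewrite inE/= in_itv/= => cI.
  have h0 := cont 0 c cI; have h1 := cont 1 c cI; have h2 := cont 2%:R c cI.
  have k0 := @continuousN _ _ _ _ _ h0; have k1 := @continuousN _ _ _ _ _ h1.
  have cc (e : R) : {for c, continuous (fun=> e : R^o)} by exact: cvg_cst.
  have j0 := @continuousB _ _ _ _ _ _ h0 (cc 1); have j1 := @continuousB _ _ _ _ _ _ h1 (cc 1).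
  have j2 := @continuousB _ _ _ _ _ _ h2 (cc (ln L)).
  exact: (continuous_max (continuous_max (continuous_max k0 j0) (continuous_max k1 j1)) j2).
have lnL c : (y c 0 2%:R <= ln L) = (expR (3 * y c 0 2%:R) <= L ^+ 3).
  by rewrite expRM_natl ler_pXn2r ?nnegrE ?expR_ge0 ?(ltW L0)// -[in RHS](lnK L0) ler_expR.
have g0 : g 0 <= 0.
  have [_] := Sv; have -> : v = x 0 by rewrite /x scale0r addr0.
  rewrite -/(y 0) => -[]; rewrite /= !in_itv/= -lnL => /andP[a1 a2] /andP[b1 b2] h3.
  by rewrite /g !ge_max; repeat (apply/andP; split); [clear -a1|clear -a2|clear -b1|clear -b2|clear -h3]; lra.
have g1 : 0 <= g 1.
  rewrite leNgt; apply/negP; rewrite /g !gt_max => /andP[/andP[/andP[a1 a2] /andP[b1 b2]] h3].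
  apply: Svu; have -> : v + u = x 1 by rewrite /x scale1r.
  split; first by move=> j; apply: x0; rewrite ler01 lexx.
  by rewrite -/(y 1); split; rewrite /= ?in_itv/= -?lnL ?ltrBlDr ?add0r//; (try apply/andP; try split); lra.
have [c cI gc] : exists2 c, c \in `[0, 1] & g c = 0.
  by apply: IVT => //; rewrite ge_min le_max g0 g1 orbT.
rewrite in_itv/= in cI.
have := lexx (g c); rewrite {2}gc {1}/g !ge_max => /andP[/andP[/andP[a1 a2] /andP[b1 b2]] h3].
exists (expR (y c 0 2%:R)), (y c 0 0), (y c 0 1).
have eL : expR (y c 0 2%:R) <= L by rewrite -[in X in _ <= X](lnK L0) ler_expR; clear -h3; lra.
split; rewrite ?expR_ge0//.
- by apply/andP; split; [clear -a1|clear -a2]; lra.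
- by apply/andP; split; [clear -b1|clear -b2]; lra.
- have := lexx (g c); rewrite {1}gc /g !le_max -!orbA /on_boundary.
  move=> /orP[h|/orP[h|/orP[h|/orP[h|h]]]].
  + by apply/orP; right; apply/orP; left; apply/eqP; clear -h a1; lra.
  + by do 2 (apply/orP; right); apply/orP; left; apply/eqP; clear -h a2; lra.
  + by do 3 (apply/orP; right); apply/orP; left; apply/eqP; clear -h b1; lra.
  + by do 4 (apply/orP; right); apply/eqP; clear -h b2; lra.
  + apply/orP; left; have -> : y c 0 2%:R = ln L by clear -h h3; lra.
    by rewrite lnK.
- move=> j; have -> : surface_point p q (expR (y c 0 2%:R)) (y c 0 0) (y c 0 1) 0 j = v 0 j + c * u 0 j.
    by rewrite mxE -expRD [y c 0 2%:R + _]addrC -xE// /x !mxE.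
  rewrite opprD addrA subrr sub0r normrN normrM.
  move: cI => /andP[c0 c1]; rewrite (ger0_norm c0).
  apply: (@le_trans _ _ (1 * D)); first by apply: ler_pM.
  by rewrite ler_pM2r// ler1n.
Qed.

(** 27 = 9 + 18: the change of [r] is multiplied by an exponential at most 9, and the exponent
    changes by at most [2 * e] under a Lipschitz constant 9. *)
Lemma surface_point_approx (L : R) p q r s t r' s' t' (e : R)
  (p1 : forall j, `|p 0 j| <= 1) (q1 : forall j, `|q 0 j| <= 1) : 0 <= r' <= L -> 0 <= s <= 1 -> 0 <= t <= 1 ->
  0 <= s' <= 1 -> 0 <= t' <= 1 -> `|r - r'| <= L * e -> `|s - s'| <= e -> `|t - t'| <= e ->
  near (surface_point p q r' s' t') (27 * (L * e)) (surface_point p q r s t).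
Proof.
move=> /andP[r0 rL] sI tI sI' tI' er es et j; rewrite !mxE.
have h1 := le_trans (ler_norm _) (exponent_le j p1 q1 sI tI).
have h2 := le_trans (ler_norm _) (exponent_le j p1 q1 sI' tI').
have dE := expR_dist h1 h2; move: h1 h2 dE.
set a := s * _ + _; set b := s' * _ + _ => h1 h2 dE.
have -> : r * expR a - r' * expR b = (r - r') * expR a + r' * (expR a - expR b) by ring.
apply: le_trans (ler_normD _ _) _; rewrite !normrM (ger0_norm (expR_ge0 _)) (ger0_norm r0).
have ea : expR a <= 9 by rewrite (le_trans _ expR2_le9)// ler_expR.
have ab : `|a - b| <= 2 * e.
  have -> : a - b = (s - s') * p 0 j + (t - t') * q 0 j by rewrite /a /b; ring.
  apply: le_trans (ler_normD _ _) _; rewrite !normrM.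
  have : `|s - s'| * `|p 0 j| <= e * 1 by apply: ler_pM.
  have : `|t - t'| * `|q 0 j| <= e * 1 by apply: ler_pM.
  by clear; lra.
have k1 : `|r - r'| * expR a <= L * e * 9 by apply: ler_pM; rewrite ?expR_ge0.
have k2 : r' * `|expR a - expR b| <= L * (18 * e).
  apply: ler_pM => //; apply: le_trans dE _.
  by clear -ab; lra.
by clear -k1 k2; lra.
Qed.

Lemma grid_approx n (x : R) : (0 < n)%N -> 0 <= x <= 1 ->
  exists i : 'I_n.+1, `|x - i%:R / n%:R| <= n%:R^-1 /\ 0 <= (i%:R / n%:R : R) <= 1.
Proof.
move=> n0 /andP[x0 x1]; have n0' : 0 < n%:R :> R by rewrite ltr0n.
have xn0 : 0 <= x * n%:R by rewrite mulr_ge0 ?(ltW n0').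
have [h1 h2] := truncnP xn0.
have ln : (Num.truncn (x * n%:R)%R < n.+1)%N.
  by rewrite ltnS -(ler_nat R); apply: le_trans h1 _; rewrite ler_piMl// ltW.
exists (Ordinal ln); rewrite /= divr_ge0 ?ler0n//=; split; last first.
  by rewrite ler_pdivrMr// mul1r ler_nat -ltnS.
rewrite ger0_norm ?subr_ge0 ?ler_pdivrMr// lerBlDr -[X in X + _]mul1r -mulrDl ler_pdivlMr//.
by rewrite addrC ltW.
Qed.

(** Regular grids on five faces of the parameter box [(r, s, t)]. The sixth face [r = 0] collapses
    to the apex, which lies on the four side faces. *)
Definition grid_point (L : R) p q n (i : 'I_5 * ('I_n.+1 * 'I_n.+1)) : 'rV[R]_3 :=
  let a := (i.2.1)%:R / n%:R in let b := (i.2.2)%:R / n%:R in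
  nth 0 [:: surface_point p q L a b; surface_point p q (L * a) 0 b; surface_point p q (L * a) 1 b;
    surface_point p q (L * a) b 0; surface_point p q (L * a) b 1] i.1.

Lemma grid_cover (L : R) p q n r s t (L0 : 0 < L) (p1 : forall j, `|p 0 j| <= 1) (q1 : forall j, `|q 0 j| <= 1) : (0 < n)%N -> 0 <= r <= L -> 0 <= s <= 1 -> 0 <= t <= 1 ->
  on_boundary L r s t -> exists i : 'I_5 * ('I_n.+1 * 'I_n.+1),
    near (grid_point L p q i) (27 * (L * n%:R^-1)) (surface_point p q r s t).
Proof.
move=> n0 rI sI tI bd.
have n0' : 0 <= n%:R^-1 :> R by rewrite invr_ge0 ler0n.
have rI' : 0 <= r / L <= 1.
  by move: rI => /andP[h1 h2]; rewrite divr_ge0 ?(ltW L0)//= ler_pdivrMr// mul1r.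
have [a [ra a01]] := grid_approx n0 rI'; have [b [sb b01]] := grid_approx n0 sI.
have [c [tc c01]] := grid_approx n0 tI.
have raL : `|r - L * (a%:R / n%:R)| <= L * n%:R^-1.
  have -> : r - L * (a%:R / n%:R) = L * (r / L - a%:R / n%:R).
    by rewrite mulrBr [L * (r / L)]mulrC divfK// gt_eqF.
  by rewrite normrM (gtr0_norm L0) ler_pM2l.
have aL : 0 <= L * (a%:R / n%:R) <= L.
  by move: a01 => /andP[h1 h2]; rewrite mulr_ge0 ?(ltW L0)//= ler_piMr// ltW.
have I0 : 0 <= (0 : R) <= 1 by rewrite lexx ler01.
have I1 : 0 <= (1 : R) <= 1 by rewrite lexx ler01.
have LL : 0 <= L <= L by rewrite lexx ltW.
have z (x : R) : `|x - x| <= n%:R^-1 by rewrite subrr normr0.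
have ap r' s' t' := @surface_point_approx L p q r s t r' s' t' n%:R^-1 p1 q1.
have z' : `|L - L| <= L * n%:R^-1 by rewrite subrr normr0 mulr_ge0// ltW.
case/orP: bd => [/eqP e|/orP[/eqP e|/orP[/eqP e|/orP[/eqP e|/eqP e]]]].
- by exists (inord 0, (b, c)); rewrite /grid_point inordK//=; apply: ap => //; rewrite e.
- by exists (inord 1, (a, c)); rewrite /grid_point inordK//=; apply: ap => //; rewrite e.
- by exists (inord 2, (a, c)); rewrite /grid_point inordK//=; apply: ap => //; rewrite e.
- by exists (inord 3, (a, b)); rewrite /grid_point inordK//=; apply: ap => //; rewrite e.
- by exists (inord 4, (a, b)); rewrite /grid_point inordK//=; apply: ap => //; rewrite e.
Qed.

Lemma near_trans (c d v : 'rV[R]_3) (a b : R) : near c a d -> near d b v -> near c (a + b) v.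
Proof.
move=> h1 h2 j; have -> : v 0 j - c 0 j = (d 0 j - c 0 j) + (v 0 j - d 0 j) by ring.
by apply: le_trans (ler_normD _ _) _; apply: lerD.
Qed.

Lemma near_shift (c w v : 'rV[R]_3) (a : R) : near c a (v + w) <-> near (c - w) a v.
Proof. by split=> h j; move: (h j); rewrite !mxE opprB addrA [_ + w 0 j - _]addrAC addrAC. Qed.

(** Such a point lies within [81 * D] of the boundary, and every boundary point within [27 * L / n]
    of one of the [5 * n.+1 ^ 2] grid points. *)
Lemma boundary_count A (L D : R) p q n N w u (L0 : 0 < L) (D0 : 0 < D)
  (p1 : forall j, `|p 0 j| <= 1) (q1 : forall j, `|q 0 j| <= 1) (dF : \det (frame p q) != 0)
  (S := cone_piece (L ^+ 3) (frame p q)) : (0 < n)%N -> (forall j, `|u 0 j| <= D) ->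
  (forall c, atmost N [set m | near c (27 * (L * n%:R^-1) + 81 * D) (lat A m)]) ->
  atmost (5 * n.+1 ^ 2 * N) [set m | S (lat A m + w) /\ ~ S (lat A m + (w + u))].
Proof.
move=> n0 uD hN.
have <- : #|{: 'I_5 * ('I_n.+1 * 'I_n.+1)}| = (5 * n.+1 ^ 2)%N by rewrite !card_prod !card_ord mulnn.
apply: (@atmost_cover _ _ _ (fun i => [set m | near (grid_point L p q i - w) (27 * (L * n%:R^-1) + 81 * D) (lat A m)])) => //.
move=> m [S1]; rewrite addrA => S2; have [r [s [t [rI sI tI bd h]]]] := boundary_near L0 D0 p1 q1 dF uD S1 S2.
have [i hi] := grid_cover L0 p1 q1 n0 rI sI tI bd.
by exists i => //=; apply/near_shift; exact: near_trans hi h.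
Qed.

End boundary.

(** * Counting lattice points in a piece of a cone *)

Section lattice_counting.
Context {R : realType}.
Implicit Types (A : 'M[R]_3) (c v w p q : 'rV[R]_3) (m : 'rV[int]_3).

Lemma det3E (M : 'M[R]_3) : \det M = M 0 0 * (M 1 1 * M 2%:R 2%:R - M 1 2%:R * M 2%:R 1)
  - M 0 1 * (M 1 0 * M 2%:R 2%:R - M 1 2%:R * M 2%:R 0)
  + M 0 2%:R * (M 1 0 * M 2%:R 1 - M 1 1 * M 2%:R 0).
Proof.
(* With entries indexed by natural numbers, the ordinals produced by the cofactor expansions
   compute. *)
have [g H] : exists g : nat -> nat -> R, forall i j : 'I_3, M i j = g i j.
  by exists (fun a b => M (inord a) (inord b)) => i j; rewrite !inord_val.
rewrite (expand_det_row _ ord0) !big_ord_recl big_ord0 /cofactor !(expand_det_row _ ord0).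
rewrite !big_ord_recl !big_ord0 /cofactor !det_mx11 !mxE !H /=.
by rewrite /bump /=; ring.
Qed.

Lemma lat_delta A i : lat A (delta_mx 0 i) = row i A.
Proof. by rewrite /lat map_delta_mx rowE. Qed.

(** The rows of [A] are lattice points. Once the cube contains all of them, a common normal [n]
    satisfies [A *m n = 0]. *)
Lemma exists_nonplanar A : \det A != 0 -> exists k : nat, ~ planar A (2 ^+ k).
Proof.
move=> dA; pose r := \sum_i \sum_j `|A i j|.
have [k kr] : exists k : nat, r <= 2 ^+ k.
  exists (Num.truncn r).+1; apply: (@le_trans _ _ (Num.truncn r).+1%:R).
    by apply: ltW; apply: truncnS_gt.
  by rewrite -natrX ler_nat ltnW// ltn_expl.
exists k => -[n n0 pl]; move/negP: n0; apply; apply/eqP.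
have uA : A \in unitmx by rewrite unitmxE unitfE.
suff h : A *m n = 0 by rewrite -(mulKmx uA n) h mulmx0.
apply/row_matrixP => i; rewrite row_mul -lat_delta pl ?row0//.
apply/near0P => j; rewrite lat_delta mxE; apply: le_trans kr.
rewrite /r (bigD1 i)//= (bigD1 j)//= -addrA lerDl addr_ge0//; apply: sumr_ge0 => // *.
by apply: sumr_ge0.
Qed.

(* The scale [2 ^ k] at which the lattice first has three independent short vectors: below it the points
   lie in a plane and can be counted on a coordinate plane, above it the lattice has a bounded fundamental cell. *)
Lemma exists_scale A : \det A != 0 -> norm_ge1 A ->
  exists k : nat, ~ planar A (2 ^+ k) /\ planar A (2 ^+ k / 2).
Proof.
move=> dA nA; have [k0 hk0] := exists_nonplanar dA.
have ex : exists k, `[< ~ planar A (2 ^+ k) >] by exists k0; exact/asboolP.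
case: (ex_minnP ex) => k /asboolP hk kmin; exists k; split=> //.
case: k hk kmin => [_ _|k _ kmin].
  (* At scale 1 the cube of radius 1/2 contains no nonzero lattice point, since the norm there is at
     most 1/8; any normal will do. *)
  exists (const_mx 1).
    by apply/eqP => /matrixP /(_ 0 0); rewrite !mxE => /eqP; rewrite oner_eq0.
  move=> m /near0P hm; have [->|m0] := eqVneq m 0.
    by rewrite /lat map_mx0 !mul0mx.
  have := nA m m0; rewrite (prod_ord3 _ 0).
  have : `|lat A m 0 0| * `|lat A m 0 (0 + 1)| * `|lat A m 0 (0 + 1 + 1)| <=
      (1 / 2) * (1 / 2) * (1 / 2).
    by rewrite !ler_pM ?mulr_ge0//; rewrite -[X in _ <= X / 2](expr0 2).
  by move=> h1 h2; exfalso; clear -h1 h2; lra.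
rewrite exprS mulrC mulKf//; apply: contrapT => h.
by have := kmin k (asboolT h); rewrite ltnn.
Qed.

(** A nonzero column of the cokernel of the points already found is a linear form vanishing on them.
    Nonplanarity provides a short lattice point on which it does not vanish, and adding that point
    raises the rank. *)
Lemma independent_points A (r : R) k : ~ planar A r -> (k <= 3)%N ->
  exists M : 'M[int]_(k, 3), (forall i j, `|(map_mx intr M *m A) i j| <= r) /\
    \rank (map_mx intr M *m A) = k.
Proof.
move=> np; elim: k => [|k IH] k3.
  by exists 0; split; [case|rewrite flatmx0 mxrank0].
have [M [hM rM]] := IH (ltnW k3); set B := map_mx intr M *m A in hM rM.
have : cokermx B != 0.
  rewrite cokermx_eq0 /row_full rM; apply/eqP => e.
  by move: k3; rewrite e ltnn.
move=> /eqP cB; have [j hj] : exists j, col j (cokermx B) != 0.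
  apply: contrapT => h; apply: cB; apply/matrixP => i j; rewrite mxE.
  have : col j (cokermx B) = 0 by apply/eqP; apply: contrapT => /negP hh; apply: h; exists j.
  by move=> /matrixP /(_ i 0); rewrite !mxE.
have [m [hm nm]] : exists m, near 0 r (lat A m) /\ lat A m *m col j (cokermx B) <> 0.
  apply: contrapT => h; apply: np; exists (col j (cokermx B)) => // m hm.
  by apply: contrapT => h'; apply: h; exists m.
exists (col_mx m M).
have e : map_mx intr (col_mx m M) *m A = col_mx (lat A m) B by rewrite map_col_mx mul_col_mx.
rewrite e; split.
  move=> i l; rewrite mxE; case: splitP => i' _; last exact: hM.
  by move/near0P: hm => /(_ l); rewrite [i']ord1.
have lt : (B < col_mx (lat A m) B)%MS.
  rewrite /ltmx; apply/andP; split; first by rewrite -addsmxE addsmxSr.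
  rewrite col_mx_sub negb_and submxE; apply/orP; left; apply/eqP => z.
  by apply: nm; rewrite colE mulmxA z mul0mx.
apply/eqP; rewrite eqn_leq rank_leq_row/=.
by have := rank_ltmx lt; rewrite rM.
Qed.

(** Dropping the integer parts of the coordinates of [w] on three independent short lattice vectors
    leaves a vector of their parallelepiped, hence at most three times [r] in each coordinate. *)
Lemma reduce_translation A (r : R) w : \det A != 0 -> ~ planar A r ->
  exists m, forall j, `|(w - lat A m) 0 j| <= 3 * r.
Proof.
move=> dA np; have [M [hM rM]] := independent_points np (leqnn 3).
set B := map_mx intr M *m A in hM rM.
have uB : B \in unitmx by rewrite -row_free_unit /row_free rM.
pose c := w *m invmx B.
exists (map_mx Num.floor c *m M) => j.
have -> : w - lat A (map_mx Num.floor c *m M) = (c - map_mx (fun x => (Num.floor x)%:~R) c) *m B.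
  rewrite mulmxBl mulmxKV// /lat map_mxM -map_mx_comp -mulmxA -/B.
  by congr (_ - _ *m _); apply/matrixP => i k; rewrite !mxE.
rewrite mxE; apply: le_trans (ler_norm_sum _ _ _) _.
have -> : 3 * r = \sum_(k < 3) r by rewrite sumr_const card_ord mulr_natl.
apply: ler_sum => k _; rewrite normrM -[r]mul1r; apply: ler_pM => //.
have -> : (c - map_mx (fun x => (Num.floor x)%:~R) c) 0 k = c 0 k - (Num.floor (c 0 k))%:~R by rewrite !mxE.
have /andP[h1 h2] := floor_itv (c 0 k).
rewrite ger0_norm ?subr_ge0//; move: h2; rewrite intrD; clear; lra.
Qed.

Lemma ncard_shift (P : set 'rV[int]_3) (m0 : 'rV[int]_3) : finite_set P ->
  (ncard [set m : 'rV[int]_3 | P (m + m0)%R] <= ncard P)%N.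
Proof.
move=> fP; apply: atmost_ncard; exists [seq m - m0 | m <- fset_set P]; first by rewrite size_map.
move=> m /= Pm; apply/mapP; exists (m + m0); last by rewrite addrK.
by rewrite in_fset_set// mem_set.
Qed.

(** [180 = 5 * 4 * 3 ^ 2]: five faces, [4 * r ^+ 2] points per cube of radius [r / 4], and a mesh
    with [n.+1 * r <= 3 * L]. The radius around a grid point is [27 * r + 81 * (3 * r) = 270 * r],
    that is [30 * 36] times [r / 4]. *)
Definition count_constant : R := 180 * (30 * 36) ^+ 3.

Lemma count_constant_ge0 : 0 <= count_constant.
Proof. by rewrite /count_constant mulr_ge0 ?exprn_ge0. Qed.

Lemma ball_finite A (r : R) (nA : norm_ge1 A) : exists N, forall c, atmost N [set m | near c r (lat A m)].
Proof.
pose k := (Num.truncn (4 * `|r|)).+1.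
exists (k ^ 3 * 1)%N => c.
have k4 : r <= k%:R * (1 / 4).
  have : 4 * `|r| < k%:R by apply: truncnS_gt.
  by have := ler_norm r; lra.
apply: atmost_sub (ball_count_mul (r := 1/4) _ (ltn0Sn _) (fun c => small_count c nA) c).
  by move=> m hm j; exact: le_trans (hm j) k4.
by rewrite divr_gt0.
Qed.

Lemma piece_near A (L : R) p q w m (L0 : 0 < L) (p1 : forall j, `|p 0 j| <= 1) (q1 : forall j, `|q 0 j| <= 1)
  (dF : \det (frame p q) != 0) (S := cone_piece (L ^+ 3) (frame p q)) : S (lat A m + w) -> near (- w) (9 * L) (lat A m).
Proof.
by move=> /(cone_piece_near L0 p1 q1 dF) /near_shift; rewrite sub0r.
Qed.

Lemma count_finite A (L : R) p q w (nA : norm_ge1 A) (L0 : 0 < L)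
  (p1 : forall j, `|p 0 j| <= 1) (q1 : forall j, `|q 0 j| <= 1) (dF : \det (frame p q) != 0)
  (S := cone_piece (L ^+ 3) (frame p q)) : finite_set [set m : 'rV[int]_3 | S (lat A m + w)].
Proof.
have [N hN] := ball_finite (9 * L) nA.
apply: (atmost_finite (N := N)); apply: atmost_sub (hN (- w)) => m; exact: (piece_near L0 p1 q1 dF).
Qed.

(* A translation can be reduced modulo the lattice to one of length [O(r)], which only matters near the boundary
   of the cone; if [L <= r] the whole cone is already covered by few planar pieces. *)
Lemma count_translate A (L : R) p q w1 w2 (dA : \det A != 0) (nA : norm_ge1 A) (L1 : 1 <= L)
  (p1 : forall j, `|p 0 j| <= 1) (q1 : forall j, `|q 0 j| <= 1) (dF : \det (frame p q) != 0)
  (S := cone_piece (L ^+ 3) (frame p q)) : (ncard [set m : 'rV[int]_3 | S (lat A m + w1)])%:R <=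
  (ncard [set m : 'rV[int]_3 | S (lat A m + w2)])%:R + count_constant * L ^+ 2.
Proof.
have L0 : 0 < L := lt_le_trans ltr01 L1.
have [k [np pl]] := exists_scale dA nA; set r := 2 ^+ k in np pl.
have r1 : 1 <= r by rewrite /r exprn_ege1// ler1n.
(* A cube of radius [l / 4] only needs planarity at radius [l / 2 <= r / 2], which is known to
   hold. *)
have ball4 (l : R) c : 1 <= l -> l <= r ->
    atmost ((Num.truncn l).+1 ^ 2) [set m | near c (l / 4) (lat A m)].
  move=> l1 lr; have -> : Num.truncn l = Num.truncn (4 * (l / 4)) by congr Num.truncn; field.
  apply: planar_count => //; first lra.
  have [n n0 h] := pl; exists n => // m hm; apply: h => j; apply: le_trans (hm j) _; lra.
have trunc2 (l : R) : 1 <= l -> ((Num.truncn l).+1 ^ 2)%:R <= 4 * l ^+ 2.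
  move=> l1; rewrite natrX -natr1 (_ : 4 * l ^+ 2 = (2 * l) ^+ 2); last by ring.
  have [h _] := @truncnP R l ltac:(lra).
  have h0 : 0 <= (Num.truncn l)%:R :> R by exact: ler0n.
  have h1 : (Num.truncn l)%:R + 1 <= 2 * l by lra.
  have h2 : 0 <= (Num.truncn l)%:R + 1 :> R by lra.
  by rewrite !expr2; apply: ler_pM.
have L2 : 0 <= L ^+ 2 by exact: sqr_ge0.
have [Lr|rL] := leP L r.
  have L4 : 0 < L / 4 by lra.
  (* The piece lies in a cube of radius [9 * L], which is 36 times [L / 4]. *)
  have h := ball_count_mul (r := L / 4) L4 (isT : (0 < 36)%N) (fun c => ball4 L c L1 Lr) (- w1).
  have hh : (ncard [set m : 'rV[int]_3 | S (lat A m + w1)%R] <= 36 ^ 3 * (Num.truncn L).+1 ^ 2)%N.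
    apply: atmost_ncard; apply: atmost_sub h => m /(piece_near L0 p1 q1 dF) hm j; apply: le_trans (hm j) _; lra.
  have {}hh : (ncard [set m : 'rV[int]_3 | S (lat A m + w1)])%:R <= 36 ^+ 3 * (4 * L ^+ 2) :> R.
    apply: (@le_trans _ _ (36 ^ 3 * (Num.truncn L).+1 ^ 2)%:R); first by rewrite ler_nat.
    by rewrite natrM natrX ler_wpM2l ?exprn_ge0// trunc2.
  apply: le_trans hh _; have h0 : 0 <= (ncard [set m : 'rV[int]_3 | S (lat A m + w2)])%:R :> R by exact: ler0n.
  apply: (@le_trans _ _ (count_constant * L ^+ 2)); last by rewrite lerDr.
  rewrite mulrA ler_wpM2r// /count_constant.
  have : (36 : R) ^+ 3 <= (30 * 36) ^+ 3 by rewrite ler_pXn2r ?nnegrE//; lra.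
  have : 0 <= (36 : R) ^+ 3 by rewrite exprn_ge0.
  lra.
have [m0 hm0] := reduce_translation (w1 - w2) dA np.
pose u := w2 - w1 + lat A m0.
have u3 j : `|u 0 j| <= 3 * r.
  by rewrite -normrN (_ : - u 0 j = (w1 - w2 - lat A m0) 0 j)// !mxE; ring.
(* Fine enough that [L / n <= r], coarse enough that [n.+1 * r <= 3 * L], because [r < L]. *)
pose n := (Num.truncn (L / r)).+1.
have r0 : 0 < r by lra.
have r4 : 0 < r / 4 by lra.
have Lr1 : 1 <= L / r by rewrite ler_pdivlMr// mul1r ltW.
have [n1 n2] := @truncnP R (L / r) ltac:(lra).
have nL : L * n%:R^-1 <= r.
  rewrite ler_pdivrMr ?ltr0n// mulrC -ler_pdivrMr// /n -natr1; lra.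
have [K KE] : exists K : nat, K%:R = 30 * 36 :> R by exists (30 * 36)%N; rewrite natrM.
have K0 : (0 < K)%N by rewrite -(ltr_nat R) KE; lra.
have hN c : atmost (K ^ 3 * (Num.truncn r).+1 ^ 2) [set m | near c (27 * (L * n%:R^-1) + 81 * (3 * r)) (lat A m)].
  apply: atmost_sub (ball_count_mul (r := r / 4) r4 K0 (fun c => ball4 r c r1 (lexx r)) c).
  move=> m hm j; apply: le_trans (hm j) _; rewrite KE.
  by lra.
have r30 : 0 < 3 * r by lra.
have bc := boundary_count (n := n) w1 L0 r30 p1 q1 dF isT u3 hN.
have e2 : [set m : 'rV[int]_3 | S (lat A m + (w1 + u))] = [set m : 'rV[int]_3 | S (lat A (m + m0) + w2)].
  have e m : lat A m + (w1 + u) = lat A (m + m0) + w2.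
    by rewrite latD /u; apply/rowP => j; rewrite !mxE; ring.
  by apply/seteqP; split=> m /=; rewrite e.
have := ncard_le_diff (count_finite w1 nA L0 p1 q1 dF) (count_finite (w1 + u) nA L0 p1 q1 dF) bc.
rewrite e2 => h; have h2 := @ncard_shift [set m : 'rV[int]_3 | S (lat A m + w2)] m0 (count_finite w2 nA L0 p1 q1 dF).
have {}h := leq_trans h (leq_add h2 (leqnn _)).
apply: (@le_trans _ _ (ncard [set m : 'rV[int]_3 | S (lat A m + w2)%R] + 5 * n.+1 ^ 2 * (K ^ 3 * (Num.truncn r).+1 ^ 2))%:R).
  by rewrite ler_nat.
have t2 := trunc2 _ r1; move: t2; set t := ((Num.truncn r).+1 ^ 2)%N => t2.
rewrite natrD lerD2l natrM natrM natrX natrM natrX KE.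
have nr : n.+1%:R * r <= 3 * L.
  have -> : n.+1%:R = (Num.truncn (L / r))%:R + 1 + 1 :> R by rewrite !natr1.
  have -> : 3 * L = 3 * (L / r) * r by field; lra.
  by rewrite ler_pM2r//; lra.
have k0 : 0 <= (30 * 36 : R) ^+ 3 by rewrite exprn_ge0.
apply: (@le_trans _ _ (5 * n.+1%:R ^+ 2 * ((30 * 36) ^+ 3 * (4 * r ^+ 2)))).
  by rewrite ler_wpM2l ?mulr_ge0 ?exprn_ge0// ler_wpM2l.
rewrite /count_constant.
have -> : 5 * n.+1%:R ^+ 2 * ((30 * 36) ^+ 3 * (4 * r ^+ 2)) = 20 * (30 * 36) ^+ 3 * (n.+1%:R * r) ^+ 2 :> R.
  by clear; move: ((30 * 36) ^+ 3) n.+1%:R => z x; ring.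
have -> : 180 * (30 * 36) ^+ 3 * L ^+ 2 = 20 * (30 * 36) ^+ 3 * (3 * L) ^+ 2 :> R.
  by clear; move: ((30 * 36) ^+ 3) => z; ring.
rewrite ler_wpM2l ?mulr_ge0// ler_pXn2r ?nnegrE ?mulr_ge0 ?ler0n ?(ltW r0) ?(ltW L0)//.
Qed.

(* The volume is the average of the translated counts, all of which differ by [O(L ^+ 2)]. *)
Lemma lattice_count A (L : R) p q (dA : \det A != 0) (nA : norm_ge1 A) (L1 : 1 <= L)
  (p1 : forall j, `|p 0 j| <= 1) (q1 : forall j, `|q 0 j| <= 1) (dF : \det (frame p q) != 0)
  (S := cone_piece (L ^+ 3) (frame p q)) : p 0 0 + p 0 1 + p 0 2%:R = 0 -> q 0 0 + q 0 1 + q 0 2%:R = 0 ->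
  `| (ncard [set m : 'rV[int]_3 | S (lat A m)])%:R - L ^+ 3 * `|p 0 0 * q 0 1 - p 0 1 * q 0 0| / `|\det A| |
    <= count_constant * L ^+ 2.
Proof.
move=> sp sq; have L0 : 0 < L := lt_le_trans ltr01 L1.
set E := count_constant * L ^+ 2.
have dA0 : 0 < `|\det A| by rewrite normr_gt0.
(* The piece has radius at most [9 * L], and the sum of the entries bounds the displacement [u *m A]
   for [u] in the unit cube; [s] therefore contains every relevant point. *)
pose r := 9 * L + \sum_i \sum_j `|A i j|.
have [M hM] := ball_finite r nA.
have fT := atmost_finite (hM 0).
pose s : seq 'rV[int]_3 := fset_set [set m | near 0 r (lat A m)].
set N0 := (ncard _)%:R.
have e0 : [set m : 'rV[int]_3 | S (lat A m)] = [set m : 'rV[int]_3 | S (lat A m + 0)].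
  by apply/seteqP; split=> m /=; rewrite addr0.
have uAb u : unit_cube u -> forall j, `|(u *m A) 0 j| <= \sum_i \sum_j `|A i j|.
  move=> [h0 h1 h2] j; rewrite mxE; apply: le_trans (ler_norm_sum _ _ _) _.
  apply: ler_sum => i _; rewrite normrM (bigD1 j)//=.
  have ui : `|u 0 i| <= 1.
    have H (x : R) : `[0, 1[%classic x -> `|x| <= 1.
      by rewrite /= in_itv/= => /andP[a0 a1]; rewrite ger0_norm// ltW.
    by case: i => -[|[|[|//]]] hi; [move: h0|move: h1|move: h2] => /H;
      congr (`|u _ _| <= _); apply/val_inj.
  rewrite -[leLHS]addr0; apply: lerD; last by apply: sumr_ge0.
  by rewrite -[leRHS]mul1r ler_wpM2r.
have sS m u : unit_cube u -> S ((u + map_mx intr m) *m A) -> m \in s.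
  move=> uC; rewrite mulmxDl addrC -/(lat A m) => Sm; rewrite /s in_fset_set//; apply/mem_set => /=.
  apply/near0P => j; have := piece_near L0 p1 q1 dF Sm j.
  rewrite (_ : (- (u *m A)) 0 j = - (u *m A) 0 j) ?opprK => [h|]; last by rewrite [LHS]mxE.
  have -> : lat A m 0 j = (lat A m 0 j + (u *m A) 0 j) - (u *m A) 0 j by ring.
  by apply: le_trans (ler_normB _ _) _; apply: lerD => //; exact: uAb.
have sumE u : unit_cube u -> \sum_(m <- s) \1_S ((u + map_mx intr m) *m A) =
    (ncard [set m : 'rV[int]_3 | S (lat A m + u *m A)])%:R :> R.
  move=> uC.
  have sSu m : [set m : 'rV[int]_3 | S (lat A m + u *m A)] m -> m \in s.
    by move=> Sm; apply: (sS m u uC); rewrite mulmxDl addrC.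
  rewrite -(@ncard_sum_indic _ R s _ (fset_uniq _) sSu).
  apply: eq_bigr => m _; rewrite !indicE; congr (_%:R); congr nat_of_bool.
  have e : (u + map_mx intr m) *m A = lat A m + u *m A by rewrite mulmxDl addrC.
  by apply/idP/idP => /set_mem h; apply/mem_set; move: h; rewrite /= e.
(* Averaging asks for a nonnegative lower bound, and [N0 - E] may be negative. *)
have bnd u : unit_cube u -> Num.max 0 (N0 - E) <=
    \sum_(m <- s) \1_S ((u + map_mx intr m) *m A) <= N0 + E.
  move=> uC; rewrite sumE// ge_max ler0n/= lerBlDr /N0 e0.
  by apply/andP; split; exact: (count_translate _ _ dA nA L1 p1 q1 dF).
have h := int3_averaging (measurable3_cone_piece _ _) dA (fset_uniq _) sS _ bnd.
have /andP[] := h ltac:(by rewrite le_max lexx).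
have L3 : 0 < L ^+ 3 by rewrite exprn_gt0.
rewrite int3_cone_piece//; last first.
  move=> i; rewrite !mxE; case: i => -[|[|[|//]]] hi /=; [exact: sp|exact: sq|].
  by ring.
rewrite !lee_fin.
have dE : `|\det (frame p q)| = 3 * `|p 0 0 * q 0 1 - p 0 1 * q 0 0|.
  rewrite det3E !mxE /=.
  have -> : p 0 2%:R = - p 0 0 - p 0 1 by clear -sp; lra.
  have -> : q 0 2%:R = - q 0 0 - q 0 1 by clear -sq; lra.
  rewrite -[3 in RHS](@ger0_norm _ (3 : R))// -normrM; congr `|_|; ring.
rewrite dE; set W := `|p 0 0 * _ - _|.
have -> : 3 * W * (L ^+ 3 / 3) = L ^+ 3 * W by field.
move=> h1 h2.
have {}h1 : Num.max 0 (N0 - E) <= L ^+ 3 * W / `|\det A| by rewrite ler_pdivlMr// mulrC.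
have {}h2 : L ^+ 3 * W / `|\det A| <= N0 + E by rewrite ler_pdivrMr// [leRHS]mulrC.
move: h1; rewrite ge_max => /andP[_ h1]; clear -h1 h2.
by rewrite ler_norml; apply/andP; split; lra.
Qed.

End lattice_counting.

(** * The simplest cubic field *)

Section simplest_cubic_polynomial.
Implicit Types (a : int).

Lemma horner_simplest_cubic (S : comNzRingType) a (x : S) :
  (map_poly intr (simplest_cubic_poly a)).[x] =
  x ^+ 3 - a%:~R * x ^+ 2 - (a%:~R + 3) * x - 1.
Proof.
rewrite /simplest_cubic_poly !rmorphB /= !map_polyZ /= !map_polyXn map_polyX rmorph1.
by rewrite rmorphD rmorph_nat !hornerE.
Qed.

Lemma polyseq_simplest_cubic a : simplest_cubic_poly a = [:: - 1; - (a + 3); - a; 1] :> seq int.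
Proof.
have -> : simplest_cubic_poly a = Poly [:: - 1; - (a + 3); - a; 1].
  apply/polyP => i; rewrite /simplest_cubic_poly coef_Poly !coefE.
  by case: i => [|[|[|[|i]]]]; rewrite /= ?nth_nil; ring.
by rewrite (@PolyK _ 0).
Qed.

Lemma size_simplest_cubic a : size (simplest_cubic_poly a) = 4%N.
Proof. by rewrite polyseq_simplest_cubic. Qed.

Lemma simplest_cubic_monic a : simplest_cubic_poly a \is monic.
Proof. by rewrite monicE lead_coefE polyseq_simplest_cubic. Qed.

Lemma size_simplest_cubic_rat a : size (map_poly intr (simplest_cubic_poly a) : {poly rat}) = 4%N.
Proof. by rewrite size_map_poly_id0 ?size_simplest_cubic// lead_coefE polyseq_simplest_cubic. Qed.

(** Rational root test: the denominator divides a power of the numerator it is coprime to, so it is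
    1; the numerator then divides 1; and the values at 1 and -1 are [- 2 * a - 3] and 1. *)
Lemma simplest_cubic_no_root a (x : rat) : 7 <= a ->
  ~~ root (map_poly intr (simplest_cubic_poly a)) x.
Proof.
move=> a7; apply/negP; rewrite rootE horner_simplest_cubic => /eqP e.
have cop := coprime_num_den x; have d0 := denq_gt0 x.
have en : numq x ^+ 3 = denq x * (a * numq x ^+ 2 + (a + 3) * numq x * denq x + denq x ^+ 2).
  apply/eqP; rewrite -(eqr_int rat); apply/eqP.
  move: e; rewrite -{1 2 3}(divq_num_den x).
  have : (denq x)%:~R != 0 :> rat by rewrite intr_eq0 gt_eqF.
  rewrite !(rmorphM, rmorphD, rmorphXn)/=; set n : rat := (numq x)%:~R; set d : rat := (denq x)%:~R.
  move=> dn0 e; have : d ^+ 3 * ((n / d) ^+ 3 - a%:~R * (n / d) ^+ 2 - (a%:~R + 3) * (n / d) - 1) = 0.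
    by rewrite e mulr0.
  have -> : d ^+ 3 * ((n / d) ^+ 3 - a%:~R * (n / d) ^+ 2 - (a%:~R + 3) * (n / d) - 1) =
     n ^+ 3 - a%:~R * n ^+ 2 * d - (a%:~R + 3) * n * d ^+ 2 - d ^+ 3 by field.
  by move=> e'; apply/eqP; rewrite -subr_eq0 -e'; apply/eqP; ring.
have d1 : `|denq x|%N = 1%N.
  have : (`|denq x| %| `|numq x| ^ 3)%N.
    by rewrite -abszX en abszM dvdn_mulr.
  move/gcdn_idPl; have : coprime `|denq x| (`|numq x| ^ 3) by rewrite coprimeXr// coprime_sym.
  by rewrite /coprime => /eqP ->.
have {}d1 : denq x = 1 by move: d0 d1; lia.
move: en; rewrite d1 => en.
have : numq x * (numq x ^+ 2 - a * numq x - (a + 3)) = 1.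
  by transitivity (numq x ^+ 3 - (a * numq x ^+ 2 + (a + 3) * numq x)); [ring|rewrite en; ring].
move=> h; have : (`|numq x| * `|(numq x ^+ 2 - a * numq x - (a + 3))%R| == 1)%N by rewrite -abszM h.
rewrite muln_eq1 => /andP[/eqP n1 _].
have [nx|nx] : numq x = 1 \/ numq x = -1 by move: n1; lia.
  by move: h; rewrite nx !mul1r expr1n mulr1 => h; lia.
by move: h; rewrite nx mulN1r mulrN1 sqrrN expr1n => h; lia.
Qed.

Lemma simplest_cubic_irreducible a : 7 <= a ->
  irreducible_poly (map_poly intr (simplest_cubic_poly a) : {poly rat}).
Proof.
move=> a7; apply: cubic_irreducible; first by rewrite size_simplest_cubic_rat.
by move=> x; exact: simplest_cubic_no_root.
Qed.

(** The roots are permuted by the map [x |-> - 1 / (1 + x)], of order 3. The equation gives [a] as a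
    rational function of [r], after which the factorization is an identity in [r] and [x]. *)
Lemma factor_simplest_cubic (F : fieldType) a (r x : F) : r != 0 -> 1 + r != 0 ->
  r ^+ 3 - a%:~R * r ^+ 2 - (a%:~R + 3) * r - 1 = 0 ->
  x ^+ 3 - a%:~R * x ^+ 2 - (a%:~R + 3) * x - 1 =
  (x - r) * (x - - (1 + r)^-1) * (x - - (1 + r) / r).
Proof.
move=> r0 r1 h.
have -> : a%:~R = (r ^+ 3 - 3 * r - 1) / (r * (1 + r)) :> F.
  apply: (mulIf (mulf_neq0 r0 r1)); rewrite divfK ?mulf_neq0//.
  apply/eqP; rewrite -subr_eq0 -[X in X == _]opprK oppr_eq0; apply/eqP; rewrite -[RHS]h; ring.
by field; rewrite r0 r1.
Qed.

End simplest_cubic_polynomial.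

(** * Evaluation of rational polynomials at an element of the field *)

Section evaluation.
Variable K : fieldExtType rat.
Implicit Types (x : K) (q : {poly rat}).

Definition ev x q : K := (map_poly (in_alg K) q).[x].

Lemma evD x q q' : ev x (q + q') = ev x q + ev x q'.
Proof. by rewrite /ev rmorphD hornerD. Qed.

Lemma evB x q q' : ev x (q - q') = ev x q - ev x q'.
Proof. by rewrite /ev rmorphB hornerD hornerN. Qed.

Lemma evM x q q' : ev x (q * q') = ev x q * ev x q'.
Proof. by rewrite /ev rmorphM hornerM. Qed.

Lemma ev1 x : ev x 1 = 1.
Proof. by rewrite /ev rmorph1 hornerC. Qed.

Lemma evX x : ev x 'X = x.
Proof. by rewrite /ev map_polyX hornerX. Qed.

Lemma ev_intr x (p : {poly int}) : ev x (map_poly intr p) = (map_poly intr p).[x].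
Proof. by rewrite /ev -map_poly_comp; congr (_.[x]); apply: eq_map_poly => c /=; rewrite scaler_int. Qed.

(** If [f] does not divide [q] the two are coprime, and evaluating a Bezout relation at a common
    zero gives [0 = 1]. *)
Lemma ev_irreducible x q f : irreducible_poly f -> ev x f = 0 -> (ev x q == 0) = (f %| q).
Proof.
move=> irr f0; apply/eqP/idP => [q0|/dvdpP[c ->]]; last by rewrite evM f0 mulr0.
apply/negPn; rewrite -irreducible_poly_coprime//.
apply/Bezout_eq1_coprimepP => -[[u v]] /= /(congr1 (ev x)).
by rewrite evD !evM f0 q0 !mulr0 addr0 ev1 => /esym/eqP; rewrite oner_eq0.
Qed.

End evaluation.

Section cubic_field.
Context (R : realType) (a : int) (K : fieldExtType rat) (iota : {rmorphism K -> R}) (rho : K).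
Hypotheses (a7 : 7 <= a) (hK : is_simplest_cubic_field a iota rho).

Local Notation f := (map_poly intr (simplest_cubic_poly a) : {poly rat}).

Lemma iota_root : iota rho ^+ 3 - a%:~R * iota rho ^+ 2 - (a%:~R + 3) * iota rho - 1 = 0.
Proof. by have [_ [/eqP]] := hK; rewrite horner_simplest_cubic. Qed.

Lemma rho_root : rho ^+ 3 - a%:~R * rho ^+ 2 - (a%:~R + 3) * rho - 1 = 0.
Proof.
apply: (fmorph_inj iota); rewrite rmorph0 -[RHS]iota_root.
by rewrite !(rmorphB, rmorphM, rmorphD, rmorphXn, rmorph1, rmorph_int, rmorph_nat).
Qed.

Lemma ev_f (x : K) : ev x f = x ^+ 3 - a%:~R * x ^+ 2 - (a%:~R + 3) * x - 1.
Proof. by rewrite ev_intr horner_simplest_cubic. Qed.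

Lemma rho_eq0 q : (ev rho q == 0) = (f %| q).
Proof. by apply: ev_irreducible; [exact: simplest_cubic_irreducible|rewrite ev_f rho_root]. Qed.

Lemma rho_neq0 : rho != 0.
Proof.
by apply/eqP => r0; have := rho_root; rewrite r0 !expr0n /= !mulr0 !subr0 sub0r => /eqP; rewrite oppr_eq0 oner_eq0.
Qed.

Lemma rho1_neq0 : 1 + rho != 0.
Proof.
rewrite addrC addr_eq0; apply/eqP => r0; have := rho_root; rewrite r0.
have -> : (-1) ^+ 3 - a%:~R * (-1) ^+ 2 - (a%:~R + 3) * -1 - 1 = 1 :> K by ring.
by move/eqP; rewrite oner_eq0.
Qed.

Definition rho' : K := - (1 + rho)^-1.
Definition rho'' : K := - (1 + rho) / rho.

Lemma factor_f (x : K) : x ^+ 3 - a%:~R * x ^+ 2 - (a%:~R + 3) * x - 1 =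
  (x - rho) * (x - rho') * (x - rho'').
Proof. by apply: factor_simplest_cubic; [exact: rho_neq0|exact: rho1_neq0|exact: rho_root]. Qed.

(** The other two roots of the cubic are rational functions of [rho]. *)
Lemma fieldE : {:K}%VS = <<1; rho>>%VS.
Proof.
have [[rs frs <-] _] := hK; apply/eqP; rewrite eqEsubv; apply/andP; split; last first.
  apply/FadjoinP; split; first exact: subv_adjoin_seq.
  have : root (map_poly intr (simplest_cubic_poly a)) rho by rewrite rootE horner_simplest_cubic rho_root.
  rewrite (eqp_root frs) root_prod_XsubC => /seqv_sub_adjoin; exact.
apply/Fadjoin_seqP; split; first exact: subv_adjoin.
move=> z zrs; have : root (map_poly intr (simplest_cubic_poly a)) z by rewrite (eqp_root frs) root_prod_XsubC.
rewrite rootE horner_simplest_cubic factor_f !mulf_eq0 !subr_eq0.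
have rE : rho \in <<1; rho>>%VS := memv_adjoin _ _.
have r1E : 1 + rho \in <<1; rho>>%VS by rewrite rpredD ?mem1v.
by move=> /orP[/orP[]|] /eqP ->; rewrite ?rpredN ?rpredV// rpredM ?rpredV ?rpredN.
Qed.

Lemma ev_surj (u : K) : exists q, u = ev rho q.
Proof.
have : u \in <<1; rho>>%VS by rewrite -fieldE memvf.
by move=> /Fadjoin_polyP[p /polyOver1P[q ->] ->]; exists q.
Qed.

(* The automorphism is given by evaluation at a conjugate of rho of any polynomial representing an element. *)
Lemma exists_automorphism : exists tau : {rmorphism K -> K}, tau rho = rho'.
Proof.
have [q qP] := choice ev_surj.
pose t u := ev rho' (q u).
(* The choice of a representing polynomial does not matter: two of them differ by a multiple of the
   cubic, which vanishes at [rho'] too. *)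
have tE p : t (ev rho p) = ev rho' p.
  apply/eqP; rewrite /t -subr_eq0 -evB.
  have /dvdpP[c ->] : f %| q (ev rho p) - p by rewrite -rho_eq0 evB -qP subrr.
  by rewrite evM ev_f factor_f subrr mulr0 mul0r mulr0.
have tB : {morph t : u v / u - v} by move=> u v; rewrite (qP u) (qP v) -evB !tE evB.
have tM : {morph t : u v / u * v} by move=> u v; rewrite (qP u) (qP v) -evM !tE evM.
have t1 : t 1 = 1 by have := tE 1; rewrite !ev1.
pose m1 := GRing.isZmodMorphism.Build K K t tB.
pose m2 := GRing.isMonoidMorphism.Build K K t (t1, tM).
pose tau : {rmorphism K -> K} := HB.pack t m1 m2.
by exists tau; rewrite /= -[X in t X](evX rho) tE evX.
Qed.

End cubic_field.

(** * The ring of integers *)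

Lemma ord3P (i : 'I_3) : [\/ i = 0, i = 1 | i = 2%:R].
Proof.
case: i => -[|[|[|//]]] hi; [apply: Or31|apply: Or32|apply: Or33]; exact/val_inj.
Qed.

Lemma horner3 (A S : comNzRingType) (g : {rmorphism A -> S}) (p : {poly A}) x : (size p <= 3)%N ->
  (map_poly g p).[x] = g p`_0 + g p`_1 * x + g p`_2 * x ^+ 2.
Proof.
move=> sp; rewrite (@horner_coef_wide _ 3) ?(leq_trans (size_poly _ _))//.
by rewrite !big_ord_recl big_ord0 !coef_map /= addr0 addrA mulr1.
Qed.

Lemma mx3_mulE (F : pzRingType) (n p : nat) (A : 'M[F]_(n, 3)) (B : 'M[F]_(3, p)) i j :
  (A *m B) i j = A i 0 * B 0 j + A i 1 * B 1 j + A i 2%:R * B 2%:R j.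
Proof.
rewrite mxE !big_ord_recl big_ord0 addr0 addrA.
by congr (_ + A i _ * B _ j + A i _ * B _ j); apply/val_inj.
Qed.

Lemma fmorph_alg (K : fieldExtType rat) (F : numFieldType) (g : {rmorphism K -> F}) (c : rat) : g c%:A = ratr c.
Proof. by rewrite -[LHS]/((g \o in_alg K) c) fmorph_eq_rat. Qed.

(* Matrix of multiplication by [rho] on the basis [1, rho, rho^2]. *)
Definition companion (F : pzRingType) (a : int) : 'M[F]_3 :=
  \matrix_(i, j) (if i == 2%:R then nth 0 [:: 1; a%:~R + 3; a%:~R] j else (j == i + 1)%:R).

(** Multiplication by the element with coordinates [m], acting on row vectors of coordinates. Its
    determinant gives both the norm of that element and the index of the ideal it generates. *)
Definition mul_matrix (F : pzRingType) (a : int) (m : 'rV[F]_3) : 'M[F]_3 :=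
  m 0 0 *: 1%:M + m 0 1 *: companion F a + m 0 2%:R *: (companion F a *m companion F a).

Lemma map_companion (F F' : pzRingType) (g : {rmorphism F -> F'}) a :
  map_mx g (companion F a) = companion F' a.
Proof.
apply/matrixP => i j; rewrite !mxE; case: ifP => _; last by rewrite rmorph_nat.
have [->|->|->] := ord3P j; rewrite /=; [exact: rmorph1| |exact: rmorph_int].
by rewrite rmorphD rmorph_int rmorph_nat.
Qed.

Lemma map_mul_matrix (F F' : pzRingType) (g : {rmorphism F -> F'}) a (m : 'rV[F]_3) :
  map_mx g (mul_matrix a m) = mul_matrix a (map_mx g m).
Proof.
rewrite /mul_matrix !map_mxD !map_mxZ map_mxM !map_companion map_mx1.
by rewrite !mxE.
Qed.

Section integers.
Context (R : realType) (a : int) (K : fieldExtType rat) (iota : {rmorphism K -> R}) (rho : K).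
Context (tau : {rmorphism K -> K}).
Hypotheses (a7 : 7 <= a) (hK : is_simplest_cubic_field a iota rho) (hM : is_monogenic rho).
Hypothesis htau : tau rho = rho' rho.

Let rho0 : rho != 0 := rho_neq0 hK.
Let rho10 : 1 + rho != 0 := rho1_neq0 hK.

Lemma tau_rho' : tau (rho' rho) = rho'' rho.
Proof.
rewrite /rho' rmorphN fmorphV rmorphD rmorph1 htau /rho' /rho''; field.
by apply/andP.
Qed.

Lemma tau_rho'' : tau (rho'' rho) = rho.
Proof.
rewrite /rho'' rmorphM rmorphN fmorphV rmorphD rmorph1 htau /rho'; field.
by rewrite rho10 oppr_eq0 oner_eq0.
Qed.

Lemma tau_ev (x : K) q : tau (ev x q) = ev (tau x) q.
Proof.
rewrite /ev -horner_map -map_poly_comp; congr (_.[_]); apply: eq_map_poly => c /=.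
have -> : c%:A = (numq c)%:~R / (denq c)%:~R :> K.
  by rewrite -[LHS]/(in_alg K c) -{1}(divq_num_den c) fmorph_div !rmorph_int.
by rewrite fmorph_div !rmorph_int.
Qed.

Lemma tau3 u : tau (tau (tau u)) = u.
Proof.
have [q ->] := ev_surj hK u; rewrite !tau_ev.
by rewrite htau tau_rho' tau_rho''.
Qed.

(** Indexing the real embeddings by powers of [tau] turns [tau] into the shift [j |-> j + 1] modulo
    3. *)
Definition sg (j : 'I_3) : {rmorphism K -> R} :=
  match val j with
  | 0%N => iota
  | 1%N => (iota \o tau : {rmorphism K -> R})
  | _ => (iota \o (tau \o tau) : {rmorphism K -> R})
  end.

Lemma sg_tau j u : sg j (tau u) = sg (j + 1) u.
Proof. by case: j => -[|[|[|//]]] hj //=; rewrite /sg /= tau3. Qed.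

Definition elt (m : 'rV[int]_3) : K := (m 0 0)%:~R + (m 0 1)%:~R * rho + (m 0 2%:R)%:~R * rho ^+ 2.
Definition eltq (m : 'rV[rat]_3) : K := (m 0 0)%:A + (m 0 1)%:A * rho + (m 0 2%:R)%:A * rho ^+ 2.

Lemma elt_eltq m : elt m = eltq (map_mx intr m).
Proof. by rewrite /elt /eltq !mxE !scaler_int. Qed.

Lemma eltB m m' : elt (m - m') = elt m - elt m'.
Proof. by rewrite /elt !mxE !rmorphB /=; ring. Qed.

Lemma eltD m m' : elt (m + m') = elt m + elt m'.
Proof. by rewrite /elt !mxE !rmorphD /=; ring. Qed.

Lemma elt0 : elt 0 = 0.
Proof. by rewrite /elt !mxE !mul0r !addr0. Qed.

Lemma eltq_ev m : eltq m = ev rho (Poly [:: m 0 0; m 0 1; m 0 2%:R]).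
Proof.
by rewrite /ev horner3 ?size_Poly// !coef_Poly.
Qed.

Lemma eltq_eq0 m : (eltq m == 0) = (m == 0).
Proof.
apply/idP/eqP => [|->]; last by rewrite /eltq !mxE scale0r !mul0r !addr0.
rewrite eltq_ev (rho_eq0 a7 hK) => /dvdp_leq; rewrite size_simplest_cubic_rat.
set p := Poly _ => h; have p0 : p = 0.
  apply/eqP/negPn/negP => /h; rewrite leqNgt => /negP; apply.
  exact: leq_ltn_trans (size_Poly _) _.
apply: rV3P; rewrite [RHS]mxE.
- by have := congr1 (fun q : {poly rat} => q`_0) p0; rewrite coef_Poly coef0.
- by have := congr1 (fun q : {poly rat} => q`_1) p0; rewrite coef_Poly coef0.
- by have := congr1 (fun q : {poly rat} => q`_2) p0; rewrite coef_Poly coef0.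
Qed.

Lemma elt_eq0 m : (elt m == 0) = (m == 0).
Proof.
rewrite elt_eltq eltq_eq0; apply/eqP/eqP => [h|->]; last by rewrite map_mx0.
apply/matrixP => i j; move/matrixP: h => /(_ i j); rewrite !mxE => /eqP.
by rewrite intr_eq0 => /eqP.
Qed.

Lemma elt_inj : injective elt.
Proof. by move=> m m' /eqP; rewrite -subr_eq0 -eltB elt_eq0 subr_eq0 => /eqP. Qed.

Lemma eltq_surj u : exists m, u = eltq m.
Proof.
have [q ->] := ev_surj hK u.
pose f : {poly rat} := map_poly intr (simplest_cubic_poly a).
have f0 : f != 0 by rewrite -size_poly_eq0 size_simplest_cubic_rat.
pose r := q %% f.
have sr : (size r < 4)%N by rewrite -(size_simplest_cubic_rat a) ltn_modp.
exists (\row_j r`_j); rewrite [in LHS](divp_eq q f) evD evM ev_f (rho_root hK) mulr0 add0r.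
by rewrite /ev horner3// /eltq !mxE.
Qed.

Lemma OK_elt u : ring_of_integers K u <-> exists m, u = elt m.
Proof.
rewrite hM; split=> [[p _ <-]|[m ->]].
  pose f := simplest_cubic_poly a; have fm := simplest_cubic_monic a.
    pose r := Pdiv.Ring.rmodp p f.
  have sr : (size r < 4)%N by rewrite -(size_simplest_cubic a) Pdiv.Ring.ltn_rmodpN0// monic_neq0.
  exists (\row_j r`_j).
  rewrite (Pdiv.RingMonic.rdivp_eq fm p) -/r rmorphD rmorphM hornerD hornerM horner_simplest_cubic.
  by rewrite (rho_root hK) mulr0 add0r horner3// /elt !mxE.
exists (Poly [:: m 0 0; m 0 1; m 0 2%:R]) => //.
by rewrite horner3 ?size_Poly// !coef_Poly.
Qed.

Lemma elt_companion m : elt (m *m companion int a) = elt m * rho.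
Proof.
rewrite /elt !mx3_mulE !mxE /= !(mulr0, mulr1, addr0, add0r).
have h3 : (3 : int)%:~R = 3 :> K by rewrite rmorph_nat.
rewrite intz; move: (3 : int) h3 => z h3; rewrite !(intrM, intrD) h3.
apply/eqP; rewrite -subr_eq0; apply/eqP.
transitivity (- (m 0 2%:R)%:~R * (rho ^+ 3 - a%:~R * rho ^+ 2 - (a%:~R + 3) * rho - 1)); first ring.
by rewrite (rho_root hK) mulr0.
Qed.

Lemma eltZ (c : int) m : elt (c *: m) = c%:~R * elt m.
Proof. by rewrite /elt !mxE !rmorphM /=; ring. Qed.

Lemma elt_mul m m' : elt (m *m mul_matrix a m') = elt m * elt m'.
Proof.
rewrite /mul_matrix !mulmxDr -!scalemxAr mulmx1 mulmxA !eltD !eltZ !elt_companion /elt; ring.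
Qed.

(** The Vandermonde matrix of the conjugates of [rho]; its lattice is the image of the ring of
    integers under the three embeddings. *)
Definition vdm : 'M[R]_3 := \matrix_(i, j) sg j rho ^+ i.

Lemma sg_elt j m : sg j (elt m) = lat vdm m 0 j.
Proof.
rewrite /lat mx3_mulE !mxE /elt 2!rmorphD (rmorphM _ _ rho) (rmorphM _ _ (rho ^+ 2)) rmorphXn !rmorph_int.
by rewrite expr0 mulr1 expr1.
Qed.

Lemma sg0 : sg 0 rho = iota rho. Proof. by []. Qed.

Lemma sg1 : sg 1 rho = - (1 + iota rho)^-1.
Proof. by rewrite /sg /= htau /rho' rmorphN fmorphV rmorphD rmorph1. Qed.

Lemma sg2 : sg 2%:R rho = - (1 + iota rho) / iota rho.
Proof. by rewrite /sg /= htau tau_rho' /rho'' fmorph_div rmorphN rmorphD rmorph1. Qed.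

Lemma sg_root j : sg j rho ^+ 3 - a%:~R * sg j rho ^+ 2 - (a%:~R + 3) * sg j rho - 1 = 0.
Proof.
have := congr1 (sg j) (rho_root hK); rewrite rmorph0 => <-.
by rewrite !(rmorphB, rmorphM, rmorphXn, rmorph1) /= rmorphD !rmorph_int rmorph_nat.
Qed.

(** The cubic is [- (2 * a + 3)] at [a + 1] and positive at [a + 2], so it has a root between them,
    and [rho] is sent to the largest root. *)
Lemma iota_rho_gt : a%:~R + 1 < iota rho.
Proof.
have a0 : 7 <= a%:~R :> R by rewrite (_ : 7 = 7%:~R :> R) ?ler_int// rmorph_nat.
have [_ [_ hmax]] := hK.
pose g (x : R) : R := (map_poly intr (simplest_cubic_poly a)).[x].
have gE x : g x = x ^+ 3 - a%:~R * x ^+ 2 - (a%:~R + 3) * x - 1 by exact: horner_simplest_cubic.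
have [x] : exists2 x, x \in `[(a%:~R + 1 : R), a%:~R + 2] & g x = 0.
  apply: IVT; first by lra.
    by apply: continuous_subspaceT => x; exact: continuous_horner.
  have -> : g (a%:~R + 1) = - (2 * a%:~R + 3) by rewrite gE; ring.
  have -> : g (a%:~R + 2) = a%:~R ^+ 2 + 3 * a%:~R + 1 by rewrite gE; ring.
  have h : 0 <= a%:~R ^+ 2 :> R by exact: sqr_ge0.
  rewrite ge_min le_max; apply/andP; split; apply/orP; [left|right]; lra.
rewrite in_itv/= => /andP[h1 _] gx; apply: (@lt_le_trans _ _ x); last by apply: hmax; apply/eqP.
rewrite lt_neqAle h1 andbT; apply/eqP => e.
have : g x = - (2 * a%:~R + 3) by rewrite -e gE; ring.
by rewrite gx; lra.
Qed.

Lemma iota_rho_lt : iota rho < a%:~R + 2.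
Proof.
have a0 : 7 <= a%:~R :> R by rewrite (_ : 7 = 7%:~R :> R) ?ler_int// rmorph_nat.
rewrite ltNge; apply/negP => h; have := iota_root hK.
set r := iota rho in h *; pose d := r - (a%:~R + 2).
have d0 : 0 <= d by rewrite subr_ge0.
have -> : r ^+ 3 - a%:~R * r ^+ 2 - (a%:~R + 3) * r - 1 =
  d * (r * (r + 2) + a%:~R + 1) + ((a%:~R + 1) * (a%:~R + 2) - 1) by rewrite /d; ring.
have r0 : 0 <= r by lra.
have h1 : 0 <= d * (r * (r + 2) + a%:~R + 1).
  rewrite mulr_ge0// -addrA addr_ge0//; first by rewrite mulr_ge0 ?addr_ge0.
  by lra.
have h2 : 0 <= a%:~R * a%:~R :> R by rewrite mulr_ge0//; lra.
have -> : (a%:~R + 1) * (a%:~R + 2) - 1 = a%:~R * a%:~R + 3 * a%:~R + 1 :> R by ring.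
by lra.
Qed.

(** Expressing [a] and the other conjugates through [r = iota rho] turns both sides into [(r ^+ 2 +
    r + 1) ^+ 3 / (r * (1 + r)) ^+ 2]. *)
Lemma det_vdm : `|\det vdm| = a%:~R ^+ 2 + 3 * a%:~R + 9.
Proof.
have a0 : 7 <= a%:~R :> R by rewrite (_ : 7 = 7%:~R :> R) ?ler_int// rmorph_nat.
have h := iota_rho_gt; rewrite det3E ![vdm _ _]mxE sg0 sg1 sg2 !(expr0, expr1).
have e := iota_root hK; move: h e; set r := iota rho => h e.
have r0 : r != 0 by apply/eqP; lra.
have r1 : 1 + r != 0 by apply/eqP; lra.
have ea : a%:~R = (r ^+ 3 - 3 * r - 1) / (r * (1 + r)) :> R.
  apply: (mulIf (mulf_neq0 r0 r1)); rewrite divfK ?mulf_neq0//.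
  by apply/eqP; rewrite -subr_eq0 -[X in X == _]opprK oppr_eq0; apply/eqP; rewrite -[RHS]e; ring.
have dE : a%:~R ^+ 2 + 3 * a%:~R + 9 = (r ^+ 2 + r + 1) ^+ 3 / (r * (1 + r)) ^+ 2.
  by rewrite ea; field; rewrite r0 r1.
have rp : 0 < r by lra.
rewrite dE; set X := (X in `|X|).
have -> : X = - ((r ^+ 2 + r + 1) ^+ 3 / (r * (1 + r)) ^+ 2) by rewrite /X; field; rewrite r0 r1.
by rewrite normrN ger0_norm// divr_ge0 ?exprn_ge0 ?mulr_ge0 ?addr_ge0 ?exprn_ge0 ?ltW// ltr_wpDl.
Qed.

Lemma det_vdm_neq0 : \det vdm != 0.
Proof.
rewrite -normr_eq0 det_vdm gt_eqF//.
have a0 : 7 <= a%:~R :> R by rewrite (_ : 7 = 7%:~R :> R) ?ler_int// rmorph_nat.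
have h : 0 <= a%:~R ^+ 2 :> R by exact: sqr_ge0.
by lra.
Qed.

(** The columns of [vdm] are common eigenvectors of all multiplication matrices, because each
    conjugate of [rho] is a root of the cubic. *)
Lemma vdm_diag (u : K) m : u = elt m ->
  mul_matrix a (map_mx intr m) *m vdm = vdm *m diag_mx (\row_j sg j u).
Proof.
move=> ->; pose D := diag_mx (\row_j sg j rho).
have CV : companion R a *m vdm = vdm *m D.
  apply/matrixP => i j; rewrite mx3_mulE mul_mx_diag !mxE.
  have [->|->|->] := ord3P i; rewrite /= ?(mul0r, mul1r, add0r, addr0, expr0, expr1) //.
  by apply/eqP; rewrite -subr_eq0 -oppr_eq0; apply/eqP; rewrite -[RHS](sg_root j); ring.
have CCV : companion R a *m companion R a *m vdm = vdm *m (D *m D).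
  by rewrite -[LHS]mulmxA CV [LHS]mulmxA CV [RHS]mulmxA.
rewrite /mul_matrix !mulmxDl -!scalemxAl mul1mx CV CCV.
rewrite -[X in _ *: X + _](mulmx1 vdm) !scalemxAr -!mulmxDr; congr (_ *m _).
apply/matrixP => i j; rewrite /D mul_diag_mx !mxE sg_elt /lat mx3_mulE !mxE.
by case: eqP => [->|_]; rewrite ?(mulr1n, mulr0n, mulr0, addr0)// expr0 expr1; ring.
Qed.

Lemma det_mul_matrix m : (\det (mul_matrix a m))%:~R = \prod_(j < 3) sg j (elt m).
Proof.
have := congr1 determinant (vdm_diag (erefl (elt m))).
rewrite -map_mul_matrix !det_mulmx det_map_mx det_diag mulrC.
by move/(mulfI det_vdm_neq0) => ->; apply: eq_bigr => j _; rewrite mxE.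
Qed.

Lemma sg_eq0 j u : (sg j u == 0) = (u == 0). Proof. exact: fmorph_eq0. Qed.

(** The norm is the determinant of an integer matrix, and it is not zero. *)
Lemma norm_elt_ge1 m : m != 0 -> 1 <= `|\prod_(j < 3) sg j (elt m)|.
Proof.
move=> m0; rewrite -det_mul_matrix -intr_norm ler1z -gtz0_ge1 normr_gt0.
rewrite -(intr_eq0 R) det_mul_matrix; apply/prodf_neq0 => j _.
by rewrite sg_eq0 elt_eq0.
Qed.

Lemma norm_ge1_vdm : norm_ge1 vdm.
Proof.
move=> m m0; have := norm_elt_ge1 m0; rewrite normr_prod.
by under eq_bigr do rewrite sg_elt.
Qed.

End integers.

(** * Ideal norm, discriminant and embeddings *)

(** [F] stands for the map to the quotient by the row lattice of [M]. In Smith form the quotient is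
    a product of three cyclic groups, and the boxes of residues modulo the [d_i] represent each
    coset once. *)
Lemma ncard_cosets (T : choiceType) (M : 'M[int]_3) (F : 'rV[int]_3 -> T) : \det M != 0 ->
  (forall m m', F m = F m' <-> exists k, m - m' = k *m M) ->
  ncard (range F) = `|\det M|%N.
Proof.
move=> dM FP; have [L uL [U uU [d _ ME]]] := int_Smith_normal_form M.
set D := (X in L *m X) in ME; have abs_unit (N : 'M[int]_3) : N \in unitmx -> `|\det N|%N = 1%N.
  by rewrite unitmxE; move=> /mulrV/(congr1 absz)/eqP; rewrite abszM muln_eq1 => /andP[/eqP].
have DE (x : 'rV[int]_3) i : (x *m D) 0 i = x 0 i * d`_i.
  rewrite mxE (bigD1 i)//= big1 ?addr0 => [|j ji]; first by rewrite mxE eqxx mulr1n.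
  by rewrite mxE (_ : (j == i :> nat) = false) ?mulr0n ?mulr0//; apply/negP => /eqP/val_inj/eqP; rewrite (negPf ji).
have detE : `|\det M|%N = (`|(d`_0)%R| * `|(d`_1)%R| * `|(d`_2)%R|)%N.
  rewrite ME !det_mulmx !abszM (abs_unit L)// (abs_unit U)// mul1n muln1.
  rewrite det_trig ?big_ord_recl ?big_ord0 ?mulr1 ?mxE ?mulr1n ?abszM ?mulnA//.
  by apply/is_trig_mxP => i j ij; rewrite mxE ltn_eqF.
have d0 (i : 'I_3) : d`_i != 0.
  move: dM; rewrite -absz_eq0 detE !muln_eq0 !absz_eq0 !negb_or => /andP[/andP[? ?] ?].
  by have [->|->|->] := ord3P i.
pose I := ('I_`|(d`_0)%R|%N * 'I_`|(d`_1)%R|%N * 'I_`|(d`_2)%R|%N)%type.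
pose r (i : I) : 'rV[int]_3 := \row_j [tuple i.1.1%:Z; i.1.2%:Z; i.2%:Z]`_j.
have rP i (j : 'I_3) : 0 <= r i 0 j < `|d`_j|.
  by rewrite mxE; have [->|->|->] := ord3P j; rewrite /= -abszE ltz_nat.
have FDP m m' : F (m *m U) = F (m' *m U) <-> exists k, m - m' = k *m D.
  split=> [/FP[k]|[k e]].
    rewrite -mulmxBl ME !mulmxA => e; exists (k *m L).
    by rewrite -[LHS](mulmxK uU) e mulmxK.
  apply/FP; exists (k *m invmx L).
  by rewrite -mulmxBl e ME -!mulmxA mulKmx.
rewrite (@ncard_seq _ [seq F (r i *m U) | i <- enum {: I}]).
- by rewrite size_map -cardE !card_prod !card_ord detE.
- rewrite map_inj_uniq ?enum_uniq// => i i' /FDP[k e].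
  have {e}rr j : r i 0 j = r i' 0 j.
    have := congr1 (fun A : 'rV[int]_3 => A 0 j) e; rewrite DE !mxE.
    move: (rP i j) (rP i' j) (d0 j); rewrite !mxE.
    move: ([tuple _; _; _]`_j) ([tuple _; _; _]`_j) (k 0 j) => x y z /andP[x1 x2] /andP[y1 y2].
    move: (d`_j) x2 y2 => w x2 y2 w0 xy; have [z0|z0] := eqVneq z 0; first by move: xy; rewrite z0; lia.
    have : `|w| <= `|z * w| by rewrite normrM ler_peMl// -gtz0_ge1 normr_gt0.
    by rewrite -xy; lia.
  case: i i' rr => -[i0 i1] i2 [[j0 j1] j2] rr.
  have := rr 0; have := rr 1; have := rr 2%:R; rewrite !mxE /= => -[e2] [e1] [e0].
  by congr (_, _, _); exact/val_inj.
- have key (x : 'rV[int]_3) : exists i, F (x *m U) = F (r i *m U).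
    have md (j : 'I_3) : (`|(x 0%R j %% (d`_j)%R)%Z| < `|(d`_j)%R|)%N.
      by have := ltz_mod (x 0 j) (d0 j); have := modz_ge0 (x 0 j) (d0 j); lia.
    exists (Ordinal (md 0), Ordinal (md 1), Ordinal (md 2%:R)); apply/FDP.
    exists (\row_(j < 3) (x 0%R j %/ (d`_j)%R)%Z).
    apply/rowP => j; rewrite DE 3![in LHS]mxE [in RHS]mxE.
    apply/eqP; rewrite subr_eq; apply/eqP; rewrite {1}(divz_eq (x 0 j) d`_j); congr (_ + _).
    by have := d0 j; have [->|->|->] := ord3P j; rewrite /= => dj; rewrite gez0_abs ?modz_ge0.
  apply/seteqP; split=> [_ [m _ <-]|_ /mapP[i _ ->]]; last by exists (r i *m U).
  have [i e] := key (m *m invmx U); move: e; rewrite mulmxKV// => ->.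
  by apply/mapP; exists i; rewrite ?mem_enum.
Qed.

Lemma sum3E (V : nmodType) (F : 'I_3 -> V) : \sum_(k < 3) F k = F 0 + F 1 + F 2%:R.
Proof. by rewrite (sum_ord3 _ 0) add0r; congr (_ + F _ + F _); apply/val_inj. Qed.

Section ideals.
Context (R : realType) (a : int) (K : fieldExtType rat) (iota : {rmorphism K -> R}) (rho : K).
Context (tau : {rmorphism K -> K}).
Hypotheses (a7 : 7 <= a) (hK : is_simplest_cubic_field a iota rho) (hM : is_monogenic rho).
Hypothesis htau : tau rho = rho' rho.

Lemma det_mul_matrix_neq0 (m : 'rV[int]_3) : m != 0 -> \det (mul_matrix a m) != 0.
Proof.
move=> m0; rewrite -(intr_eq0 R) (det_mul_matrix a7 hK htau); apply/prodf_neq0 => j _.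
by rewrite sg_eq0 (elt_eq0 a7 hK).
Qed.

(** In coordinates the ideal is the row lattice of [mul_matrix a m], so its index is the absolute
    determinant, which is the norm. *)
Lemma ideal_norm_elt m : m != 0 ->
  (ideal_norm [set elt rho m * u | u in ring_of_integers K])%:R =
  `|\prod_(j < 3) sg iota tau j (elt rho m)|.
Proof.
move=> m0; rewrite -(det_mul_matrix a7 hK htau) -intr_norm -abszE; congr (_%:R).
set I := [set _ | _ in _].
have IE v : I v <-> exists k, v = elt rho (k *m mul_matrix a m).
  split=> [[u /(OK_elt hK hM)[k ->] <-]|[k ->]].
    by exists k; rewrite (elt_mul hK) mulrC.
  exists (elt rho k); first by apply/(OK_elt hK hM); exists k.
  by rewrite (elt_mul hK) mulrC.
rewrite -(@ncard_cosets _ (mul_matrix a m) (fun k => [set elt rho k + v | v in I])).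
- congr ncard; apply/seteqP; split=> [_ [u /(OK_elt hK hM)[k ->] <-]|_ [k _ <-]]; first by exists k.
  by exists (elt rho k) => //; apply/(OK_elt hK hM); exists k.
- exact: det_mul_matrix_neq0.
- move=> k k'; split=> [e|[l e]].
    have : [set elt rho k + v | v in I] (elt rho k).
      by exists 0; [apply/IE; exists 0; rewrite mul0mx elt0|rewrite addr0].
    rewrite e => -[_ /IE[l ->]]; rewrite -eltD => /(elt_inj a7 hK) <-.
    by exists l; rewrite addrC addKr.
  apply/seteqP; split=> _ [_ /IE[l' ->] <-].
    exists (elt rho ((l + l') *m mul_matrix a m)); first by apply/IE; exists (l + l').
    by rewrite -!eltD mulmxDl -e addrA [k' + _]addrC subrK.
  exists (elt rho ((l' - l) *m mul_matrix a m)); first by apply/IE; exists (l' - l).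
  by rewrite -!eltD mulmxBl -e opprB !addrA addrAC [k + _]addrC addrK addrC.
Qed.

End ideals.

Section trace.
Context (R : realType) (a : int) (K : fieldExtType rat) (iota : {rmorphism K -> R}) (rho : K).
Context (tau : {rmorphism K -> K}).
Hypotheses (a7 : 7 <= a) (hK : is_simplest_cubic_field a iota rho) (hM : is_monogenic rho).
Hypothesis htau : tau rho = rho' rho.
Local Notation sg := (sg iota tau).
Local Notation vdm := (vdm iota rho tau).

Lemma sg_eltq j m : sg j (eltq rho m) = (map_mx ratr m *m vdm) 0 j.
Proof.
rewrite mx3_mulE !mxE /eltq 2!rmorphD (rmorphM _ _ rho) (rmorphM _ _ (rho ^+ 2)) rmorphXn !fmorph_alg.
by rewrite expr0 mulr1 expr1.
Qed.

(** The trace is defined on an arbitrary rational basis. [C] and [D] pass to the powers of [rho]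
    without changing it, and [vdm] diagonalizes the result with the conjugates of [u] on the
    diagonal. *)
Lemma trace_sg u : ratr (field_trace u) = \sum_(j < 3) sg j u.
Proof.
pose e := vbasis {:K}; have eb : basis_of {:K} e := vbasisP _.
pose W : 'M[R]_(_, 3) := \matrix_(i, j) sg j e`_(i : 'I_(\dim {:K})).
have WP j v : sg j v = (map_mx ratr (passmx.rVof e v) *m W) 0 j.
  rewrite {1}(coord_vbasis (memvf v)) rmorph_sum mxE; apply: eq_bigr => k _.
  by rewrite !mxE -mulr_algl rmorphM fmorph_alg.
pose A := passmx.mxof e e (amulr u).
have AP i : row i A = passmx.rVof e (e`_i * u).
  by rewrite rowE -(passmx.rVofE eb) -(passmx.rVof_app e eb) lfunE.
have [m mP] := choice (eltq_surj hK).
pose C : 'M[rat]_(_, 3) := \matrix_(i, j) m e`_(i : 'I_(\dim {:K})) 0 j.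
pose D : 'M[rat]_(3, _) := \matrix_(i, j) passmx.rVof e (rho ^+ (i : 'I_3)) 0 j.
have CD : C *m D = 1%:M.
  apply/row_matrixP => i; rewrite row_mul [RHS]rowE mulmx1 -(passmx.rVofE eb) [in RHS](mP e`_i).
  apply/rowP => k; rewrite [LHS]mx3_mulE !mxE /eltq !mulr_algl !linearD !linearZ /=.
  by rewrite expr0 expr1.
have trE : \tr A = \tr (D *m A *m C) by rewrite mxtrace_mulC mulmxA CD mul1mx.
have e1 : map_mx ratr D *m W = vdm.
  apply/matrixP => i j; rewrite [RHS]mxE -rmorphXn WP !mxE.
  by apply: eq_bigr => k _; rewrite !mxE.
have e2 : map_mx ratr A *m W = W *m diag_mx (\row_j sg j u).
  apply/matrixP => i j; rewrite mul_mx_diag !mxE -rmorphM WP -AP mxE.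
  by apply: eq_bigr => k _; rewrite !mxE.
have e3 : map_mx ratr C *m vdm = W.
  apply/matrixP => i j; rewrite [RHS]mxE [in RHS](mP e`_i) sg_eltq !mxE.
  by apply: eq_bigr => k _; rewrite !mxE.
have uV : vdm \in unitmx by rewrite unitmxE unitfE (det_vdm_neq0 a7 hK htau).
rewrite /field_trace -/e -/A trE -trace_map_mx !map_mxM -(mulmxK uV (_ *m map_mx ratr C)).
rewrite -[X in X *m invmx _]mulmxA e3 -[X in X *m invmx _]mulmxA e2 [X in X *m invmx _]mulmxA e1 mxtrace_mulC mulmxA mulVmx// mul1mx mxtrace_diag.
by apply: eq_bigr => j _; rewrite mxE.
Qed.

Lemma elt_delta i : elt rho (delta_mx 0 i) = rho ^+ i.
Proof. by have [->|->|->] := ord3P i; rewrite /elt !mxE /= ?(mul0r, mul1r, add0r, addr0). Qed.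

Lemma elt_sum n (c : 'I_n -> int) (m : 'I_n -> 'rV[int]_3) :
  elt rho (\sum_i c i *: m i) = \sum_i (c i)%:~R * elt rho (m i).
Proof.
rewrite (big_morph _ (eltD rho) (elt0 rho)); apply: eq_bigr => i _; exact: eltZ.
Qed.

(** The matrices between [b] and the powers of [rho] are integral and inverse to each other, which
    forces [n = 3] and determinant 1 or -1. The trace matrix is [W *m W^T] with [W] the matrix of
    conjugates, so its determinant is that of [vdm] squared. *)
Lemma discriminant_basis n (b : 'I_n -> K) : is_integral_basis b ->
  ratr (\det (\matrix_(i < n, j < n) field_trace (b i * b j))) = (a%:~R ^+ 2 + 3 * a%:~R + 9) ^+ 2 :> R.
Proof.
move=> [bO bU].
have [B BP] := choice (fun i => (OK_elt hK hM (b i)).1 (bO i)).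
have OKr (i : 'I_3) : ring_of_integers K (rho ^+ i).
  apply/(OK_elt hK hM); exists (delta_mx 0 i).
  by rewrite elt_delta.
have [G GP] := choice (fun i => bU _ (OKr i)).
pose Bm : 'M[int]_(n, 3) := \matrix_(i, j) B i 0 j.
pose Gm : 'M[int]_(3, n) := \matrix_(i, j) G i j.
have bE k : b k = \sum_(j < 3) rho ^+ j *~ Bm k j.
  by rewrite (BP k) sum3E /elt !mxE expr0 expr1 !mulrzl.
have rE (i : 'I_3) : rho ^+ i = \sum_(k < n) b k *~ Gm i k.
  by have [-> _] := GP i; apply: eq_bigr => k _; rewrite mxE.
have BG : Bm *m Gm = 1%:M.
  apply/matrixP => i j; have [m [_ mU]] := bU _ (bO i).
  have := mU [ffun k => (Bm *m Gm) i k]; have := mU [ffun k => (i == k)%:R].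
  have h1 : b i = \sum_k b k *~ [ffun k0 => (i == k0)%:R : int] k.
    rewrite (bigD1 i)//= big1 ?addr0 => [|k ki]; first by rewrite ffunE eqxx.
    by rewrite ffunE eq_sym (negPf ki).
  have h2 : b i = \sum_k b k *~ [ffun k0 => (Bm *m Gm) i k0] k.
    rewrite {1}(bE i); under eq_bigr do rewrite (rE _) mulrz_suml.
    rewrite exchange_big; apply: eq_bigr => k _; rewrite ffunE mxE mulrz_sumr.
    by apply: eq_bigr => l _; rewrite mulrC mulrzA.
  move=> /(_ h1) e1 /(_ h2) e2.
  by have := congr1 (fun f : {ffun _ -> int} => f j) (etrans (esym e2) e1);
    rewrite !ffunE => ->; rewrite [in RHS]mxE.
have GB : Gm *m Bm = 1%:M.
  apply/row_matrixP => i; apply: (elt_inj a7 hK); rewrite row_mul [row i 1%:M]rowE.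
  rewrite mulmx1 elt_delta mulmx_sum_row elt_sum rE; apply: eq_bigr => k _.
  by rewrite [row i Gm _ _]mxE mulrzl (BP k); congr (elt rho _ *~ _); apply/rowP => j; rewrite !mxE.
have n3 : n = 3%N.
  by apply/eqP; rewrite eqn_leq (mulmx1_min BG) (mulmx1_min GB).
subst n.
have dB : (\det Bm) ^+ 2 = 1.
  have : `|\det Bm|%N = 1%N.
    have := congr1 determinant BG; rewrite det_mulmx det1 => /(congr1 absz)/eqP.
    by rewrite abszM muln_eq1 => /andP[/eqP].
  by move=> h; rewrite -real_normK ?num_real// -abszE h.
pose W := map_mx intr Bm *m vdm.
have WE i j : W i j = sg j (b i).
  rewrite (BP i) sg_elt /lat !mx3_mulE; congr (_ * _ + _ * _ + _ * _); by rewrite !mxE.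
rewrite -det_map_mx (_ : map_mx _ _ = W *m W^T).
  rewrite det_mulmx det_tr -expr2 /W det_mulmx det_map_mx exprMn -rmorphXn dB mul1r.
  by rewrite -(det_vdm a7 hK htau) real_normK ?num_real.
apply/matrixP => i j; transitivity (ratr (field_trace (b i * b j)) : R).
  by rewrite [LHS]mxE; apply: (congr1 (ratr : rat -> R)); rewrite [LHS]mxE.
rewrite trace_sg [RHS]mxE; apply: eq_bigr => k _.
by rewrite [W^T _ _]mxE !WE rmorphM.
Qed.

Lemma is_integral_basis_powers : is_integral_basis (fun i : 'I_3 => rho ^+ i).
Proof.
split=> [i|u /(OK_elt hK hM)[m ->]].
  by apply/(OK_elt hK hM); exists (delta_mx 0 i); rewrite elt_delta.
have mE (f : {ffun 'I_3 -> int}) : \sum_(i < 3) rho ^+ i *~ f i = elt rho (\row_i f i).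
  by rewrite sum3E /elt !mxE expr0 expr1 !mulrzl.
exists [ffun i => m 0 i]; split=> [|f].
  by rewrite mE; congr elt; apply/rowP => i; rewrite mxE ffunE.
by rewrite mE => /(elt_inj a7 hK) ->; apply/ffunP => i; rewrite ffunE mxE.
Qed.

(** The set of candidate values is inhabited by the power basis, and every value in it is the same,
    so the choice made by [xget] is harmless. *)
Lemma discriminant_simplest_cubic :
  ratr (field_discriminant K) = (a%:~R ^+ 2 + 3 * a%:~R + 9) ^+ 2 :> R.
Proof.
rewrite /field_discriminant; set S := [set _ | _].
have [n [b [hb ->]]] : S (xget 0 S).
  apply: xgetPex; exists (\det (\matrix_(i, j) field_trace (rho ^+ (i : 'I_3) * rho ^+ (j : 'I_3)))).
  by exists 3%N, (fun i : 'I_3 => rho ^+ i); split=> //; exact: is_integral_basis_powers.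
exact: discriminant_basis.
Qed.

Lemma sg_rho_inj i j : sg i rho = sg j rho -> i = j.
Proof.
move=> e; apply: contraTeq (det_vdm_neq0 a7 hK htau) => ij; rewrite negbK -det_tr; apply/eqP.
by apply: (determinant_alternate ij) => k; rewrite !mxE e.
Qed.

Lemma rmorphism_eq (F : numFieldType) (g g' : {rmorphism K -> F}) : g rho = g' rho -> g =1 g'.
Proof.
move=> e u; have [m ->] := eltq_surj hK u.
by rewrite /eltq 2!(rmorphD g) 2!(rmorphD g') !(rmorphM _ _ rho) !(rmorphM _ _ (rho ^+ 2)) !rmorphXn !fmorph_alg e.
Qed.

Definition sgC j : {rmorphism K -> R[i]} := (real_complex R \o sg j : {rmorphism K -> R[i]}).

(** [g rho] is a complex root of the cubic, which already factors over the three real conjugates. *)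
Lemma embeddingP (g : {rmorphism K -> R[i]}) : exists j, g =1 sgC j.
Proof.
have fE (F : fieldType) (h : {rmorphism K -> F}) :
   h rho ^+ 3 - a%:~R * h rho ^+ 2 - (a%:~R + 3) * h rho - 1 = 0.
  have := congr1 h (rho_root hK); rewrite rmorph0 => <-.
  by rewrite !(rmorphB, rmorphM, rmorphXn, rmorph1) /= rmorphD !rmorph_int rmorph_nat.
have r0 := rho_neq0 hK; have r1 := rho1_neq0 hK; pose h := sgC 0.
have hr1 : 1 + h rho != 0 by rewrite -(rmorph1 h) -rmorphD fmorph_eq0.
have := factor_simplest_cubic (g rho) _ hr1 (fE _ h); rewrite fmorph_eq0 r0 fE => /(_ isT)/esym/eqP.
rewrite !mulf_eq0 !subr_eq0.
have h1 : sgC 1 rho = - (1 + h rho)^-1.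
  by rewrite -(rmorph1 h) -rmorphD -fmorphV -rmorphN /sgC /= htau.
have h2 : sgC 2%:R rho = - (1 + h rho) / h rho.
  rewrite -(rmorph1 h) -rmorphD -rmorphN -fmorph_div /sgC /= htau.
  by rewrite (tau_rho' hK htau).
by rewrite -h1 -h2 => /orP[/orP[]|] /eqP e; [exists 0|exists 1|exists 2%:R]; exact: rmorphism_eq.
Qed.

Lemma sgC_real j : is_real_embedding (sgC j).
Proof. by move=> u; rewrite /= complex_real. Qed.

Lemma nb_real_embeddings3 : nb_real_embeddings K R = 3%N.
Proof.
rewrite /nb_real_embeddings (@ncard_seq _ [seq (sgC j : K -> R[i]) | j <- enum 'I_3]).
- by rewrite size_map size_enum_ord.
- rewrite map_inj_uniq ?enum_uniq// => i j /(congr1 (fun g => g rho))/= /complexI; exact: sg_rho_inj.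
- apply/seteqP; split=> [_ [[g _ <-] _]|_ /mapP[j _ ->]].
    by have [j /funext gj] := embeddingP g; apply/mapP; exists j; rewrite ?mem_enum.
  by split; [exists (sgC j)|exact: sgC_real].
Qed.

Lemma nb_complex_places0 : nb_complex_places K R = 0%N.
Proof.
rewrite /nb_complex_places (_ : _ `\` _ = set0) ?(@ncard_seq _ [::])//.
  by apply/seteqP; split.
apply/seteqP; split=> // _ [[g _ <-]]; apply.
by have [j /funext ->] := embeddingP g; exact: sgC_real.
Qed.

Lemma roots_of_unityE : roots_of_unity K = [set 1; -1].
Proof.
apply/seteqP; split=> [z [n n0 zn]|z [] ->]; last first.
- by exists 2%N => //; rewrite sqrrN expr1n.
- by exists 1%N.
have : `|iota z| ^+ n = 1 by rewrite -normrX -rmorphXn zn rmorph1 normr1.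
move/eqP; rewrite pexpr_eq1 ?normr_ge0// -[1]normr1 eqr_norm2 => /orP[]/eqP h.
  by left; apply: (fmorph_inj iota); rewrite h rmorph1.
by right; apply: (fmorph_inj iota); rewrite h rmorphN rmorph1.
Qed.

Lemma ncard_roots_of_unity : ncard (roots_of_unity K) = 2%N.
Proof.
rewrite roots_of_unityE (@ncard_seq _ [:: 1; -1])//.
  rewrite /= inE andbT -subr_eq0 opprK.
  by apply/eqP => /(congr1 iota)/eqP; rewrite rmorph0 rmorphD rmorph1 -mulr2n pnatr_eq0.
apply/seteqP; split=> z /=; rewrite !inE; first by case=> ->; rewrite eqxx ?orbT.
by case/orP => /eqP; [left|right].
Qed.

(** [4 = 2 ^ 3 / 2] comes from three real embeddings and two roots of unity; the discriminant is a
    perfect square. *)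
Lemma ideal_densityE : ideal_density K R = 4 * regulator K R / (a%:~R ^+ 2 + 3 * a%:~R + 9).
Proof.
rewrite /ideal_density nb_real_embeddings3 nb_complex_places0 ncard_roots_of_unity.
rewrite discriminant_simplest_cubic expr0 mulr1.
have h : 0 < a%:~R ^+ 2 + 3 * a%:~R + 9 :> R.
  by rewrite -(det_vdm a7 hK htau) normr_gt0 (det_vdm_neq0 a7 hK htau).
rewrite normrX sqrtr_sqr normr_id gtr0_norm// !exprS expr0; field.
by rewrite gt_eqF.
Qed.

End trace.

(** * Units and the regulator *)

Section quadratic_form.
Context {R : realType}.
Implicit Types x y s t : R.

(** Half the squared Euclidean length of the vector [(x, y, - x - y)]. *)
Definition quad x y := x ^+ 2 + x * y + y ^+ 2.

Lemma quad_ge_first x y : 3 / 4 * x ^+ 2 <= quad x y.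
Proof.
rewrite -subr_ge0 /quad (_ : _ - _ = (x / 2 + y) ^+ 2); last by field.
exact: sqr_ge0.
Qed.

Lemma quadC x y : quad y x = quad x y. Proof. by rewrite /quad; ring. Qed.

Lemma quad_rot x y z : x + y + z = 0 -> quad y z = quad x y.
Proof. by move=> h; have -> : z = - x - y by [lra]; rewrite /quad; ring. Qed.

(** On the plane of sum zero the cyclic shift is a rotation by 120 degrees, so the Gram matrix of a
    vector and its shift is that of a hexagonal lattice. *)
Lemma quad_comb x y z s t : x + y + z = 0 ->
  quad (s * x + t * y) (s * y + t * z) = (s ^+ 2 - s * t + t ^+ 2) * quad x y.
Proof. by move=> h; have -> : z = - x - y by [lra]; rewrite /quad; ring. Qed.

Lemma quad_minor x y z : x + y + z = 0 -> x * z - y * y = - quad x y.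
Proof. by move=> h; have -> : z = - x - y by [lra]; rewrite /quad; ring. Qed.

Lemma round_half x : exists n : int, `|x - n%:~R| <= 1 / 2.
Proof.
exists (Num.floor (x + 1 / 2)).
have := floor_le_tmp (x + 1 / 2); have := floorD1_gt (x + 1 / 2); rewrite intrD1 ler_norml.
by move: (Num.floor _)%:~R => y; lra.
Qed.

(** Adding the three equations isolates [h]; what remains is a combination of a vector and its shift
    of length zero. *)
Lemma quad_coords_unique x y z s t h s' t' h' : x + y + z = 0 -> 0 < quad x y ->
  s * x + t * y + h = s' * x + t' * y + h' -> s * y + t * z + h = s' * y + t' * z + h' ->
  s * z + t * x + h = s' * z + t' * x + h' -> [/\ s = s', t = t' & h = h'].
Proof.
move=> sum0 q0 e0 e1 e2.
have eh : h = h'.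
  apply: (mulfI (_ : 3 != 0)); first by rewrite pnatr_eq0.
  have : (s * x + t * y + h) + (s * y + t * z + h) + (s * z + t * x + h) =
    (s' * x + t' * y + h') + (s' * y + t' * z + h') + (s' * z + t' * x + h') by rewrite e0 e1 e2.
  have E (b c d : R) : (b * x + c * y + d) + (b * y + c * z + d) + (b * z + c * x + d) =
    (b + c) * (x + y + z) + 3 * d by ring.
  by rewrite !E sum0 !mulr0 !add0r.
have := quad_comb (s - s') (t - t') sum0.
have -> : (s - s') * x + (t - t') * y = 0 by move: e0; rewrite eh; lra.
have -> : (s - s') * y + (t - t') * z = 0 by move: e1; rewrite eh; lra.
rewrite {1}/quad expr0n /= mul0r !addr0 => /esym/eqP; rewrite mulf_eq0 (gt_eqF q0) orbF => /eqP e.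
have et : t = t'.
  apply/eqP; rewrite -subr_eq0 -sqrf_eq0 eq_le sqr_ge0 andbT.
  have := sqr_ge0 (s - s' - (t - t') / 2).
  have -> : (s - s' - (t - t') / 2) ^+ 2 = ((s - s') ^+ 2 - (s - s') * (t - t') + (t - t') ^+ 2) - 3 / 4 * (t - t') ^+ 2 by field.
  by rewrite e; lra.
split=> //; move: e; rewrite et subrr mulr0 subr0 expr0n addr0 => /eqP.
by rewrite sqrf_eq0 subr_eq0 => /eqP.
Qed.

Lemma quad_half s t : `|s| <= 1 / 2 -> `|t| <= 1 / 2 -> s ^+ 2 - s * t + t ^+ 2 <= 3 / 4.
Proof.
have sq (r : R) : `|r| <= 1 / 2 -> r ^+ 2 <= 1 / 4.
  move=> h; rewrite -real_normK ?num_real// (_ : 1 / 4 = (1 / 2) ^+ 2); last by field.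
  by rewrite lerXn2r ?nnegrE.
move=> hs ht; have := sq _ hs; have := sq _ ht.
have : `|s * t| <= 1 / 2 * (1 / 2) by rewrite normrM ler_pM.
rewrite ler_norml => /andP[h _]; move: (s * t) (s ^+ 2) (t ^+ 2) h => x y z; lra.
Qed.

End quadratic_form.

Lemma det2E (R : comNzRingType) (M : 'M[R]_2) : \det M = M 0 0 * M 1 1 - M 0 1 * M 1 0.
Proof.
have [g H] : exists g : nat -> nat -> R, forall i j : 'I_2, M i j = g i j.
  by exists (fun a b => M (inord a) (inord b)) => i j; rewrite !inord_val.
rewrite (expand_det_row _ ord0) !big_ord_recl big_ord0 /cofactor !det_mx11 !mxE !H /=.
by rewrite /bump /=; ring.
Qed.

Lemma finite_min (R : realType) (T : choiceType) (f : T -> R) (A : set T) : finite_set A -> A !=set0 ->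
  exists2 u, A u & forall v, A v -> f u <= f v.
Proof.
move=> fA [u0 Au0]; have u0s : u0 \in fset_set A by rewrite in_fset_set// mem_set.
pose u := [arg min_(v < [` u0s]%fset) f (fsval v)]%O.
exists (fsval u).
  by apply/set_mem; rewrite -in_fset_set//; exact: fsvalP.
move=> v Av; have vs : v \in fset_set A by rewrite in_fset_set// mem_set.
by rewrite /u; case: Order.TotalTheory.arg_minP => // i _ /(_ [` vs]%fset); apply.
Qed.

(** * The logarithm lattice of the units *)

Section units.
Context (R : realType) (a : int) (K : fieldExtType rat) (iota : {rmorphism K -> R}) (rho : K).
Context (tau : {rmorphism K -> K}).
Hypotheses (a7 : 7 <= a) (hK : is_simplest_cubic_field a iota rho) (hM : is_monogenic rho).
Hypothesis htau : tau rho = rho' rho.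
Local Notation sg := (sg iota tau).
Local Notation vdm := (vdm iota rho tau).
Local Notation OK := (ring_of_integers K).
Local Notation unit := (@is_integral_unit K).
Implicit Types u v w : K.

Lemma OKM u v : OK u -> OK v -> OK (u * v).
Proof.
move=> /(OK_elt hK hM)[m ->] /(OK_elt hK hM)[m' ->].
by apply/(OK_elt hK hM); exists (m *m mul_matrix a m'); rewrite (elt_mul hK).
Qed.

Lemma OK1 : OK 1.
Proof. by apply/(OK_elt hK hM); exists (delta_mx 0 0); rewrite elt_delta. Qed.

Lemma OKN u : OK u -> OK (- u).
Proof.
move=> /(OK_elt hK hM)[m ->]; apply/(OK_elt hK hM); exists (- m).
by rewrite -[- m]add0r eltB elt0 add0r.
Qed.

Lemma OK_tau u : OK u -> OK (tau u).
Proof.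
move=> [p pm /(rmorph_root tau)]; rewrite -map_poly_comp => h; exists p => //.
by congr root: h; apply: eq_map_poly => z /=; rewrite rmorph_int.
Qed.

Lemma unit1 : unit 1.
Proof. by split; rewrite ?oner_eq0 ?invr1//; exact: OK1. Qed.

Lemma unitN u : unit u -> unit (- u).
Proof. by move=> [u0 Ou OV]; split; rewrite ?oppr_eq0 ?invrN//; exact: OKN. Qed.

Lemma unitM u v : unit u -> unit v -> unit (u * v).
Proof. by move=> [u0 Ou OuV] [v0 Ov OvV]; split; rewrite ?mulf_neq0 ?invfM//; exact: OKM. Qed.

Lemma unitV u : unit u -> unit u^-1.
Proof. by move=> [u0 Ou OuV]; split; rewrite ?invr_eq0 ?invrK. Qed.

Lemma unitX u (n : nat) : unit u -> unit (u ^+ n).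
Proof.
move=> Uu; elim: n => [|n IH]; first by rewrite expr0; exact: unit1.
by rewrite exprS; exact: unitM.
Qed.

Lemma unitXz u (n : int) : unit u -> unit (u ^ n).
Proof. by case: n => n Uu; [|apply: unitV]; exact: unitX. Qed.

Lemma unit_tau u : unit u -> unit (tau u).
Proof.
by move=> [u0 Ou OuV]; split; [rewrite fmorph_eq0|exact: OK_tau|rewrite -fmorphV; exact: OK_tau].
Qed.

Lemma unit_rho : unit rho.
Proof.
have OKp (p : {poly int}) : OK (map_poly intr p).[rho] by rewrite hM; exists p.
split; first exact: rho_neq0 hK.
  by have := OKp 'X; rewrite map_polyX hornerX.
have -> : rho^-1 = rho ^+ 2 - a%:~R * rho - (a%:~R + 3).
  apply: (mulIf (rho_neq0 hK)); rewrite mulVf ?(rho_neq0 hK)//.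
  by apply/eqP; rewrite eq_sym -subr_eq0; apply/eqP; rewrite -[RHS](rho_root hK); ring.
have := OKp ('X^2 - a *: 'X - (a + 3)%:P).
by rewrite !rmorphB /= map_polyZ /= map_polyXn map_polyX map_polyC /= rmorphD rmorph_nat !hornerE.
Qed.

Lemma sg_prod_unit u : unit u -> `|\prod_(j < 3) sg j u| = 1.
Proof.
move=> [u0 /(OK_elt hK hM)[m um] /(OK_elt hK hM)[m' um']].
have m0 : m != 0 by rewrite -(elt_eq0 a7 hK) -um.
have m0' : m' != 0 by rewrite -(elt_eq0 a7 hK) -um' invr_eq0.
have := norm_elt_ge1 a7 hK htau m0; have := norm_elt_ge1 a7 hK htau m0'; rewrite -um -um' => h' h.
apply/eqP; rewrite eq_le h andbT.
have e : `|\prod_(j < 3) sg j u| * `|\prod_(j < 3) sg j u^-1| = 1.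
  rewrite -normrM -big_split/= big1 ?normr1// => j _.
  by rewrite -rmorphM mulfV// rmorph1.
by rewrite -[leRHS]e ler_peMr.
Qed.

Definition lg (j : 'I_3) u : R := ln `|sg j u|.

Lemma sg_norm_gt0 j u : u != 0 -> 0 < `|sg j u|.
Proof. by rewrite normr_gt0 sg_eq0. Qed.

Lemma lgM j u v : u != 0 -> v != 0 -> lg j (u * v) = lg j u + lg j v.
Proof. by move=> u0 v0; rewrite /lg rmorphM normrM lnM// posrE sg_norm_gt0. Qed.

Lemma lgN j u : lg j (- u) = lg j u.
Proof. by rewrite /lg rmorphN normrN. Qed.

Lemma lg1 j : lg j 1 = 0.
Proof. by rewrite /lg rmorph1 normr1 ln1. Qed.

Lemma lgV j u : u != 0 -> lg j u^-1 = - lg j u.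
Proof. by move=> u0; rewrite /lg fmorphV normfV lnV// posrE sg_norm_gt0. Qed.

Lemma lgX j u (n : nat) : u != 0 -> lg j (u ^+ n) = n%:R * lg j u.
Proof.
move=> u0; elim: n => [|n IH]; first by rewrite expr0 lg1 mul0r.
by rewrite exprS lgM ?expf_neq0// IH -natr1 mulrDl mul1r addrC.
Qed.

Lemma lgXz j u (n : int) : u != 0 -> lg j (u ^ n) = n%:~R * lg j u.
Proof.
move=> u0; case: n => n; first exact: lgX.
by rewrite /exprz NegzE lgV ?expf_neq0// lgX// rmorphN mulNr.
Qed.

Lemma lg_tau j u : lg j (tau u) = lg (j + 1) u.
Proof. by rewrite /lg (sg_tau hK htau). Qed.

Lemma lg_sum u : unit u -> lg 0 u + lg 1 u + lg 2%:R u = 0.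
Proof.
move=> Uu; have [u0 _ _] := Uu; have := congr1 (@ln R) (sg_prod_unit Uu).
rewrite ln1 (prod_ord3 _ 0) !normrM !lnM ?posrE ?mulr_gt0 ?sg_norm_gt0// => <-.
Qed.

Definition lgq u := quad (lg 0 u) (lg 1 u).

Lemma lgq_ge j u : unit u -> 3 / 4 * lg j u ^+ 2 <= lgq u.
Proof.
move=> /lg_sum h; have [->|->|->] := ord3P j; rewrite /lgq; first exact: quad_ge_first.
  by rewrite -quadC; exact: quad_ge_first.
by rewrite -(quad_rot h) -quadC; exact: quad_ge_first.
Qed.

Lemma lg0_sign u : u != 0 -> lg 0 u = 0 -> u = 1 \/ u = -1.
Proof.
move=> u0; rewrite /lg => /(congr1 (@expR R)); rewrite lnK ?posrE ?sg_norm_gt0// expR0 /=.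
move/eqP; rewrite -[1]normr1 eqr_norm2 => /orP[]/eqP h.
  by left; apply: (fmorph_inj iota); rewrite rmorph1.
by right; apply: (fmorph_inj iota); rewrite rmorphN1.
Qed.

Lemma lgq_sign u : unit u -> lgq u <= 0 -> u = 1 \/ u = -1.
Proof.
move=> Uu q0; have [u0 _ _] := Uu; apply: lg0_sign => //.
have h := le_trans (lgq_ge 0 Uu) q0; apply/eqP; rewrite -sqrf_eq0 eq_le sqr_ge0 andbT.
by move: h; rewrite pmulr_rle0.
Qed.

(** Bounded logarithms bound all conjugates, and a cube contains finitely many lattice points. *)
Lemma finite_units (B : R) : finite_set [set u | unit u /\ lgq u <= B].
Proof.
have [N hN] := ball_finite (expR (1 + B)) (norm_ge1_vdm a7 hK htau).
have fin := atmost_finite (hN 0).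
apply: sub_finite_set (finite_image (elt rho) fin) => u [Uu qB].
have [u0 /(OK_elt hK hM)[m um] _] := Uu; exists m => //= j.
rewrite [X in _ - X]mxE subr0 -sg_elt -um -[leLHS]lnK ?posrE ?sg_norm_gt0// ler_expR -/(lg j u).
(* [x <= 3 / 4 * x ^+ 2 + 1 / 3] for all [x], by the square of [x - 2 / 3]; hence the radius
   [expR (1 + B)]. *)
have := le_trans (lgq_ge j Uu) qB; have := sqr_ge0 (lg j u - 2 / 3).
by move: (lg j u) => x; rewrite !expr2; nra.
Qed.

Lemma lgq_ge0 u : unit u -> 0 <= lgq u.
Proof. by move=> Uu; apply: le_trans (lgq_ge 0 Uu); rewrite mulr_ge0 ?sqr_ge0. Qed.

Lemma lgq_rho_gt0 : 0 < lgq rho.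
Proof.
have h := iota_rho_gt a7 hK; apply: lt_le_trans (lgq_ge 0 unit_rho).
have a0 : 7 <= a%:~R :> R by rewrite (_ : 7 = 7%:~R :> R) ?ler_int// rmorph_nat.
rewrite mulr_gt0// exprn_gt0// /lg sg0 ln_gt0// ger0_norm; lra.
Qed.

(** [rho] is a candidate, so the minimum is taken over a finite nonempty set and inherits the upper
    bound [lgq rho]. *)
Lemma exists_minimal_unit : exists u, [/\ unit u, 0 < lgq u, lgq u <= lgq rho &
  forall w, unit w -> 0 < lgq w -> lgq u <= lgq w].
Proof.
pose A := [set u | (unit u /\ lgq u <= lgq rho) /\ 0 < lgq u].
have fA : finite_set A by apply: sub_finite_set (finite_units (lgq rho)) => u [].
have [|u [[Uu qu] u0] umin] := finite_min lgq fA.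
  by exists rho; split; [split=> //; exact: unit_rho|exact: lgq_rho_gt0].
exists u; split=> // w Uw w0; have [qw|/ltW qw] := leP (lgq w) (lgq rho); first exact: umin.
exact: le_trans qw.
Qed.

Lemma lg_comb j u (m n : int) : u != 0 ->
  lg j (u ^ m * tau u ^ n) = m%:~R * lg j u + n%:~R * lg (j + 1) u.
Proof.
move=> u0; have tu0 : tau u != 0 by rewrite fmorph_eq0.
by rewrite lgM ?expfz_neq0// !lgXz// lg_tau.
Qed.

Lemma lgq_comb u v (s t : R) : unit u ->
  lg 0 v = s * lg 0 u + t * lg 1 u -> lg 1 v = s * lg 1 u + t * lg 2%:R u ->
  lgq v = (s ^+ 2 - s * t + t ^+ 2) * lgq u.
Proof. by move=> /lg_sum h e0 e1; rewrite /lgq e0 e1; exact: quad_comb. Qed.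

Lemma lg_solve u (b c : R) : unit u -> 0 < lgq u -> exists s t : R,
  b = s * lg 0 u + t * lg 1 u /\ c = s * lg 1 u + t * lg 2%:R u.
Proof.
move=> Uu q0; have := quad_minor (lg_sum Uu); rewrite -/(lgq u).
set x := lg 0 u; set y := lg 1 u; set z := lg 2%:R u => e.
have D0 : x * z - y * y != 0 by rewrite e oppr_eq0 gt_eqF.
exists ((b * z - c * y) / (x * z - y * y)), ((x * c - y * b) / (x * z - y * y)).
by split; field.
Qed.

Section minimal.
Variable u : K.
Hypotheses (Uu : unit u) (q0 : 0 < lgq u) (umin : forall w, unit w -> 0 < lgq w -> lgq u <= lgq w).

(* Rounding the log coordinates of [w] to integers multiplies [lgq] by at most 3/4, against minimality. *)
Lemma unit_span w : unit w -> exists m n : int, exists2 e, e = 1 \/ e = -1 & w = e * (u ^ m * tau u ^ n).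
Proof.
move=> Uw; have [u0 _ _] := Uu; have [w0 _ _] := Uw.
have [s [t [e0 e1]]] := lg_solve (lg 0 w) (lg 1 w) Uu q0.
have [m hm] := round_half s; have [n hn] := round_half t.
have Up : unit (u ^ m * tau u ^ n) by apply: unitM; apply: unitXz => //; exact: unit_tau.
have [p0 _ _] := Up.
pose v := w * (u ^ m * tau u ^ n)^-1.
have Uv : unit v by apply: unitM => //; exact: unitV.
have vE : lgq v = ((s - m%:~R) ^+ 2 - (s - m%:~R) * (t - n%:~R) + (t - n%:~R) ^+ 2) * lgq u.
  by apply: lgq_comb => //; rewrite /v lgM ?invr_eq0// lgV// lg_comb// ?e0 ?e1;
    [rewrite (_ : 0 + 1 = 1) ?add0r//; ring|rewrite (_ : 1 + 1 = 2%:R :> 'I_3); [ring|exact: val_inj]].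
exists m, n, v; last by rewrite /v divfK.
apply: lgq_sign => //; rewrite leNgt; apply/negP => v0.
have := umin Uv v0; rewrite vE leNgt => /negP; apply.
rewrite gtr_pMl//; apply: le_lt_trans (quad_half hm hn) _.
by rewrite ltr_pdivrMr// mul1r ltr_nat.
Qed.

Lemma unit_independent (m n : int) : lg 0 (u ^ m * tau u ^ n) = 0 -> lg 1 (u ^ m * tau u ^ n) = 0 ->
  m = 0 /\ n = 0.
Proof.
have [u0 _ _] := Uu; rewrite !lg_comb// add0r (_ : 1 + 1 = 2%:R :> 'I_3); last exact: val_inj.
move=> h0 h1; have := quad_comb m%:~R n%:~R (lg_sum Uu).
rewrite h0 h1 -/(lgq u) {1}/quad expr0n /= mul0r !addr0 => /esym/eqP.
rewrite mulf_eq0 (gt_eqF q0) orbF -!rmorphXn -rmorphM -rmorphB -rmorphD intr_eq0 => /eqP e.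
(* Completing the square shows that the hexagonal form is positive definite. *)
have e1 : (2 * m - n) ^+ 2 + 3 * n ^+ 2 = 0.
  by transitivity (4 * (m ^+ 2 - m * n + n ^+ 2)); [ring|rewrite e mulr0].
have s1 := sqr_ge0 (2 * m - n); have s2 := sqr_ge0 n.
have n0 : n = 0 by apply/eqP; rewrite -sqrf_eq0; apply/eqP; move: s1 s2 e1; clear; lia.
split=> //; apply/eqP; rewrite -sqrf_eq0; apply/eqP; move: e; rewrite n0; lia.
Qed.

Definition min_system (i : 'I_2) : K := if i == 0 then u else tau u.

Lemma min_system_fundamental : is_fundamental_units min_system.
Proof.
have [u0 _ _] := Uu; have Utu := unit_tau Uu; have [tu0 _ _] := Utu.
split=> [i|w Uw]; first by rewrite /min_system; case: ifP.
have prodE (f : {ffun 'I_2 -> int}) : \prod_(i < 2) min_system i ^ f i = u ^ f 0 * tau u ^ f 1.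
  by rewrite !big_ord_recl big_ord0 mulr1 /min_system /=; congr (_ * tau u ^ f _); apply/val_inj.
have [m [n [e eP wE]]] := unit_span Uw.
have rE z : roots_of_unity K z <-> z = 1 \/ z = -1 by rewrite (roots_of_unityE iota).
exists (e, [ffun i => if i == 0 then m else n]); split=> /=.
  by rewrite prodE !ffunE /=; split=> //; apply/rE.
move=> [z f] /= [/rE zP]; rewrite prodE => wE'.
have lgs j x y : x = 1 \/ x = -1 -> lg j (x * y) = lg j y.
  by case=> ->; rewrite ?mul1r ?mulN1r ?lgN.
have ss (x : K) : x = 1 \/ x = -1 -> x != 0 by case=> ->; rewrite ?oppr_eq0 ?oner_eq0.
have lw j : lg j (u ^ m * tau u ^ n) = lg j (u ^ f 0 * tau u ^ f 1).
  have := congr1 (lg j) (etrans (esym wE) wE').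
  by rewrite (lgs _ _ _ eP) (lgs _ _ _ zP).
have [d0 d1] : m - f 0 = 0 /\ n - f 1 = 0.
  by apply: unit_independent; rewrite lg_comb// !rmorphB /=;
   [have := lw 0|have := lw 1]; rewrite !lg_comb// => h; apply/eqP; move/eqP: h; rewrite -subr_eq0 => /eqP h;
   apply/eqP; rewrite -[RHS]h; ring.
have fm : f 0 = m by apply/esym/eqP; rewrite -subr_eq0 d0.
have fn : f 1 = n by apply/esym/eqP; rewrite -subr_eq0 d1.
congr (_, _).
  by move: wE' wE => -> ; rewrite fm fn => /mulIf -> //; rewrite mulf_neq0 ?expfz_neq0.
apply/ffunP => i; rewrite ffunE; case: i => -[|[|//]] hi /=.
  by rewrite -fm; congr (f _); apply/val_inj.
by rewrite -fn; congr (f _); apply/val_inj.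
Qed.

End minimal.

Lemma lg_sign j e : roots_of_unity K e -> lg j e = 0.
Proof. by rewrite (roots_of_unityE iota) => -[] ->; rewrite ?lgN lg1. Qed.

Lemma lg_prod n j (F : 'I_n -> K) : (forall i, F i != 0) -> lg j (\prod_i F i) = \sum_i lg j (F i).
Proof.
move=> F0; pose P (p : K) s := p != 0 /\ lg j p = s.
suff : P (\prod_i F i) (\sum_i lg j (F i)) by case.
apply: (big_rec2 P); first by split; [exact: oner_neq0|exact: lg1].
by move=> i p s _ [p0 <-]; split; [rewrite mulf_neq0|rewrite lgM].
Qed.

(** Logarithms forget the root of unity, so only the integer exponents remain. *)
Lemma fundamental_span r r' (eps : 'I_r -> K) (eps' : 'I_r' -> K) : (forall i, unit (eps i)) ->
  is_fundamental_units eps' -> exists A : 'M[int]_(r, r'),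
  forall i j, lg j (eps i) = \sum_k (A i k)%:~R * lg j (eps' k).
Proof.
move=> Ueps [Ueps' span].
have /choice[f fP] i : exists f : {ffun 'I_r' -> int}, forall j, lg j (eps i) = \sum_k (f k)%:~R * lg j (eps' k).
  have [[z f] [[/= zr e] _]] := span _ (Ueps i); exists f => j.
  have n0 k : eps' k ^ f k != 0 by apply: expfz_neq0; have [] := Ueps' k.
  have z0 : z != 0 by move: zr; rewrite (roots_of_unityE iota) => -[] ->; rewrite ?oppr_eq0 oner_eq0.
  rewrite e lgM//; last by apply/prodf_neq0 => k _; exact: n0.
  rewrite lg_sign// add0r lg_prod//; apply: eq_bigr => k _.
  by rewrite lgXz//; have [] := Ueps' k.
by exists (\matrix_(i, k) f i k) => i j; rewrite fP; apply: eq_bigr => k _; rewrite mxE.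
Qed.

Lemma normc_real (x : R) : Normc.normc (x%:C%C) = `|x|.
Proof. by rewrite /= expr0n addr0 sqrtr_sqr. Qed.

Lemma sgC_conj j w : conjc (sgC iota tau j w) = sgC iota tau j w.
Proof. by rewrite /= oppr0. Qed.

Lemma sgC_inj i j : sgC iota tau i =1 sgC iota tau j -> i = j.
Proof. by move=> /(_ rho) /complexI; exact: (sg_rho_inj a7 hK htau). Qed.

Lemma represents_places_sgC : represents_places (sgC iota tau).
Proof.
move=> g; have [j gj] := embeddingP hK htau g; exists j; split; first by left.
by move=> k [|] gk; apply: sgC_inj => w; rewrite -gj gk//= oppr0.
Qed.

(** The logarithms sum to zero, so all these minors agree up to sign; the regulator does not depend
    on the omitted embedding. *)
Lemma lg_minor u (c d : 'I_3) : unit u -> c != d ->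
  `|lg c u * lg (d + 1) u - lg d u * lg (c + 1) u| = lgq u.
Proof.
move=> Uu; have h := lg_sum Uu; have q0 := lgq_ge0 Uu; rewrite /lgq in q0 *.
have e01 : 0 + 1 = 1 :> 'I_3 by exact: val_inj.
have e12 : 1 + 1 = 2%:R :> 'I_3 by exact: val_inj.
have e20 : 2%:R + 1 = 0 :> 'I_3 by exact: val_inj.
have z : lg 2%:R u = - lg 0 u - lg 1 u by lra.
have [->|->|->] := ord3P c; have [->|->|->] := ord3P d; rewrite ?eqxx// ?(e01, e12, e20) z => _;
  set x := lg 0 u in q0 *; set y := lg 1 u in q0 *.
- by rewrite [X in `|X|](_ : _ = - quad x y) ?normrN ?ger0_norm//; rewrite /quad; ring.
- by rewrite [X in `|X|](_ : _ = quad x y) ?ger0_norm//; rewrite /quad; ring.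
- by rewrite [X in `|X|](_ : _ = quad x y) ?ger0_norm//; rewrite /quad; ring.
- by rewrite [X in `|X|](_ : _ = - quad x y) ?normrN ?ger0_norm//; rewrite /quad; ring.
- by rewrite [X in `|X|](_ : _ = - quad x y) ?normrN ?ger0_norm//; rewrite /quad; ring.
- by rewrite [X in `|X|](_ : _ = quad x y) ?ger0_norm//; rewrite /quad; ring.
Qed.

(** A choice of places is a bijection with the three real embeddings, which forces [r = 2]. Two
    fundamental systems are related by integer matrices in both directions, so their determinants
    agree up to sign, and for [u] and [tau u] the determinant is a minor computed by [lg_minor]. *)
Lemma regulator_set u r (sigma : 'I_r.+1 -> {rmorphism K -> R[i]}) (eps : 'I_r -> K) :
  unit u -> 0 < lgq u -> is_fundamental_units (min_system u) ->
  represents_places sigma -> is_fundamental_units eps ->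
  `| \det (\matrix_(i < r, j < r)
        (let s := sigma (widen_ord (leqnSn r) j) in
         (local_degree s)%:R * ln (Normc.normc (s (eps i))))) | = lgq u.
Proof.
move=> Uu q0 Fu Ps Fe.
have /choice[p pP] := fun j => embeddingP hK htau (sigma j).
have pinj : injective p.
  move=> i j e; have [k [_ kU]] := Ps (sigma i).
  by rewrite -(kU i) ?(kU j)//; left=> // w; rewrite (pP i) e -(pP j).
have psurj k : exists i, p i = k.
  have [i [hi _]] := Ps (sgC iota tau k); exists i; apply: sgC_inj => w.
  by case: hi => /(_ w) ->; rewrite ?[(_ \o _) w]/= pP ?sgC_conj.
have r2 : r = 2%N.
  apply/eqP; rewrite -eqSS; apply/eqP; rewrite -[LHS]card_ord -[RHS](card_ord 3).
  have [q qP] := choice psurj.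
  by apply: (bij_eq_card (f := p)); exists q => // i; apply: pinj; rewrite qP.
subst r.
set N := (X in \det X); pose c (j : 'I_2) := p (widen_ord (leqnSn 2) j).
have NE i j : N i j = lg (c j) (eps i).
  rewrite mxE /local_degree asboolT ?mul1r.
    by rewrite pP normc_real.
  by rewrite (funext (pP _)); exact: sgC_real.
pose L : 'M[R]_2 := \matrix_(i, j) lg (c j) (min_system u i).
have LE : `|\det L| = lgq u.
  rewrite det2E !mxE /min_system /= !lg_tau lg_minor//.
  by rewrite (inj_eq pinj).
have [A AP] := fundamental_span Fe.1 Fu; have [B BP] := fundamental_span Fu.1 Fe.
have NA : N = map_mx intr A *m L.
  by apply/matrixP => i j; rewrite NE AP mxE; apply: eq_bigr => k _; rewrite !mxE.
have LB : L = map_mx intr B *m N.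
  apply/matrixP => i j; rewrite [LHS]mxE BP [RHS]mxE; apply: eq_bigr => k _.
  by rewrite NE mxE.
have AB : `|\det A| * `|\det B| = 1.
  have := congr1 determinant LB; rewrite NA !det_mulmx !det_map_mx mulrA -[LHS]mul1r => /mulIf e.
  have : \det L != 0 by rewrite -normr_gt0 LE.
  move=> /e; rewrite -rmorphM -[1](rmorph1 (intr : int -> R)) => /intr_inj h.
  by rewrite -normrM mulrC -h normr1.
have A1 : `|\det A| = 1.
  by move: AB; rewrite -!abszE -PoszM => -[/eqP]; rewrite muln_eq1 => /andP[/eqP ->].
by rewrite NA det_mulmx normrM det_map_mx -intr_norm A1 mul1r LE.
Qed.

Lemma regulatorE u : unit u -> 0 < lgq u -> (forall w, unit w -> 0 < lgq w -> lgq u <= lgq w) ->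
  regulator K R = lgq u.
Proof.
move=> Uu q0 umin; have Fu := min_system_fundamental Uu q0 umin.
rewrite /regulator; set S := [set _ | _].
have [r [sigma [eps [Ps Fe ->]]]] : S (xget 0 S); last exact: regulator_set.
apply: xgetPex; eexists; exists 2%N, (sgC iota tau), (min_system u); split=> //.
exact: represents_places_sgC.
Qed.

(** With [x = ln r] and [y = ln (1 + r)] the form is [x ^+ 2 - x * y + y ^+ 2], at most [y ^+ 2]
    since [0 <= x <= y]; and [1 + r < a + 3 <= a ^+ 2]. *)
Lemma lgq_rho_le : lgq rho <= 4 * ln a%:~R ^+ 2.
Proof.
have a0 : 7 <= a%:~R :> R by rewrite (_ : 7 = 7%:~R :> R) ?ler_int// rmorph_nat.
have h1 := iota_rho_gt a7 hK; have h2 := iota_rho_lt a7 hK.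
rewrite /lgq /lg sg0 (sg1 _ htau) normrN normfV.
set r := iota rho in h1 h2 *; rewrite !gtr0_norm ?lnV ?posrE; [|lra..].
have x0 : 0 <= ln r by apply: ln_ge0; lra.
have xy : ln r <= ln (1 + r) by rewrite ler_ln ?posrE; lra.
have y2 : ln (1 + r) <= 2 * ln a%:~R.
  have -> : 2 * ln a%:~R = ln (a%:~R ^+ 2) :> R by rewrite lnXn ?mulr_natl//; lra.
  by rewrite ler_ln ?posrE ?exprn_gt0//; [nra|lra|lra].
apply: (@le_trans _ _ (ln (1 + r) ^+ 2)).
  rewrite /quad sqrrN; move: (ln r) (ln (1 + r)) x0 xy => x y x0 xy; nra.
have -> : 4 * ln a%:~R ^+ 2 = (2 * ln a%:~R) ^+ 2 :> R by ring.
by rewrite lerXn2r ?nnegrE//; lra.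
Qed.

(** The three logarithms are then equal, and their sum is zero. *)
Lemma tau_fixed_sign u : unit u -> tau u = u -> lgq u = 0.
Proof.
move=> Uu tu; have h := lg_sum Uu.
have e j : lg (j + 1) u = lg j u by rewrite -lg_tau tu.
have := e 0; have := e 1; rewrite add0r (_ : 1 + 1 = 2%:R :> 'I_3); last exact: val_inj.
by move=> e2 e1; rewrite /lgq /quad e1; have -> : lg 0 u = 0 by [lra]; ring.
Qed.

(* The discriminant of Z[u] is a nonzero multiple of that of O_K. *)
Lemma discriminant_le u : unit u -> 0 < lgq u ->
  a%:~R ^+ 2 + 3 * a%:~R + 9 <= `|(sg 1 u - sg 0 u) * (sg 2%:R u - sg 0 u) * (sg 2%:R u - sg 1 u)|.
Proof.
move=> Uu q0; have [u0 Ou _] := Uu.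
have OX (i : 'I_3) : OK (u ^+ i) by have [] := unitX i Uu.
have /choice[m mP] i := (OK_elt hK hM _).1 (OX i).
pose C : 'M[int]_3 := \matrix_(i, j) m i 0 j.
pose W : 'M[R]_3 := \matrix_(i, j) sg j u ^+ i.
have WE : W = map_mx intr C *m vdm.
  apply/matrixP => i j; rewrite [LHS]mxE -rmorphXn (mP i) sg_elt /lat !mx3_mulE.
  by congr (_ * _ + _ * _ + _ * _); rewrite !mxE.
have dW : \det W = (sg 1 u - sg 0 u) * (sg 2%:R u - sg 0 u) * (sg 2%:R u - sg 1 u).
  by rewrite det3E ![W _ _]mxE !(expr0, expr1); ring.
have ne : sg 0 u != sg 1 u /\ sg 1 u != sg 2%:R u /\ sg 2%:R u != sg 0 u.
  have tu : tau u != u by apply/eqP => /(tau_fixed_sign Uu) e; move: q0; rewrite e ltxx.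
  split; first by rewrite eq_sym [sg 1 u]/= fmorph_eq.
  split; first by rewrite /= (inj_eq (fmorph_inj iota)) (inj_eq (fmorph_inj tau)) eq_sym.
  rewrite /= (inj_eq (fmorph_inj iota)) -(inj_eq (fmorph_inj tau)) (tau3 hK htau) eq_sym.
  exact: tu.
have C0 : \det C != 0.
  apply/eqP => e; have := congr1 determinant WE; rewrite dW det_mulmx det_map_mx e mul0r => /eqP.
  by case: ne => [n1 [n2 n3]]; rewrite !mulf_eq0 !subr_eq0 (negPf n3) [_ == sg 0 u]eq_sym (negPf n1) [_ == sg 1 u]eq_sym (negPf n2).
rewrite -dW WE det_mulmx normrM -(det_vdm a7 hK htau) ler_peMl//.
by rewrite det_map_mx -intr_norm ler1z -gtz0_ge1 normr_gt0.
Qed.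

(** Let [k] be the largest conjugate. The three differences in the discriminant are at most twice
    its absolute value, so [a ^+ 2 <= 8 * |sg k u| ^+ 3]. Squaring and using [64 <= a ^+ 3] gives
    [a <= |sg k u| ^+ 6], that is [ln a <= 6 * lg k u]; and [3 / 4 / 36 = 1 / 48]. *)
Lemma lgq_lower u : unit u -> 0 < lgq u -> ln a%:~R ^+ 2 / 48 <= lgq u.
Proof.
move=> Uu q0; have [u0 _ _] := Uu.
have a0 : 7 <= a%:~R :> R by rewrite (_ : 7 = 7%:~R :> R) ?ler_int// rmorph_nat.
have [k kmax] : exists k : 'I_3, forall j, `|sg j u| <= `|sg k u|.
  exists [arg max_(i > (0 : 'I_3)) `|sg i u|]%O => j.
  by case: Order.TotalTheory.arg_maxP => // i _ /(_ j); apply.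
have M0 : 0 < `|sg k u| := sg_norm_gt0 k u0.
have hd i j : `|sg i u - sg j u| <= 2 * `|sg k u|.
  by rewrite mulr_natl mulr2n; apply: le_trans (ler_normB _ _) _; rewrite lerD.
have h3 : a%:~R ^+ 2 <= 8 * `|sg k u| ^+ 3.
  apply: (@le_trans _ _ (a%:~R ^+ 2 + 3 * a%:~R + 9)); first by lra.
  apply: le_trans (discriminant_le Uu q0) _; rewrite !normrM.
  have -> : 8 * `|sg k u| ^+ 3 = (2 * `|sg k u|) * (2 * `|sg k u|) * (2 * `|sg k u|) by ring.
  by rewrite !ler_pM ?mulr_ge0.
have h6 : a%:~R <= `|sg k u| ^+ 6.
  have : (a%:~R ^+ 2) ^+ 2 <= (8 * `|sg k u| ^+ 3) ^+ 2 by rewrite lerXn2r ?nnegrE ?mulr_ge0 ?exprn_ge0//; lra.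
  have -> : (8 * `|sg k u| ^+ 3) ^+ 2 = 64 * `|sg k u| ^+ 6 by ring.
  have : 64 * a%:~R <= (a%:~R ^+ 2) ^+ 2 :> R.
    have -> : (a%:~R ^+ 2) ^+ 2 = a%:~R ^+ 3 * a%:~R :> R by ring.
    rewrite ler_wpM2r//; first by lra.
    have : (7 : R) ^+ 3 <= a%:~R ^+ 3 by rewrite lerXn2r ?nnegrE//; lra.
    by move: (a%:~R ^+ 3) => y; lra.
  by move: ((a%:~R ^+ 2) ^+ 2) (`|sg k u| ^+ 6) => y z; lra.
have hl : ln a%:~R <= 6 * lg k u.
  have -> : 6 * lg k u = ln (`|sg k u| ^+ 6) by rewrite lnXn// mulr_natl.
  by rewrite ler_ln ?posrE ?exprn_gt0//; lra.
have l0 : 0 <= ln a%:~R :> R by apply: ln_ge0; lra.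
apply: le_trans (lgq_ge k Uu).
have : ln a%:~R ^+ 2 <= (6 * lg k u) ^+ 2 by rewrite lerXn2r ?nnegrE//; lra.
by rewrite exprMn; move: (ln _ ^+ 2) (lg k u ^+ 2) => y z; lra.
Qed.


End units.

(** * A fundamental domain for the units *)

Lemma ncard_image_inj (T T' : choiceType) (f : T -> T') (A : set T) : finite_set A ->
  (forall x y, A x -> A y -> f x = f y -> x = y) -> ncard (f @` A) = ncard A.
Proof.
move=> fA finj; have mA x : x \in fset_set A -> A x by rewrite in_fset_set// => /set_mem.
rewrite (@ncard_seq _ [seq f x | x <- fset_set A]); first by rewrite size_map.
  by rewrite map_inj_in_uniq ?fset_uniq// => x y /mA Ax /mA Ay; exact: finj.
apply/seteqP; split=> [_ [x Ax <-]|_ /mapP[x /mA Ax ->]]; last by exists x.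
by apply/mapP; exists x => //; rewrite in_fset_set// mem_set.
Qed.

Lemma ncard_bigcup (R : realType) (T : choiceType) (I : finType) (F : I -> set T) :
  (forall i, finite_set (F i)) -> (forall i j x, F i x -> F j x -> i = j) ->
  (ncard (\bigcup_i F i))%:R = \sum_i (ncard (F i))%:R :> R.
Proof.
move=> fF dF; have fA : finite_set (\bigcup_i F i) by apply: bigcup_finite.
pose s := enum_fset (fset_set (\bigcup_i F i)).
have sP i x : F i x -> x \in s by move=> Fx; rewrite in_fset_set// mem_set//; exists i.
rewrite -(@ncard_sum_indic _ _ s) ?fset_uniq//; last by move=> x [i _]; exact: sP.
under [in RHS]eq_bigr => i _ do rewrite -(@ncard_sum_indic _ _ s _ (fset_uniq _) (sP i)).
rewrite exchange_big/=; apply: eq_big_seq => x; rewrite in_fset_set// => /set_mem[i _ Fx].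
rewrite indicE mem_set/=; last by exists i.
rewrite (bigD1 i)//= indicE mem_set// big1 ?addr0// => j ji.
rewrite indicE memNset// => Fjx; move/eqP: ji; apply; exact: dF Fjx Fx.
Qed.

Lemma fractional_shift (R : realType) (s s' : R) (k : int) : 0 <= s < 1 -> 0 <= s' < 1 ->
  s' = s + k%:~R -> k = 0.
Proof.
move=> s01 s01' e.
have h1 : (-1)%:~R < k%:~R :> R by rewrite rmorphN1; lra.
have h2 : k%:~R < 1%:~R :> R by rewrite rmorph1; lra.
by move: h1 h2; rewrite !ltr_int => {e}; lia.
Qed.

Lemma fractional_shift_nat (R : realType) (r r' : R) (n n' : nat) : 0 <= r < 1 -> 0 <= r' < 1 ->
  n%:R + r = n'%:R + r' -> n = n'.
Proof.
move=> r01 r01' e; have H : n%:Z - n'%:Z = 0.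
  by apply: (@fractional_shift R r r' _ r01 r01'); rewrite rmorphB /= -!pmulrn; lra.
by move/eqP: H; rewrite subr_eq0 => /eqP[].
Qed.

Lemma det_frame (R : realType) (p q : 'rV[R]_3) : p 0 0 + p 0 1 + p 0 2%:R = 0 ->
  q 0 0 + q 0 1 + q 0 2%:R = 0 -> \det (frame p q) = 3 * (p 0 0 * q 0 1 - p 0 1 * q 0 0).
Proof.
move=> sp sq; rewrite det3E !mxE /=.
have -> : p 0 2%:R = - p 0 0 - p 0 1 by lra.
have -> : q 0 2%:R = - q 0 0 - q 0 1 by lra.
ring.
Qed.

Lemma sign_mul_gt0 (R : realDomainType) (b : bool) (x : R) : 0 < (-1) ^+ b * x -> b = (x < 0).
Proof.
case: b; rewrite ?expr1 ?expr0 ?mulN1r ?mul1r ?oppr_gt0 => h; first by rewrite h.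
by apply/esym/negbTE; rewrite -leNgt ltW.
Qed.

Section gluing.
Context (R : realType) (a : int) (K : fieldExtType rat) (iota : {rmorphism K -> R}) (rho : K).
Context (tau : {rmorphism K -> K}).
Hypotheses (a7 : 7 <= a) (hK : is_simplest_cubic_field a iota rho) (hM : is_monogenic rho).
Hypothesis htau : tau rho = rho' rho.
Local Notation sg := (sg iota tau).
Local Notation vdm := (vdm iota rho tau).
Local Notation OK := (ring_of_integers K).
Local Notation unit := (@is_integral_unit K).
Local Notation lg := (lg iota tau).
Local Notation lgq := (lgq iota tau).
Context (u : K).
Hypotheses (Uu : unit u) (q0 : 0 < lgq u) (umin : forall w, unit w -> 0 < lgq w -> lgq u <= lgq w).

Let e01 : 0 + 1 = 1 :> 'I_3. Proof. exact: val_inj. Qed.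
Let e12 : 1 + 1 = 2%:R :> 'I_3. Proof. exact: val_inj. Qed.
Let e20 : 2%:R + 1 = 0 :> 'I_3. Proof. exact: val_inj. Qed.

(** Coordinates on the logarithm vectors of [u] and [tau u] and the vector of ones; [lg (j + 1) u]
    is [lg j (tau u)]. *)
Definition log_coords (w : K) (s t h : R) := forall j, lg j w = s * lg j u + t * lg (j + 1) u + h.

Lemma log_coords_exist w : exists s t h, log_coords w s t h.
Proof.
pose h := (lg 0 w + lg 1 w + lg 2%:R w) / 3.
have [s [t [h0 h1]]] := lg_solve a7 hK hM htau (lg 0 w - h) (lg 1 w - h) Uu q0.
exists s, t, h => j; have sum := lg_sum a7 hK hM htau Uu.
have w0 : lg 0 w = s * lg 0 u + t * lg 1 u + h by rewrite -h0 subrK.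
have w1 : lg 1 w = s * lg 1 u + t * lg 2%:R u + h by rewrite -h1 subrK.
have [->|->|->] := ord3P j; rewrite ?(e01, e12, e20)//.
have -> : lg 2%:R w = 3 * h - lg 0 w - lg 1 w by rewrite /h; field.
have -> : lg 2%:R u = - lg 0 u - lg 1 u by move: sum; lra.
by rewrite w0 w1; have -> : lg 2%:R u = - lg 0 u - lg 1 u by [move: sum; lra]; ring.
Qed.

Lemma log_coords_unique w s t h s' t' h' : log_coords w s t h -> log_coords w s' t' h' ->
  [/\ s = s', t = t' & h = h'].
Proof.
move=> c c'; apply: (quad_coords_unique (lg_sum a7 hK hM htau Uu)) => //.
- by have := c 0; rewrite (c' 0) e01.
- by have := c 1; rewrite (c' 1) e12.
- by have := c 2%:R; rewrite (c' 2%:R) e20.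
Qed.

Lemma log_coords_mul w s t h (m n : int) e : w != 0 -> e = 1 \/ e = -1 -> log_coords w s t h ->
  log_coords (e * (u ^ m * tau u ^ n) * w) (s + m%:~R) (t + n%:~R) h.
Proof.
move=> w0 he c j; have [u0 _ _] := Uu.
have p0 : u ^ m * tau u ^ n != 0 by rewrite mulf_neq0 ?expfz_neq0// fmorph_eq0.
rewrite lgM//; last by rewrite mulf_neq0//; case: he => ->; rewrite ?oppr_eq0 oner_eq0.
have -> : lg j (e * (u ^ m * tau u ^ n)) = lg j (u ^ m * tau u ^ n).
  by case: he => ->; rewrite ?mul1r ?mulN1r ?lgN.
by rewrite (lg_comb hK htau)// (c j); ring.
Qed.

Lemma log_coords_norm w s t h : w != 0 -> log_coords w s t h -> `|\prod_(j < 3) sg j w| = expR (3 * h).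
Proof.
move=> w0 c; have sum := lg_sum a7 hK hM htau Uu.
have sgE j : `|sg j w| = expR (lg j w) by rewrite lnK ?posrE ?sg_norm_gt0.
rewrite (prod_ord3 _ 0) !normrM !sgE -!expRD !c !(e01, e12, e20); congr expR.
transitivity ((s + t) * (lg 0 u + lg 1 u + lg 2%:R u) + 3 * h); first ring.
by rewrite sum mulr0 add0r.
Qed.

Local Notation ideal w := [set w * v | v in OK].

Lemma ideal_unit w e : unit e -> ideal (e * w) = ideal w.
Proof.
move=> Ue; have [e0 Oe OV] := Ue; apply/seteqP; split=> _ [v Ov <-].
  by exists (e * v); [exact: (OKM hK hM)|rewrite mulrCA mulrA].
exists (e^-1 * v); first exact: (OKM hK hM).
by rewrite mulrACA mulfV// mul1r.
Qed.

Lemma ideal_eq w w' : w != 0 -> w' != 0 -> ideal w = ideal w' -> exists2 e, unit e & w' = e * w.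
Proof.
move=> w0 w'0 e.
have [x Ox wx] : ideal w' w by rewrite -e; exists 1; [exact: (OK1 hK hM)|rewrite mulr1].
have [y Oy wy] : ideal w w' by rewrite e; exists 1; [exact: (OK1 hK hM)|rewrite mulr1].
exists y; last by rewrite -wy mulrC.
have y0 : y != 0 by apply: contraNneq w'0 => y0; rewrite -wy y0 mulr0.
have xy : y^-1 = x by apply: (mulfI y0); apply: (mulfI w0); rewrite mulfV// mulr1 mulrA wy wx.
by split=> //; rewrite xy.
Qed.

(* A fundamental domain for the action of the units on the nonzero integers. *)
Definition generators (X : R) : set 'rV[int]_3 := [set m | 0 < sg 0 (elt rho m) /\
  exists s t h, [/\ 0 <= s < 1, 0 <= t < 1, expR (3 * h) <= X & log_coords (elt rho m) s t h]].

(** Generators of one ideal differ by a unit, which is a sign times [u ^ k * tau u ^ n]. The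
    half-open unit intervals force [k = n = 0], and positivity of the first conjugate excludes the
    sign -1. *)
Lemma generators_inj X m m' : generators X m -> generators X m' ->
  ideal (elt rho m) = ideal (elt rho m') -> m = m'.
Proof.
move=> [p0 [s [t [h [s01 t01 _ c]]]]] [p0' [s' [t' [h' [s01' t01' _ c']]]]] e.
have w0 : elt rho m != 0 by rewrite -(sg_eq0 iota tau 0) gt_eqF.
have w0' : elt rho m' != 0 by rewrite -(sg_eq0 iota tau 0) gt_eqF.
have [x Ux xE] := ideal_eq w0 w0' e.
have [k [n [z zP xz]]] := unit_span a7 hK hM htau Uu q0 umin Ux.
have := log_coords_mul k n w0 zP c; rewrite -xz -xE => /(log_coords_unique c')[es et _].
have k0 : k = 0.
  exact: fractional_shift s01 s01' es.
have n0 : n = 0.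
  exact: fractional_shift t01 t01' et.
move: xE; rewrite xz k0 n0 !expr0z !mulr1; case: zP => ->; first by rewrite mul1r => /(elt_inj a7 hK).
by move=> xE; move: p0'; rewrite xE mulN1r rmorphN oppr_gt0 => /lt_trans/(_ p0); rewrite ltxx.
Qed.

Lemma principal_idealsE (X : R) :
  [set I : set K | [/\ is_principal_ideal I, I <> [set 0] & (ideal_norm I)%:R <= X]] =
  (fun m => ideal (elt rho m)) @` generators X.
Proof.
apply/seteqP; split=> [I [[w Ow IE] I0 nI]|_ [m [p0 [s [t [h [s01 t01 hX c]]]]] <-]]; last first.
  have w0 : elt rho m != 0 by rewrite -(sg_eq0 iota tau 0) gt_eqF.
  split.
  - by exists (elt rho m) => //; apply/(OK_elt hK hM); exists m.
  - move=> e; have : ideal (elt rho m) (elt rho m) by exists 1; [exact: (OK1 hK hM)|rewrite mulr1].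
    by rewrite e => /eqP; rewrite (negPf w0).
  - rewrite (ideal_norm_elt a7 hK hM htau) -?(elt_eq0 a7 hK)//.
    by rewrite (log_coords_norm w0 c).
have w0 : w != 0.
  apply/eqP => w0; apply: I0; rewrite IE w0; apply/seteqP; split=> [_ [v _ <-]|_ ->].
    by rewrite mul0r.
  by exists 1; [exact: (OK1 hK hM)|rewrite mul0r].
have [s [t [h c]]] := log_coords_exist w.
(* The floors bring [s] and [t] into the half-open unit interval, and [e] makes the first conjugate
   positive. *)
pose e : K := if 0 < sg 0 (u ^ (- Num.floor s) * tau u ^ (- Num.floor t) * w) then 1 else -1.
have eP : e = 1 \/ e = -1 by rewrite /e; case: ifP; [left|right].
pose x := e * (u ^ (- Num.floor s) * tau u ^ (- Num.floor t)).
have Ue : unit e by case: eP => ->; [exact: (unit1 hK hM)|apply: (unitN hK hM); exact: (unit1 hK hM)].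
have Ux : unit x.
  apply: (unitM hK hM) => //; apply: (unitM hK hM); apply: (unitXz hK hM) => //.
  exact: unit_tau.
have [x0 Ox _] := Ux.
have /(OK_elt hK hM)[m mE] : OK (x * w) by exact: (OKM hK hM).
have cx := log_coords_mul (- Num.floor s) (- Num.floor t) w0 eP c.
have xw0 : x * w != 0 by rewrite mulf_neq0.
exists m; last by rewrite -mE ideal_unit.
split.
  rewrite -mE /x -mulrA; set y := _ * w; rewrite rmorphM /e -/y.
  have y0 : sg 0 y != 0.
    rewrite sg_eq0; have [u0 _ _] := Uu.
    by rewrite !mulf_neq0 ?expfz_neq0// fmorph_eq0.
  case: ifP => h0; first by rewrite rmorph1 mul1r.
  by rewrite rmorphN1 mulN1r oppr_gt0 lt_neqAle y0 leNgt h0.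
rewrite -mE; eexists _, _, h; split; last exact: cx.
- by rewrite rmorphN /= subr_ge0 floor_le_tmp ltrBlDl -intrD1 floorD1_gt.
- by rewrite rmorphN /= subr_ge0 floor_le_tmp ltrBlDl -intrD1 floorD1_gt.
- rewrite -(log_coords_norm xw0 cx) mE -(ideal_norm_elt a7 hK hM htau).
    by rewrite -mE ideal_unit// -IE.
  by rewrite -(elt_eq0 a7 hK) -mE.
Qed.

(** * Cutting the fundamental domain into rescaled pieces *)

Section pieces.
Context (M : nat).
Hypotheses (M0 : (0 < M)%N) (uM : forall j, `|lg j u| <= M%:R).

(** [M] bounds the logarithms of [u], so division by [M] gives directions with entries at most 1, as
    the count in a fixed cone requires. *)
Definition dir_p : 'rV[R]_3 := \row_k (lg k u / M%:R).
Definition dir_q : 'rV[R]_3 := \row_k (lg (k + 1) u / M%:R).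

Local Notation index := (bool * bool * 'I_M * 'I_M)%type.

(** Only the signs of the second and third conjugates vary; the first is positive on generators. *)
Definition octant (b : bool * bool) (k : 'I_3) : R :=
  (-1) ^+ (if k == 0 then false else if k == 1 then b.1 else b.2).

(** The signs move the octant to the positive one, and the exponential moves the subsquare [(i, j)]
    to the one at the origin. The exponents sum to zero over the coordinates, so the absolute
    determinant is unchanged. *)
Definition piece_matrix (x : index) : 'M[R]_3 := vdm *m diag_mx
  (\row_k (octant x.1.1 k * expR (- (x.1.2%:R * dir_p 0 k + x.2%:R * dir_q 0 k)))).

Definition piece (X : R) (x : index) : set 'rV[int]_3 :=
  [set m | cone_piece X (frame dir_p dir_q) (lat (piece_matrix x) m)].

Lemma octant_norm b k : `|octant b k| = 1. Proof. exact: normr_sign. Qed.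

Lemma lat_piece x m k : lat (piece_matrix x) m 0 k = sg k (elt rho m) *
  (octant x.1.1 k * expR (- (x.1.2%:R * dir_p 0 k + x.2%:R * dir_q 0 k))).
Proof. by rewrite {1}/lat /piece_matrix mulmxA mul_mx_diag sg_elt [LHS]mxE; congr (_ * _); rewrite mxE. Qed.

Lemma sum_dir_p : dir_p 0 0 + dir_p 0 1 + dir_p 0 2%:R = 0.
Proof. by rewrite !mxE -!mulrDl (lg_sum a7 hK hM htau Uu) mul0r. Qed.

Lemma sum_dir_q : dir_q 0 0 + dir_q 0 1 + dir_q 0 2%:R = 0.
Proof.
rewrite !mxE -!mulrDl !(e01, e12, e20).
rewrite [X in X / _](_ : _ = lg 0 u + lg 1 u + lg 2%:R u); last by rewrite [LHS]addrC addrA.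
by rewrite (lg_sum a7 hK hM htau Uu) mul0r.
Qed.

Lemma minor_dir : `|dir_p 0 0 * dir_q 0 1 - dir_p 0 1 * dir_q 0 0| = lgq u / M%:R ^+ 2.
Proof.
rewrite !mxE -(lg_minor a7 hK hM htau (c := 0) (d := 1) Uu)//.
rewrite -[M%:R in RHS]normr_nat -normrX -normf_div; congr `|_|.
by field; rewrite pnatr_eq0 -lt0n.
Qed.

Lemma det_frame_dir : \det (frame dir_p dir_q) != 0.
Proof.
rewrite (det_frame sum_dir_p sum_dir_q).
by rewrite mulf_neq0// -normr_gt0 minor_dir divr_gt0 ?exprn_gt0 ?ltr0n.
Qed.

Lemma dir_p_le1 k : `|dir_p 0 k| <= 1.
Proof. by rewrite mxE normrM normfV normr_nat ler_pdivrMr ?ltr0n// mul1r. Qed.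

Lemma dir_q_le1 k : `|dir_q 0 k| <= 1.
Proof. by rewrite mxE normrM normfV normr_nat ler_pdivrMr ?ltr0n// mul1r. Qed.

Lemma pieceP X (b : bool * bool) (i j : 'I_M) m : piece X (b, i, j) m <->
  (forall k, 0 < octant b k * sg k (elt rho m)) /\ exists s t h,
    [/\ 0 <= s < 1, 0 <= t < 1, expR (3 * h) <= X &
      log_coords (elt rho m) ((i%:R + s) / M%:R) ((j%:R + t) / M%:R) h].
Proof.
have cE k s t h : ((i%:R + s) / M%:R) * lg k u + ((j%:R + t) / M%:R) * lg (k + 1) u + h =
    (s * dir_p 0 k + t * dir_q 0 k + h) + (i%:R * dir_p 0 k + j%:R * dir_q 0 k).
  by rewrite !mxE; ring.
rewrite /piece /= (cone_pieceP _ _ det_frame_dir); split=> [[s [t [h [s01 t01 hX e]]]]|[pos [s [t [h [s01 t01 hX c]]]]]].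
  have oE k : octant b k * sg k (elt rho m) =
      expR (((i%:R + s) / M%:R) * lg k u + ((j%:R + t) / M%:R) * lg (k + 1) u + h).
    rewrite cE expRD -e lat_piece /= -!mulrA -expRD addNr expR0 mulr1 mulrC.
    by [].
  split=> [k|]; first by rewrite oE expR_gt0.
  exists s, t, h; split=> // k.
  transitivity (ln `|octant b k * sg k (elt rho m)|); first by rewrite normrM octant_norm mul1r.
  by rewrite oE gtr0_norm ?expR_gt0// expRK.
exists s, t, h; split=> // k; rewrite lat_piece /= mulrCA mulrA.
have -> : octant b k * sg k (elt rho m) = expR (lg k (elt rho m)).
  rewrite lnK ?posrE ?normr_gt0; last first.
    by apply: contraTneq (pos k) => ->; rewrite mulr0 ltxx.
  by rewrite -[RHS]mul1r -(octant_norm b k) -normrM gtr0_norm.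
by rewrite c cE -expRD addrK.
Qed.

Lemma piece_disjoint X x y m : piece X x m -> piece X y m -> x = y.
Proof.
move: x y => [[b i] j] [[b' i'] j'] /pieceP[pos [s [t [h [s01 t01 _ c]]]]] /pieceP[pos' [s' [t' [h' [s01' t01' _ c']]]]].
have [es et _] := log_coords_unique c c'.
have Mn0 : M%:R^-1 != 0 :> R by rewrite invr_eq0 pnatr_eq0 -lt0n.
have bb : b = b'.
  have := sign_mul_gt0 (pos 1); have := sign_mul_gt0 (pos 2%:R).
  have := sign_mul_gt0 (pos' 1); have := sign_mul_gt0 (pos' 2%:R).
  by rewrite /=; case: (b) (b') => b1 b2 [b1' b2'] /= -> -> -> ->.
have sh (n n' : nat) (r r' : R) : 0 <= r < 1 -> 0 <= r' < 1 -> (n%:R + r) / M%:R = (n'%:R + r') / M%:R -> n = n'.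
  by move=> r01 r01' /(mulIf Mn0); exact: fractional_shift_nat.
by rewrite bb (val_inj (sh _ _ _ _ s01 s01' es)) (val_inj (sh _ _ _ _ t01 t01' et)).
Qed.

Lemma generators_pieces X : generators X = \bigcup_x piece X x.
Proof.
have Mr0 : 0 < M%:R :> R by rewrite ltr0n.
apply/seteqP; split=> [m [p0 [s [t [h [s01 t01 hX c]]]]]|m [[[b i] j] _ /pieceP[pos [s [t [h [s01 t01 hX c]]]]]]].
  have w0 : elt rho m != 0 by rewrite -(sg_eq0 iota tau 0) gt_eqF.
  have tr r : 0 <= r < 1 -> exists (i : 'I_M) (r' : R), 0 <= r' < 1 /\ r = (i%:R + r') / M%:R.
    move=> /andP[r0 r1]; have [h1 h2] := truncnP (mulr_ge0 r0 (ltW Mr0)).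
    have lt : (Num.truncn (r * M%:R) < M)%N.
      by rewrite -(ltr_nat R); apply: le_lt_trans h1 _; rewrite gtr_pMl.
    exists (Ordinal lt), (r * M%:R - (Num.truncn (r * M%:R))%:R); rewrite /= subr_ge0 h1 ltrBlDl h2.
    by split=> //; rewrite addrC subrK mulfK// gt_eqF.
  have [i [s' [s01' sE]]] := tr s s01; have [j [t' [t01' tE]]] := tr t t01.
  exists (sg 1 (elt rho m) < 0, sg 2%:R (elt rho m) < 0, i, j) => //; apply/pieceP; split.
    move=> k; have hk : sg k (elt rho m) != 0 by rewrite sg_eq0.
    move: hk; have [->|->|->] := ord3P k => hk.
    - by rewrite /octant /= expr0 mul1r.
    - by rewrite /octant [_ * _]/= -[X in 0 < X]normrEsign ?num_real// normr_gt0.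
    - by rewrite /octant [_ * _]/= -[X in 0 < X]normrEsign ?num_real// normr_gt0.
  by exists s', t', h; rewrite -sE -tE.
split; first by have := pos 0; rewrite /octant /= expr0 mul1r.
have fr (k : 'I_M) (r : R) : 0 <= r < 1 -> 0 <= (k%:R + r) / M%:R < 1.
  move=> /andP[r0 r1]; rewrite divr_ge0 ?addr_ge0//= ltr_pdivrMr// mul1r.
  by apply: (@lt_le_trans _ _ (k%:R + 1)); rewrite ?ltrD2l// natr1 ler_nat.
by exists ((i%:R + s) / M%:R), ((j%:R + t) / M%:R), h; split=> //; exact: fr.
Qed.

Lemma det_piece x : `|\det (piece_matrix x)| = `|\det vdm|.
Proof.
rewrite det_mulmx normrM det_diag normr_prod; under eq_bigr => k _ do
  rewrite mxE normrM octant_norm mul1r ger0_norm ?expR_ge0//.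
rewrite (prod_ord3 _ 0) add0r -!expRD.
set E := (X in expR X); have -> : E = 0; last by rewrite expR0 mulr1.
have e2 : 1 + 1 = 2%:R :> 'I_3 by exact: val_inj.
rewrite /E e2; transitivity (- (x.1.2%:R * (dir_p 0 0 + dir_p 0 1 + dir_p 0 2%:R) + x.2%:R * (dir_q 0 0 + dir_q 0 1 + dir_q 0 2%:R))).
  by ring.
by rewrite sum_dir_p sum_dir_q !mulr0 addr0 oppr0.
Qed.

(** The diagonal factors have product 1 in absolute value, which is read off from [det_piece]. *)
Lemma norm_ge1_piece x : norm_ge1 (piece_matrix x).
Proof.
move=> m m0; have := norm_ge1_vdm a7 hK htau m0.
suff -> : \prod_(j < 3) `|lat (piece_matrix x) m 0 j| = \prod_(j < 3) `|lat vdm m 0 j| by [].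
have dv := det_piece x; move: dv; rewrite det_mulmx normrM -[RHS]mulr1.
move=> /mulfI; rewrite normr_eq0 (det_vdm_neq0 a7 hK htau) => /(_ isT); rewrite det_diag normr_prod => d1.
rewrite -[RHS]mulr1 -[X in _ = _ * X]d1 -big_split /=; apply: eq_bigr => k _.
by rewrite lat_piece sg_elt normrM mxE.
Qed.

Lemma finite_piece (L : R) x : 0 < L -> finite_set (piece (L ^+ 3) x).
Proof.
move=> L0; have := count_finite 0 (norm_ge1_piece x) L0 dir_p_le1 dir_q_le1 det_frame_dir.
by apply: sub_finite_set => m; rewrite /= addr0.
Qed.

Lemma finite_generators (L : R) : 0 < L -> finite_set (generators (L ^+ 3)).
Proof. by move=> L0; rewrite generators_pieces; apply: bigcup_finite => // x _; exact: finite_piece. Qed.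

(** There are [4 * M ^ 2] pieces: four sign patterns and [M ^ 2] subsquares. All have the same main
    term, proportional to [lgq u / M ^+ 2], so [M] cancels there and stays only in the error. *)
Lemma count_generators (L : R) : 1 <= L ->
  `|(ncard (generators (L ^+ 3)))%:R - 4 * lgq u / `|\det vdm| * L ^+ 3| <=
  4 * M%:R ^+ 2 * (count_constant * L ^+ 2).
Proof.
move=> L1; have L0 : 0 < L := lt_le_trans ltr01 L1.
have M1 : M%:R != 0 :> R by rewrite pnatr_eq0 -lt0n.
have dv : `|\det vdm| != 0 by rewrite normr_eq0 (det_vdm_neq0 a7 hK htau).
rewrite generators_pieces (@ncard_bigcup R); last 2 first.
- by move=> x; exact: finite_piece.
- by move=> x y m; exact: piece_disjoint.
have cI : #|{: index}| = (4 * M ^ 2)%N by rewrite !card_prod !card_bool !card_ord; ring.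
have -> : 4 * lgq u / `|\det vdm| * L ^+ 3 =
    \sum_(x : index) L ^+ 3 * (lgq u / M%:R ^+ 2) / `|\det vdm|.
  rewrite sumr_const cI -[RHS]mulr_natl natrM natrX.
  by field; rewrite M1 dv.
rewrite -sumrB; apply: le_trans (ler_norm_sum _ _ _) _.
apply: (@le_trans _ _ (\sum_(x : index) count_constant * L ^+ 2)); last first.
  by rewrite sumr_const cI -[leLHS]mulr_natl natrM natrX.
apply: ler_sum => x _; rewrite -minor_dir -(det_piece x).
apply: lattice_count => //.
- by rewrite -normr_gt0 det_piece normr_gt0 (det_vdm_neq0 a7 hK htau).
- exact: norm_ge1_piece.
- exact: dir_p_le1.
- exact: dir_q_le1.
- exact: det_frame_dir.
- exact: sum_dir_p.
- exact: sum_dir_q.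
Qed.

End pieces.

End gluing.

(** * The counting theorem *)

Section final_bounds.
Context {R : realType}.

(** [expR (- 1 / 2) >= 1 / 2] gives [expR 1 <= 4]. *)
Lemma ln_ge1 (x : R) : 4 <= x -> 1 <= ln x.
Proof.
move=> x4; have x0 : 0 < x by lra.
have h : 1 / 2 <= expR (- (1 / 2)) :> R.
  by have := expR_ge1Dx (- (1 / 2) : R); lra.
have h2 : expR (1 / 2) <= 2 :> R.
  rewrite -[leLHS]invrK -expRN invf_ple ?posrE ?expR_gt0//.
  by move: h; rewrite mul1r.
have h4 : expR 1 <= 2 ^+ 2 :> R.
  have -> : expR 1 = expR (1 / 2) ^+ 2 :> R by rewrite expr2 -expRD; congr expR; field.
  by rewrite lerXn2r ?nnegrE ?expR_ge0.
rewrite -[leLHS]expRK ler_ln ?posrE ?expR_gt0//; apply: le_trans h4 _.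
by rewrite (_ : 2 ^+ 2 = 4 :> R)//; ring.
Qed.

(** The factors are compared one by one: 60 and 80 with [3 ^ 4], 180 with [3 ^ 5], and 30 and 36,
    each cubed, with [3 ^ 4] cubed. *)
Lemma count_constant_le : 60 * 80 * count_constant <= 3 ^+ 37 :> R.
Proof.
have -> : 3 ^+ 37 = (3 ^+ 4 * 3 ^+ 4) * (3 ^+ 5 * ((3 ^+ 4 * 3 ^+ 4) ^+ 3)) :> R.
  by rewrite -!exprD -exprM -!exprD.
have e4 : 3 ^+ 4 = 81 :> R by ring.
have e5 : 3 ^+ 5 = 243 :> R by ring.
rewrite e4 e5 /count_constant ler_pM ?mulr_ge0 ?exprn_ge0//; first by rewrite ler_pM//; lra.
rewrite ler_pM ?exprn_ge0 ?mulr_ge0//; first lra.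
by rewrite lerXn2r ?nnegrE ?mulr_ge0// ler_pM//; lra.
Qed.

Lemma leading_constant_ge : 3 ^+ 37 <= 3 ^+ 900 * (3 / 2) `^ (5 / 3) :> R.
Proof.
have h : 1 <= (3 / 2) `^ (5 / 3) :> R.
  have h32 : 1 <= 3 / 2 :> R by lra.
  have h53 : 0 <= 5 / 3 :> R by lra.
  by have := ler_powR h32 h53; rewrite powRr0.
rewrite -[leLHS]mulr1 ler_pM ?exprn_ge0// ler_weXn2l//; lra.
Qed.

(** Used with [l = ln a ^+ 2], [r] the regulator, [c = a ^+ 2] and [D = a ^+ 2 + 3 * a + 9]. *)
Lemma density_arith (l r c D : R) : 0 <= l -> 0 < c -> c <= D -> D <= 2 * c -> l / 48 <= r -> r <= 4 * l ->
  l / c / 24 <= 4 * r / D <= 16 * (l / c).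
Proof.
move=> l0 c0 D1 D2 r1 r2; have D0 : 0 < D := lt_le_trans c0 D1.
apply/andP; split.
  rewrite ler_pdivlMr// (_ : l / c / 24 * D = l * (D / (24 * c))); last by field; rewrite gt_eqF.
  apply: (@le_trans _ _ (l * (1 / 12))); last by lra.
  by rewrite ler_wpM2l// ler_pdivrMr; lra.
rewrite ler_pdivrMr//; apply: (@le_trans _ _ (16 * l)); first by lra.
rewrite (_ : 16 * (l / c) * D = 16 * l * (D / c)); last by field; rewrite gt_eqF.
by rewrite ler_peMr ?mulr_ge0// ler_pdivlMr// mul1r.
Qed.

(** Used with [b = a ^+ 2]. The error is at most [l / (48 * b) * L ^+ 3] exactly when
    [4800 * C * b <= L] (for [l > 0]); this halves the lower density constant 1/24 and leaves the
    upper one, 16, below 17. *)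
Lemma error_arith (C l b L P d : R) : 0 <= l -> 0 < b -> 0 < L -> 60 * 80 * C * b <= L ->
  `|P - d * L ^+ 3| <= 100 * C * l * L ^+ 2 -> l / b / 24 <= d <= 16 * (l / b) ->
  1 / 48 * (l / b) * L ^+ 3 <= P /\ P <= 17 * (l / b) * L ^+ 3.
Proof.
move=> l0 b0 L0 hL herr /andP[d1 d2].
have hE : 100 * C * l * L ^+ 2 <= 1 / 48 * (l / b) * L ^+ 3.
  rewrite (_ : 1 / 48 * (l / b) * L ^+ 3 = (L / (48 * b)) * (l * L ^+ 2)); last by field; rewrite gt_eqF.
  rewrite (_ : 100 * C * l * L ^+ 2 = 100 * C * (l * L ^+ 2)); last by ring.
  rewrite ler_wpM2r ?mulr_ge0 ?exprn_ge0 ?(ltW L0)// ler_pdivlMr ?mulr_gt0//; lra.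
have L3 : 0 <= L ^+ 3 by rewrite exprn_ge0 ?ltW.
have h1 : l / b / 24 * L ^+ 3 <= d * L ^+ 3 by rewrite ler_wpM2r.
have h2 : d * L ^+ 3 <= 16 * (l / b) * L ^+ 3 by rewrite ler_wpM2r.
have q0 : 0 <= l / b * L ^+ 3 by rewrite mulr_ge0 ?divr_ge0 ?(ltW b0).
have := le_trans herr hE; rewrite ler_norml => /andP[h3 h4].
have e1 : l / b / 24 * L ^+ 3 = (l / b * L ^+ 3) / 24 by ring.
have e2 (k : R) : k * (l / b) * L ^+ 3 = k * (l / b * L ^+ 3) by rewrite -[LHS]mulrA.
move: h1 h2 h3 h4; rewrite e1 !e2; move: (l / b * L ^+ 3) q0 => q q0.
move: (d * L ^+ 3) => D h1 h2 h3 h4; split; lra.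
Qed.

Lemma powR_third (x : R) : 0 <= x -> (x `^ (1 / 3)) ^+ 3 = x /\ (x `^ (1 / 3)) ^+ 2 = x `^ (2 / 3).
Proof.
move=> x0; have e3 : 1 / 3 * 3 = 1 :> R by field.
have e2 : 1 / 3 * 2 = 2 / 3 :> R by field.
by rewrite -!powR_mulrn ?powR_ge0// -!powRrM e3 e2 powRr1.
Qed.

End final_bounds.

Section counting_theorem.
Context (R : realType) (a : int) (K : fieldExtType rat) (iota : {rmorphism K -> R}) (rho : K).
Hypotheses (a7 : 7 <= a) (hK : is_simplest_cubic_field a iota rho) (hM : is_monogenic rho).

Lemma regulator_bounds : ln a%:~R ^+ 2 / 48 <= regulator K R <= 4 * ln a%:~R ^+ 2.
Proof.
have [tau htau] := exists_automorphism a7 hK.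
have [u [Uu q0 urho umin]] := exists_minimal_unit a7 hK hM htau.
rewrite (regulatorE a7 hK hM htau Uu q0 umin); apply/andP; split.
  exact: (lgq_lower a7 hK hM htau).
exact: le_trans urho (lgq_rho_le a7 hK htau).
Qed.

Lemma ideal_density_bounds : (ln a%:~R ^+ 2 / a%:~R ^+ 2) / 24 <= ideal_density K R <=
  16 * (ln a%:~R ^+ 2 / a%:~R ^+ 2).
Proof.
have a0 : 7 <= a%:~R :> R by rewrite (_ : 7 = 7%:~R :> R) ?ler_int// rmorph_nat.
have [tau htau] := exists_automorphism a7 hK.
rewrite (ideal_densityE a7 hK hM htau); move: regulator_bounds => /andP[].
set l := ln _ ^+ 2; move: (regulator K R) => r; set b : R := a%:~R in a0 *.
have l0 : 0 <= l by exact: sqr_ge0.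
move=> r1 r2; apply: density_arith => //; first by rewrite exprn_gt0//; lra.
  by lra.
by rewrite expr2; nra.
Qed.

Lemma principal_ideals_count (L : R) : 1 <= L ->
  `|(nb_principal_ideals K (L ^+ 3))%:R - ideal_density K R * L ^+ 3| <=
  100 * count_constant * ln a%:~R ^+ 2 * L ^+ 2.
Proof.
move=> L1; have L0 : 0 < L := lt_le_trans ltr01 L1.
have a0 : 7 <= a%:~R :> R by rewrite (_ : 7 = 7%:~R :> R) ?ler_int// rmorph_nat.
have ln1a : 1 <= ln a%:~R :> R by apply: ln_ge1; lra.
have [tau htau] := exists_automorphism a7 hK.
have [u [Uu q0 urho umin]] := exists_minimal_unit a7 hK hM htau.
(* Every [|lg j u|] is at most [4 * ln a], because [3 / 4 * lg j u ^+ 2 <= lgq u <= lgq rho <= 4 *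
   ln a ^+ 2]. As [ln a >= 1], this [M] is at most [5 * ln a], and [4 * M ^+ 2] at most
   [100 * ln a ^+ 2]. *)
pose M := (Num.truncn (4 * ln a%:~R : R)).+1.
have l4 : 0 <= 4 * ln a%:~R :> R by lra.
have [M1 M2] := truncnP l4.
have MS : M%:R = (Num.truncn (4 * ln a%:~R : R))%:R + 1 :> R by rewrite natr1.
have uM j : `|lg iota tau j u| <= M%:R.
  apply: le_trans (_ : 4 * ln a%:~R <= _); last by rewrite MS; lra.
  rewrite -(@ler_pXn2r _ 2) ?nnegrE// real_normK ?num_real//.
  have := lgq_ge a7 hK hM htau j Uu; have := lgq_rho_le a7 hK htau.
  rewrite exprMn; move: urho; move: (lgq _ _ u) (lgq _ _ rho) (_ ^+ 2) (ln _ ^+ 2) (sqr_ge0 (ln a%:~R : R)).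
  by move=> x y z w w0; lra.
have M5 : M%:R <= 5 * ln a%:~R :> R by rewrite MS; lra.
have M0 : (0 < M)%N by [].
have := count_generators a7 hK hM htau Uu q0 M0 uM L1.
rewrite (det_vdm a7 hK htau) (ideal_densityE a7 hK hM htau) (regulatorE a7 hK hM htau Uu q0 umin).
rewrite /nb_principal_ideals (principal_idealsE a7 hK hM htau Uu q0) ncard_image_inj; last 2 first.
- exact: (finite_generators a7 hK hM htau Uu q0 M0 uM).
- by move=> m m'; exact: (generators_inj a7 hK hM htau Uu q0 umin).
move=> /le_trans; apply.
have -> : 100 * count_constant * ln a%:~R ^+ 2 * L ^+ 2 =
  4 * (5 * ln a%:~R) ^+ 2 * (count_constant * L ^+ 2) :> R by ring.
rewrite ler_wpM2r ?mulr_ge0 ?count_constant_ge0 ?exprn_ge0 ?(ltW L0)//.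
by rewrite ler_wpM2l// lerXn2r ?nnegrE//; lra.
Qed.

End counting_theorem.

Theorem theorem3p3 (R : realType) :
  let c1 : R := 3 ^+ 900 * (3 / 2) `^ (5 / 3) in
  (forall (a : int) (K : fieldExtType rat) (iota : {rmorphism K -> R}) (rho : K),
     7 <= a -> is_simplest_cubic_field a iota rho -> is_monogenic rho ->
     forall x : R, 1 <= x ->
       `| (nb_principal_ideals K x)%:R - ideal_density K R * x |
         <= c1 * ln (a%:~R) `^ (10 / 3) * x `^ (2 / 3))
  /\
  (exists c' c'' : R, [/\ 0 < c', 0 < c'' &
     forall (a : int) (K : fieldExtType rat) (iota : {rmorphism K -> R}) (rho : K),
       7 <= a -> is_simplest_cubic_field a iota rho -> is_monogenic rho ->
       forall x : R, c1 ^+ 3 * a%:~R ^+ 6 * ln (a%:~R) ^+ 4 <= x ->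
         c' * (ln (a%:~R) ^+ 2 / a%:~R ^+ 2) * x <= (nb_principal_ideals K x)%:R
         /\ (nb_principal_ideals K x)%:R
              <= c'' * (ln (a%:~R) ^+ 2 / a%:~R ^+ 2) * x]).
Proof.
move=> c1; have c37 : 3 ^+ 37 <= c1 := leading_constant_ge.
(* From here [c1] is an arbitrary real above [3 ^+ 37], so its large power is never evaluated. *)
move: c1 c37 => c1 c37; have cC : 60 * 80 * count_constant <= c1 := le_trans count_constant_le c37.
have C0 : 0 <= count_constant :> R := count_constant_ge0.
have a_ge (a : int) : 7 <= a -> 7 <= a%:~R :> R.
  by move=> a7; rewrite (_ : 7 = 7%:~R :> R) ?ler_int// rmorph_nat.
have ln_a (a : int) : 7 <= a -> 1 <= ln a%:~R :> R.
  by move=> /a_ge a0; apply: ln_ge1; apply: le_trans a0; rewrite ler_nat.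
split=> [a K iota rho a7 hK hM x x1|].
  have x0 : 0 <= x := le_trans ler01 x1.
  have [x3 x2] := powR_third x0.
  have L1 : 1 <= x `^ (1 / 3) by have := ler_powR x1 (_ : 0 <= 1 / 3); rewrite powRr0; apply; rewrite divr_ge0.
  have := principal_ideals_count a7 hK hM L1; rewrite x3 x2 => /le_trans; apply.
  have l0 := le_trans ler01 (ln_a _ a7).
  rewrite ler_wpM2r ?powR_ge0// ler_pM ?mulr_ge0//.
    by apply: le_trans cC; rewrite ler_wpM2r// -natrM ler_nat.
  (* The exponent 2 is raised to 10/3, which is allowed because [ln a >= 1]. *)
  rewrite -powR_mulrn//.
  by apply: ler_powR; [exact: ln_a|rewrite ler_pdivlMr// -natrM ler_nat].
exists (1 / 48), 17; split=> // a K iota rho a7 hK hM x hx.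
have c0 : 0 < c1 by apply: lt_le_trans c37; rewrite exprn_gt0.
have a0 : 0 < a%:~R :> R by apply: lt_le_trans (a_ge _ a7).
(* Since [ln a ^+ 4 >= 1], the threshold gives [x] a cube root of at least [c1 * a ^+ 2], the size
   at which the main term beats the error. *)
have ax : (c1 * a%:~R ^+ 2) ^+ 3 <= x.
  apply: le_trans hx; rewrite exprMn -exprM ler_peMr ?mulr_ge0 ?exprn_ge0 ?(ltW c0) ?(ltW a0)//.
  by rewrite exprn_ege1// ln_a.
have x0 : 0 <= x by apply: le_trans ax; rewrite exprn_ge0 ?mulr_ge0 ?exprn_ge0 ?(ltW c0) ?(ltW a0).
have [x3 _] := powR_third x0.
have cL : c1 * a%:~R ^+ 2 <= x `^ (1 / 3).
  by rewrite -(@ler_pXn2r _ 3) ?nnegrE ?x3 ?powR_ge0 ?mulr_ge0 ?exprn_ge0 ?(ltW c0) ?(ltW a0).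
have L1 : 1 <= x `^ (1 / 3).
  apply: le_trans cL; rewrite -[leLHS]mulr1 ler_pM//.
    by apply: le_trans c37; apply: exprn_ege1; rewrite ler1n.
  by apply: exprn_ege1; apply: le_trans (a_ge _ a7); rewrite ler1n.
have := error_arith (sqr_ge0 _) _ (lt_le_trans ltr01 L1) _ (principal_ideals_count a7 hK hM L1) (ideal_density_bounds a7 hK hM).
rewrite x3; apply; first by rewrite exprn_gt0.
by apply: le_trans cL; rewrite ler_wpM2r ?exprn_ge0 ?(ltW a0).
Qed.
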